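(* Let $R$ be an integral domain with field of fractions $Q(R)$ and let $M$ be a torsion-free $R$-module. Then there exist a $Q(R)$-module $N$ and an injective $R$-module homomorphism $i: M\to N$ such that $C^*(N)\times_F Q(R)^\times$ is the $C^*$-envelope of $C^*(M)\times_F R^\times$.
   Context: For an integral domain $R$, $R^\times = R\setminus\{0\}$ is its multiplicative semigroup. For an $R$-module $M$, regarded as a discrete abelian group, the Fock semicrossed product $C^*(M)\times_F R^\times$ is the norm-closed subalgebra of $B(\ell^2(M)\otimes\ell^2(R^\times))$ generated by the operators $U^m$ ($m\in M$) and $S_r$ ($r\in R^\times$) given on the standard orthonormal basis by $U^m(v_n\otimes u_s)=v_{sm+n}\otimes u_s$ and $S_r(v_n\otimes u_s)=v_n\otimes u_{rs}$. The algebra $C^*(N)\times_F Q(R)^\times$ is defined in the same way from the integral domain (field) $Q(R)$ and the $Q(R)$-module $N$. The $C^*$-envelope of a unital operator algebra $\mathcal{A}$ is the $C^*$-algebra $C^*_{env}(\mathcal{A})$ with a unital completely isometric homomorphism $\iota:\mathcal{A}\to C^*_{env}(\mathcal{A})$ whose image generates it, such that for any unital completely isometric homomorphism $j:\mathcal{A}\to B$ into a $C^*$-algebra $B$ with $B=C^*(j(\mathcal{A}))$ there is a surjective $*$-homomorphism $B\to C^*_{env}(\mathcal{A})$ taking $j(a)$ to $\iota(a)$ for all $a\in\mathcal{A}$. *)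

(* Defs.v *)
From HB Require Import structures.
From mathcomp Require Import all_boot all_order all_algebra.
From mathcomp Require Import complex fraction sesquilinear.
From mathcomp Require Import all_classical all_reals ereal esum topology normedtype numfun.
From mathcomp Require Import ring lra.

Set Implicit Arguments.
Unset Strict Implicit.
Unset Printing Implicit Defensive.
Import Order.TTheory GRing.Theory Num.Theory.
Import numFieldNormedType.Exports ComplexField.Normc.

Local Open Scope classical_set_scope.
Local Open Scope ring_scope.

HB.mixin Record isCStarAlgebra (K : realType) B & GRing.Algebra K[i] B := {
  cnorm : B -> K;
  adj : B -> B;
  cnorm_eq0 : forall a, cnorm a = 0 -> a = 0;
  cnormD : forall a b, cnorm (a + b) <= cnorm a + cnorm b;
  cnormZ : forall (c : K[i]) a, cnorm (c *: a) = normc c * cnorm a;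
  cnormM : forall a b, cnorm (a * b) <= cnorm a * cnorm b;
  cnorm_complete : forall u : nat -> B,
    (forall e : K, 0 < e -> exists N, forall m n, (N <= m)%N -> (N <= n)%N ->
       cnorm (u m - u n) < e) ->
    exists l, cnorm (u n - l) @[n --> \oo] --> (0 : K);
  adjK : involutive adj;
  adjD : {morph adj : a b / a + b};
  adjZ : forall (c : K[i]) a, adj (c *: a) = c^* *: adj a;
  adjM : forall a b, adj (a * b) = adj b * adj a;
  cnorm_adjM : forall a, cnorm (adj a * a) = cnorm a ^+ 2
}.

#[short(type="cstarType")]
HB.structure Definition CStarAlgebra (K : realType) :=
  {B of isCStarAlgebra K B & GRing.Algebra K[i] B}.

Arguments cnorm {K s} _ : rename.
Arguments adj {K s} _ : rename.

Section OperatorAlgebras.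
Context {K : realType}.

Definition norm_closed (B : cstarType K) (A : set B) : Prop :=
  forall a, (forall e : K, 0 < e -> exists2 b, A b & cnorm (a - b) < e) -> A a.

Definition subalgebra (B : cstarType K) (A : set B) : Prop :=
  [/\ A 0, forall (c : K[i]) a b, A a -> A b -> A (c *: a + b)
    & forall a b, A a -> A b -> A (a * b)].

Definition closed_algebra (B : cstarType K) : set B -> set B :=
  smallest [set A | subalgebra A /\ norm_closed A].

Definition cstar_algebra (B : cstarType K) : set B -> set B :=
  smallest [set A | [/\ subalgebra A, norm_closed A & forall a, A a -> A (adj a)]].

(* M acts on the Hilbert B-module B^n, whose norm is |b|^2 = |sum_i b_i^* b_i|;
   the operator norm of this action is the C*-norm of M_n(B). When B is the
   algebra of bounded operators on H, it is the norm of M on the n-fold direct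
   sum of H. *)
Definition mxnorm (B : cstarType K) n (M : 'M[B]_n) : \bar K :=
  let colnorm (b : 'cV[B]_n) : K :=
    Num.sqrt (cnorm (\sum_i adj (b i 0) * b i 0)) in
  ereal_sup [set (colnorm (M *m b))%:E | b in [set b | colnorm b <= 1]].

(* Homomorphisms on a subalgebra A of B are total functions on B of which only
   the values on A matter. *)
Definition completely_isometric (B C : cstarType K) (A : set B) (j : B -> C) : Prop :=
  forall n (M : 'M[B]_n), (forall k l, A (M k l)) -> mxnorm (map_mx j M) = mxnorm M.

Definition unital_ci_hom (B C : cstarType K) (A : set B) (j : B -> C) : Prop :=
  [/\ j 1 = 1,
      forall (c : K[i]) a b, A a -> A b -> j (c *: a + b) = c *: j a + j b,
      forall a b, A a -> A b -> j (a * b) = j a * j b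
    & completely_isometric A j].

(* The C*-subalgebra E of C is a C*-envelope of the unital subalgebra A of B. *)
Definition is_cstar_envelope (B C : cstarType K) (A : set B) (E : set C) : Prop :=
  exists iota : B -> C, [/\ unital_ci_hom A iota, cstar_algebra (iota @` A) = E
    & forall (D : cstarType K) (j : B -> D),
        unital_ci_hom A j -> cstar_algebra (j @` A) = setT ->
        exists pi : {lrmorphism D -> C},
          [/\ {morph pi : d / adj d}, range pi = E
            & forall a, A a -> pi (j a) = iota a]].

End OperatorAlgebras.

Section NonnegativeSums.
Context {K : realType} {X : choiceType}.
Implicit Types p q u v : X -> K.

(* Unordered sums over X of nonnegative reals. *)
Definition nnsummable p : Prop := (\esum_(x in [set: X]) (p x)%:E < +oo)%E.
Definition nnsum p : K := fine (\esum_(x in [set: X]) (p x)%:E).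

Lemma nnsumE p : (forall x, 0 <= p x) -> nnsummable p ->
  (\esum_(x in [set: X]) (p x)%:E = (nnsum p)%:E)%E.
Proof.
move=> p0 ps; rewrite /nnsum fineK// fin_numElt ps andbT.
by rewrite (lt_le_trans (ltNyr 0))// esum_ge0// => x _; rewrite lee_fin.
Qed.

Lemma le_nnsummable p q : (forall x, p x <= q x) -> nnsummable q -> nnsummable p.
Proof. by move=> pq; apply: le_lt_trans; apply: le_esum => x _; rewrite lee_fin. Qed.

Lemma nnsum_ge0 p : (forall x, 0 <= p x) -> 0 <= nnsum p.
Proof. by move=> p0; apply/fine_ge0/esum_ge0 => x _; rewrite lee_fin. Qed.

Lemma le_nnsum p q : (forall x, 0 <= p x) -> (forall x, p x <= q x) ->
  nnsummable q -> nnsum p <= nnsum q.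
Proof.
move=> p0 pq sq; have sp := le_nnsummable pq sq.
have q0 x : 0 <= q x by apply: le_trans (pq x).
rewrite -lee_fin -!nnsumE//; apply: le_esum => x _; by rewrite lee_fin.
Qed.

Lemma nnsumD p q : (forall x, 0 <= p x) -> (forall x, 0 <= q x) ->
  nnsummable p -> nnsummable q ->
  nnsummable (fun x => p x + q x) /\ nnsum (fun x => p x + q x) = nnsum p + nnsum q.
Proof.
move=> p0 q0 sp sq.
have e : (\esum_(x in [set: X]) (p x + q x)%:E = (nnsum p + nnsum q)%:E)%E.
  rewrite EFinD -!nnsumE// -esumD// => x _; by rewrite lee_fin.
by split; rewrite /nnsummable /nnsum e// ltry.
Qed.

Lemma nnsumZ (t : K) p : 0 <= t -> (forall x, 0 <= p x) -> nnsummable p ->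
  nnsummable (fun x => t * p x) /\ nnsum (fun x => t * p x) = t * nnsum p.
Proof.
move=> t0 p0 sp.
have e : (\esum_(x in [set: X]) (t * p x)%:E = (t * nnsum p)%:E)%E.
  rewrite EFinM -nnsumE// /esum -ereal_supZl//; last first.
    by apply/set0P; exists (\sum_(x \in set0) (p x)%:E)%E; exists set0 => //; exact: fsets_set0.
  congr ereal_sup; apply/seteqP; split => [_ [F [fF _] <-]|_ [_ [F [fF _] <-] <-]] /=.
    exists (\sum_(x \in F) (p x)%:E)%E; first by exists F.
    by rewrite ge0_mule_fsumr// => x; rewrite lee_fin.
  exists F; first by split.
  by rewrite ge0_mule_fsumr// => x; rewrite lee_fin.
by split; rewrite /nnsummable /nnsum e// ltry.
Qed.

Lemma nnsum_seq_le p (r : seq X) : (forall x, 0 <= p x) -> nnsummable p -> uniq r ->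
  \sum_(x <- r) p x <= nnsum p.
Proof.
move=> p0 sp ur; rewrite -lee_fin -nnsumE// -sumEFin fsbig_seq//=.
by apply: ereal_sup_ubound; exists [set` r].
Qed.

Lemma nnsum_seq_bound p (c : K) : (forall x, 0 <= p x) ->
  (forall r : seq X, uniq r -> \sum_(x <- r) p x <= c) ->
  nnsummable p /\ nnsum p <= c.
Proof.
move=> p0 bc.
have e : (\esum_(x in [set: X]) (p x)%:E <= c%:E)%E.
  apply: ge_ereal_sup => _ [F [fF _] <-].
  by rewrite fsbig_finite//= sumEFin lee_fin bc.
have sp : nnsummable p by apply: le_lt_trans e _; rewrite ltry.
by split=> //; rewrite -lee_fin -nnsumE.
Qed.

Lemma nnsum_approx p (e : K) : (forall x, 0 <= p x) -> nnsummable p -> 0 < e ->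
  exists2 r : seq X, uniq r & nnsum p - e < \sum_(x <- r) p x.
Proof.
move=> p0 sp e0; apply: contrapT => /forall2NP H.
have [|_] := @nnsum_seq_bound p (nnsum p - e) p0.
  by move=> r ur; case: (H r) => // /negP; rewrite -leNgt.
by rewrite lerBDr gerDl leNgt e0.
Qed.

Lemma nnsum1 (a : X) (t : K) : 0 <= t ->
  nnsummable (fun x => if x == a then t else 0) /\
  nnsum (fun x => if x == a then t else 0) = t.
Proof.
move=> t0.
have e : (\esum_(x in [set: X]) (if x == a then t else 0)%:E = t%:E)%E.
  rewrite -(@esum_set1 _ _ a (fun=> t%:E)) ?lee_fin// [RHS]esum_mkcond.
  apply: eq_esum => x _; have [->|xa] := eqVneq x a; first by rewrite mem_set.
  by rewrite memNset//= => /eqP; rewrite (negPf xa).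
by split; rewrite /nnsummable /nnsum e ?ltry.
Qed.

End NonnegativeSums.

Section ComplexSums.
Context {K : realType} {X : choiceType}.
Implicit Types (u v : X -> K) (z w : X -> K[i]).

(* Sums of absolutely summable families. *)
Definition rsum u : K :=
  fine (\esum_(x in [set: X]) (EFin \o u)^\+ x - \esum_(x in [set: X]) (EFin \o u)^\- x)%E.
Definition csum z : K[i] :=
  Complex (rsum (fun x => complex.Re (z x))) (rsum (fun x => complex.Im (z x))).
Definition rsummable u := nnsummable (fun x => `|u x|).

Lemma rsum_sub (p q : X -> K) u : (forall x, 0 <= p x) -> (forall x, 0 <= q x) ->
  nnsummable p -> nnsummable q -> (forall x, u x = p x - q x) ->
  rsum u = nnsum p - nnsum q.
Proof.
move=> p0 q0 sp sq upq.
have sE (h : X -> K) : (forall x, 0 <= h x) -> nnsummable h ->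
    summable [set: X] (fun x => (h x)%:E).
  move=> h0; apply: le_lt_trans; apply: le_esum => x _.
  by rewrite abse_EFin ger0_norm.
have := @esumB _ _ [set: X] _ _ (sE _ p0 sp) (sE _ q0 sq)
  (fun x _ => p0 x) (fun x _ => q0 x).
rewrite (nnsumE p0 sp) (nnsumE q0 sq) -EFinB => H.
rewrite /rsum (_ : EFin \o u = ((fun x => (p x)%:E) \- (fun x => (q x)%:E)))%E ?H//.
by apply/funext => x /=; rewrite upq.
Qed.

Lemma rsum_posneg u : rsummable u ->
  exists p q, [/\ (forall x, 0 <= p x), (forall x, 0 <= q x), nnsummable p,
    nnsummable q & (forall x, u x = p x - q x)] .
Proof.
move=> su; exists (fun x => (`|u x| + u x) / 2), (fun x => (`|u x| - u x) / 2).
have hp x : 0 <= `|u x| + u x by have := ler_norm (- u x); rewrite normrN; lra.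
have hm x : 0 <= `|u x| - u x by rewrite subr_ge0 ler_norm.
split.
- by move=> x; rewrite divr_ge0.
- by move=> x; rewrite divr_ge0.
- by apply: le_nnsummable su => x; have := hm x; lra.
- by apply: le_nnsummable su => x; have := hp x; lra.
- by move=> x; lra.
Qed.

Lemma rsum_nn u : (forall x, 0 <= u x) -> nnsummable u -> rsum u = nnsum u.
Proof.
move=> u0 su.
have s0 : nnsummable (fun _ : X => 0 : K) by rewrite /nnsummable esum1// ltry.
rewrite (rsum_sub u0 (q := fun=> 0) _ su s0)//; last by move=> x; rewrite subr0.
by rewrite [nnsum (fun=> 0)]/nnsum esum1// subr0.
Qed.

Lemma rsumD u v : rsummable u -> rsummable v ->
  rsum (fun x => u x + v x) = rsum u + rsum v.
Proof.
move=> /rsum_posneg[p [q [p0 q0 sp sq upq]]] /rsum_posneg[p' [q' [p'0 q'0 sp' sq' vpq]]].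
have [s1 e1] := nnsumD p0 p'0 sp sp'.
have [s2 e2] := nnsumD q0 q'0 sq sq'.
rewrite (rsum_sub _ _ s1 s2) => [|x|x|x]; rewrite ?addr_ge0// ?upq ?vpq; last by ring.
rewrite (rsum_sub p0 q0 sp sq upq) (rsum_sub p'0 q'0 sp' sq' vpq) e1 e2; ring.
Qed.

Lemma rsumN u : rsummable u -> rsum (fun x => - u x) = - rsum u.
Proof.
move=> /rsum_posneg[p [q [p0 q0 sp sq upq]]].
rewrite (rsum_sub p0 q0 sp sq upq) (rsum_sub q0 p0 sq sp); first by ring.
by move=> x; rewrite upq; ring.
Qed.

Lemma rsumZ (t : K) u : rsummable u -> rsum (fun x => t * u x) = t * rsum u.
Proof.
wlog t0 : t u / 0 <= t => [H su|].
  have [/H->//|/ltW t0] := leP 0 t.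
  have -> : (fun x => t * u x) = (fun x => (- t) * (- u x)).
    by apply/funext => x; ring.
  rewrite (H (- t) (fun x => - u x)) ?oppr_ge0// ?rsumN//; first by ring.
  by rewrite /rsummable; under eq_fun do rewrite normrN.
move=> /rsum_posneg[p [q [p0 q0 sp sq upq]]].
have [s1 e1] := nnsumZ t0 p0 sp; have [s2 e2] := nnsumZ t0 q0 sq.
rewrite (rsum_sub p0 q0 sp sq upq) (rsum_sub _ _ s1 s2) => [|x|x|x].
- by rewrite e1 e2; ring.
- exact: mulr_ge0.
- exact: mulr_ge0.
- by rewrite upq; ring.
Qed.

End ComplexSums.

Section ComplexSumTheory.
Context {K : realType} {X : choiceType}.
Implicit Types (u v : X -> K) (z w : X -> K[i]).

Lemma rsummable_lin (s t : K) u v : rsummable u -> rsummable v ->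
  rsummable (fun x => s * u x + t * v x).
Proof.
move=> su sv.
have [s1 _] := nnsumZ (normr_ge0 s) (fun x => normr_ge0 (u x)) su.
have [s2 _] := nnsumZ (normr_ge0 t) (fun x => normr_ge0 (v x)) sv.
have [|| s3 _] := nnsumD _ _ s1 s2; try by move=> x; rewrite mulr_ge0.
apply: le_nnsummable s3 => x.
by rewrite (le_trans (ler_normD _ _))// !normrM.
Qed.

Lemma rsum_lin (s t : K) u v : rsummable u -> rsummable v ->
  rsum (fun x => s * u x + t * v x) = s * rsum u + t * rsum v.
Proof.
move=> su sv; rewrite -!rsumZ// -rsumD//.
- have := rsummable_lin s 0 su su; congr (rsummable _).
  by apply/funext => x; rewrite mul0r addr0.
- have := rsummable_lin t 0 sv sv; congr (rsummable _).
  by apply/funext => x; rewrite mul0r addr0.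
Qed.

Definition csummable z :=
  rsummable (fun x => complex.Re (z x)) /\ rsummable (fun x => complex.Im (z x)).

Lemma csumP (c : K[i]) z w : csummable z -> csummable w ->
  csum (fun x => c * z x + w x) = c * csum z + csum w.
Proof.
move=> [zr zi] [wr wi]; case: c => a b.
have s1 := rsummable_lin a (- b) zr zi; have s2 := rsummable_lin b a zr zi.
rewrite /csum.
set rz := rsum (fun x => complex.Re (z x)); set iz := rsum (fun x => complex.Im (z x)).
set rw := rsum (fun x => complex.Re (w x)); set iw := rsum (fun x => complex.Im (w x)).
transitivity (Complex (a * rz + - b * iz + rw) (b * rz + a * iz + iw)).
  rewrite -!rsum_lin// -!rsumD//; congr Complex; congr rsum; apply/funext => x;
    case: (z x) (w x) => ? ? [? ?] /=; ring.
by apply/eqP; rewrite eq_complex /=; apply/andP; split; apply/eqP; ring.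
Qed.

Lemma csum_conj z : csummable z -> csum (fun x => (z x)^*) = (csum z)^*.
Proof.
move=> [zr zi]; apply/eqP; rewrite eq_complex /csum /= -rsumN//.
by apply/andP; split; apply/eqP; congr rsum; apply/funext => x; case: (z x).
Qed.

Lemma csum_ge0 z : (forall x, 0 <= z x) -> csummable z ->
  csum z = (nnsum (fun x => complex.Re (z x)))%:C%C.
Proof.
move=> z0 [zr zi].
have zi0 x : complex.Im (z x) = 0 by exact: ger0_Im.
have zr0 x : 0 <= complex.Re (z x) by have := z0 x; rewrite lecE => /andP[].
apply/eqP; rewrite eq_complex /csum /=; apply/andP; split; apply/eqP.
- rewrite rsum_nn//; apply: le_nnsummable zr => x; exact: ler_norm.
- rewrite rsum_nn//.
  + by rewrite /nnsum esum1// => x _; rewrite zi0.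
  + by move=> x; rewrite zi0.
  + by apply: le_nnsummable zi => x; exact: ler_norm.
Qed.

End ComplexSumTheory.

Lemma sqr_normcE (K : realType) (z : K[i]) :
  normc z ^+ 2 = complex.Re z ^+ 2 + complex.Im z ^+ 2.
Proof. by case: z => a b /=; rewrite sqr_sqrtr// addr_ge0 ?sqr_ge0. Qed.

Section Ell2.
Context {K : realType} {X : choiceType}.

Definition ell2_pred : {pred X -> K[i]} :=
  fun f => `[< nnsummable (fun x => normc (f x) ^+ 2) >].

Lemma ell2_submod : submod_closed ell2_pred.
Proof.
split.
  apply/asboolP; rewrite /nnsummable esum1 ?ltry// => x _.
  by rewrite normc0 expr0n.
move=> c f g /asboolP sf /asboolP sg; apply/asboolP.
have p2 (h : X -> K[i]) x : 0 <= normc (h x) ^+ 2 by exact: sqr_ge0.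
have c0 : 0 <= 2 * normc c ^+ 2 by rewrite mulr_ge0// sqr_ge0.
have [s1 _] := nnsumZ c0 (p2 f) sf.
have [s2 _] := nnsumZ (ler0n K 2) (p2 g) sg.
have [|| s3 _] := nnsumD _ _ s1 s2; try by move=> x; rewrite mulr_ge0.
apply: le_nnsummable s3 => x.
rewrite -mulrA -exprMn -normcM.
change (normc (c * f x + g x) ^+ 2 <= 2 * normc (c * f x) ^+ 2 + 2 * normc (g x) ^+ 2).
rewrite !sqr_normcE; case: (c * f x) (g x) => a b [a' b'] /=.
by have := sqr_ge0 (a - a'); have := sqr_ge0 (b - b'); nra.
Qed.
HB.instance Definition _ := GRing.isSubmodClosed.Build K[i] (X -> K[i]) ell2_pred ell2_submod.
End Ell2.

Record ell2 (K : realType) (X : choiceType) := Ell2 {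
  ell2_fun :> X -> K[i];
  _ : ell2_fun \in ell2_pred
}.
HB.instance Definition _ K X := [isSub for @ell2_fun K X].
HB.instance Definition _ K X := [Choice of ell2 K X by <:].
HB.instance Definition _ K X := [SubChoice_isSubLmodule of ell2 K X by <:].

Section Ell2Theory.
Context {K : realType} {X : choiceType}.
Implicit Types f g h : ell2 K X.

Definition inner f g : K[i] := csum (fun x => f x * (g x)^*).
Definition l2norm f : K := Num.sqrt (nnsum (fun x => normc (f x) ^+ 2)).

Lemma ell2_sum f : nnsummable (fun x => normc (f x) ^+ 2).
Proof. by case: f => f /= /asboolP. Qed.

Lemma ell2P f g : (forall x, f x = g x) -> f = g.
Proof. by move=> fg; apply/val_inj/funext. Qed.

Lemma ell2DE f g x : (f + g) x = f x + g x. Proof. by []. Qed.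
Lemma ell2ZE c f x : (c *: f) x = c * f x. Proof. by []. Qed.
Lemma ell2NE f x : (- f) x = - f x. Proof. by []. Qed.
Lemma ell20E x : (0 : ell2 K X) x = 0. Proof. by []. Qed.

Lemma inner_summable f g : csummable (fun x => f x * (g x)^*).
Proof.
have p2 (h : ell2 K X) x : 0 <= normc (h x) ^+ 2 by exact: sqr_ge0.
have [s _] := nnsumD (p2 f) (p2 g) (ell2_sum f) (ell2_sum g).
split; apply: le_nnsummable s => x; rewrite !sqr_normcE;
  case: (f x) (g x) => a b [c d] /=; rewrite ler_norml;
  have := sqr_ge0 (a - c); have := sqr_ge0 (b - d); 
  have := sqr_ge0 (a + c); have := sqr_ge0 (b + d);
  have := sqr_ge0 (a - d); have := sqr_ge0 (b - c); 
  have := sqr_ge0 (a + d); have := sqr_ge0 (b + c); rewrite !expr2 => *;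
  apply/andP; split; lra.
Qed.

Lemma innerPl c f g h : inner (c *: f + g) h = c * inner f h + inner g h.
Proof.
rewrite -csumP; try exact: inner_summable.
by congr csum; apply/funext => x; rewrite ell2DE ell2ZE mulrDl mulrA.
Qed.

Lemma innerC f g : inner f g = (inner g f)^*.
Proof.
rewrite -csum_conj; last exact: inner_summable.
by congr csum; apply/funext => x; rewrite rmorphM/= conjCK mulrC.
Qed.

Lemma innerPr c f g h : inner h (c *: f + g) = c^* * inner h f + inner h g.
Proof. by rewrite innerC innerPl rmorphD rmorphM/= -!innerC. Qed.

Lemma inner_norm f : inner f f = ((l2norm f) ^+ 2)%:C%C.
Proof.
have e x : f x * (f x)^* = (normc (f x) ^+ 2)%:C%C.
  by rewrite -normCK rmorphXn.
rewrite /inner csum_ge0.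
- rewrite /l2norm sqr_sqrtr; first by congr (_%:C%C); congr nnsum; apply/funext => x; rewrite e.
  by apply: nnsum_ge0 => x; exact: sqr_ge0.
- by move=> x; rewrite -normCK exprn_ge0.
- exact: inner_summable.
Qed.

Lemma l2norm_ge0 f : 0 <= l2norm f. Proof. exact: sqrtr_ge0. Qed.

Lemma l2norm_coord f x : normc (f x) <= l2norm f.
Proof.
rewrite -[leLHS]ger0_norm; last by case: (f x) => a b /=; exact: sqrtr_ge0.
rewrite -sqrtr_sqr; apply: ler_wsqrtr.
have := @nnsum_seq_le K X (fun x => normc (f x) ^+ 2) [:: x] _ (ell2_sum f) erefl.
by rewrite big_seq1; apply => y; exact: sqr_ge0.
Qed.

Lemma l2norm_eq0 f : l2norm f = 0 -> f = 0.
Proof.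
move=> f0; apply: ell2P => x; apply: eq0_normc; apply/eqP.
rewrite eq_le -{1}f0 l2norm_coord/=; case: (f x) => a b /=; exact: sqrtr_ge0.
Qed.

Lemma inner_gt0 f : f != 0 -> 0 < inner f f.
Proof.
move=> f0; rewrite inner_norm ltcR exprn_gt0// lt_neqAle l2norm_ge0 andbT.
by apply: contra f0 => /eqP/esym/l2norm_eq0->.
Qed.

End Ell2Theory.

HB.instance Definition _ (K : realType) (X : choiceType) :=
  @bilinear_isBilinear.Build K[i] (ell2 K X) (ell2 K X) K[i] *%R
    (Num.conj \; *%R) (@inner K X)
    (fun h c f g => innerPl c f g h, fun h c f g => innerPr c f g h).

Lemma inner_herm (K : realType) (X : choiceType) (f g : ell2 K X) :
  inner f g = (-1) ^+ false * Num.conj (inner g f).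
Proof. by rewrite expr0 mul1r; exact: innerC. Qed.

HB.instance Definition _ (K : realType) (X : choiceType) :=
  isHermitianSesquilinear.Build K[i] (ell2 K X) false Num.conj (@inner K X)
    (@inner_herm K X).

HB.instance Definition _ (K : realType) (X : choiceType) :=
  isDotProduct.Build K[i] (ell2 K X) (@inner K X) (@inner_gt0 K X).

Section Ell2Norm.
Context {K : realType} {X : choiceType}.
Implicit Types f g h : ell2 K X.

Lemma normc_conj (z : K[i]) : normc z^* = normc z.
Proof. by case: z => a b /=; rewrite sqrrN. Qed.

Lemma normc_ge0 (z : K[i]) : 0 <= normc z.
Proof. by case: z => a b /=; exact: sqrtr_ge0. Qed.

Lemma normc_real (t : K) : normc t%:C%C = `|t|.
Proof. by rewrite /= expr0n addr0 sqrtr_sqr. Qed.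

Lemma mulc_conj (z : K[i]) : z * z^* = (normc z ^+ 2)%:C%C.
Proof. by rewrite -normCK rmorphXn. Qed.

Lemma cauchy_schwarz f g : normc (inner f g) <= l2norm f * l2norm g.
Proof.
have [->|g0] := eqVneq g 0.
  by rewrite linear0r normc0 mulr_ge0// l2norm_ge0.
have [a aE] : exists a, inner f g = a by exists (inner f g).
rewrite aE; set F := l2norm f; set G := l2norm g.
have G0 : 0 < G by rewrite lt_neqAle l2norm_ge0 andbT eq_sym;
  apply: contra g0 => /eqP/l2norm_eq0->.
have H : inner ((G ^+ 2)%:C%C *: f - a *: g) ((G ^+ 2)%:C%C *: f - a *: g)
    = (G ^+ 2 * (G ^+ 2 * F ^+ 2 - normc a ^+ 2))%:C%C.
  rewrite -scaleNr innerPl innerPr linearZl_LR/= innerPr linearZr_LR/=.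
  rewrite !linearZr_LR/= (innerC g f) aE !inner_norm -/F -/G.
  have -> : Num.conj (G ^+ 2)%:C%C = (G ^+ 2)%:C%C :> K[i].
    by apply: CrealP; rewrite complex_real.
  rewrite sqr_normcE; clear -a; case: a => p q.
  by apply/eqP; rewrite eq_complex /=; apply/andP; split; apply/eqP; ring.
have : 0 <= (G ^+ 2 * (G ^+ 2 * F ^+ 2 - normc a ^+ 2))%:C%C :> K[i].
  by rewrite -H inner_norm lecR exprn_ge0// l2norm_ge0.
rewrite lecR pmulr_rge0 ?exprn_gt0// subr_ge0 -exprMn mulrC ler_pXn2r//.
  by rewrite nnegrE normc_ge0.
by rewrite nnegrE mulr_ge0// l2norm_ge0.
Qed.

Lemma l2normZ c f : l2norm (c *: f) = normc c * l2norm f.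
Proof.
apply/eqP; rewrite -(@eqrXn2 _ 2)// ?mulr_ge0// ?normc_ge0 ?l2norm_ge0// exprMn.
rewrite -(inj_eq (@complexI K)) -inner_norm linearZl_LR/= linearZr_LR/=.
by rewrite mulrA mulc_conj inner_norm -rmorphM.
Qed.

Lemma l2norm_triangle f g : l2norm (f + g) <= l2norm f + l2norm g.
Proof.
rewrite -(@ler_pXn2r _ 2)// ?nnegrE ?addr_ge0// ?l2norm_ge0// -lecR -inner_norm.
rewrite linearDl/= !linearDr/= !inner_norm (innerC g f).
have cs := cauchy_schwarz f g; move: (inner f g) cs => z cs.
have -> : ((l2norm f ^+ 2)%:C%C + z + (z^* + (l2norm g ^+ 2)%:C%C)
   = (l2norm f ^+ 2 + l2norm g ^+ 2 + 2 * complex.Re z)%:C%C).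
  by case: z cs => a b _; apply/eqP; rewrite eq_complex/=; apply/andP; split; apply/eqP; ring.
have hz : complex.Re z <= l2norm f * l2norm g.
  rewrite (le_trans _ cs)//; case: z {cs} => a b /=.
  by rewrite (le_trans (ler_norm _))// -sqrtr_sqr ler_wsqrtr// lerDl sqr_ge0.
by rewrite lecR; move: (l2norm f) (l2norm g) hz => F G hz; nra.
Qed.

Lemma l2normN f : l2norm (- f) = l2norm f.
Proof. by rewrite -scaleN1r l2normZ normcN normc1 mul1r. Qed.

Lemma l2norm0 : l2norm (0 : ell2 K X) = 0.
Proof. by rewrite -(scale0r (0 : ell2 K X)) l2normZ normc0 mul0r. Qed.

Lemma delta_subproof (a : X) : (fun x : X => ((x == a)%:R : K[i])) \in ell2_pred.
Proof.
apply/asboolP; have [s _] := nnsum1 a (@ler01 K); apply: le_nnsummable s => x.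
by case: (x == a); rewrite ?normc1 ?normc0 ?expr1n ?expr0n.
Qed.
Definition delta a : ell2 K X := Ell2 (delta_subproof a).

Lemma deltaE a x : delta a x = (x == a)%:R. Proof. by []. Qed.

Lemma l2norm_delta a : l2norm (delta a) = 1.
Proof.
rewrite /l2norm -[RHS]sqrtr1; congr Num.sqrt.
have [_ e] := nnsum1 a (@ler01 K); rewrite -[RHS]e; congr nnsum; apply/funext => x.
by rewrite deltaE; case: (x == a); rewrite ?normc1 ?normc0 ?expr1n ?expr0n.
Qed.

Lemma inner_delta f a : inner f (delta a) = f a.
Proof.
have -> : inner f (delta a) = inner (f a *: delta a) (delta a).
  congr csum; apply/funext => x; rewrite ell2ZE deltaE.
  by have [->|_] := eqVneq x a; rewrite ?mulr1// mulr0n conjC0 !mulr0.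
by rewrite linearZl_LR/= inner_norm l2norm_delta expr1n mulr1.
Qed.

Definition l2restrict (f : ell2 K X) (r : seq X) := \sum_(x <- r) f x *: delta x.

Lemma l2restrictE f r x : uniq r -> x \in r -> l2restrict f r x = f x.
Proof.
move=> ur xr; rewrite -inner_delta /l2restrict linear_sumlz/= (bigD1_seq x)//=.
rewrite linearZl_LR/= inner_norm l2norm_delta expr1n mulr1 big1 ?addr0// => y yx.
by rewrite linearZl_LR/= inner_delta deltaE eq_sym (negPf yx) mulr0.
Qed.

Lemma inner_restrict f r : uniq r ->
  inner f (l2restrict f r) = (\sum_(x <- r) normc (f x) ^+ 2)%:C%C /\
  inner (l2restrict f r) (l2restrict f r) = (\sum_(x <- r) normc (f x) ^+ 2)%:C%C.
Proof.
move=> ur.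
have H g : (forall x, x \in r -> g x = f x) ->
    inner g (l2restrict f r) = (\sum_(x <- r) normc (f x) ^+ 2)%:C%C.
  move=> gf; rewrite linear_sumr/= rmorph_sum/=; apply: eq_big_seq => x xr.
  by rewrite linearZr_LR/= inner_delta gf// mulrC mulc_conj.
by split; apply: H => // x; exact: l2restrictE.
Qed.

Lemma restrict_approx f (e : K) : 0 < e ->
  exists2 r, uniq r & l2norm (f - l2restrict f r) < e.
Proof.
move=> e0; have p0 x : 0 <= normc (f x) ^+ 2 by exact: sqr_ge0.
have e20 : 0 < e ^+ 2 by exact: exprn_gt0.
have [r ur H] := nnsum_approx p0 (ell2_sum f) e20.
exists r => //; rewrite -(@ltr_pXn2r _ 2)// ?nnegrE ?l2norm_ge0 ?ltW// -ltcR -inner_norm.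
have [e1 e2] := inner_restrict f ur.
rewrite linearBl/= !linearBr/= e2 (innerC (l2restrict f r) f) e1.
have -> : Num.conj (\sum_(x <- r) normc (f x) ^+ 2)%:C%C = (\sum_(x <- r) normc (f x) ^+ 2)%:C%C :> K[i].
  by apply: CrealP; rewrite complex_real.
rewrite subrr subr0 inner_norm -rmorphB ltcR.
rewrite /l2norm sqr_sqrtr; first by rewrite ltrBlDr addrC -ltrBlDr.
exact: nnsum_ge0.
Qed.

End Ell2Norm.

Section BoundedOperators.
Context {K : realType} {X : choiceType}.
Implicit Types f g : ell2 K X.

Definition bounded_op : {pred ell2 K X -> ell2 K X} := fun T =>
  `[< linear T /\ exists c : K, forall f, l2norm (T f) <= c * l2norm f >].

Lemma bounded_op_bound T : T \in bounded_op ->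
  exists2 c : K, 0 <= c & forall f, l2norm (T f) <= c * l2norm f.
Proof.
move=> /asboolP[_ [c cT]]; exists `|c| => // f.
by rewrite (le_trans (cT f))// ler_wpM2r ?l2norm_ge0// ler_norm.
Qed.

Lemma bounded_op_submod : submod_closed bounded_op.
Proof.
split.
  apply/asboolP; split=> [c f g|]; first by rewrite scaler0 addr0.
  by exists 0 => f; rewrite l2norm0 mul0r.
move=> a S T bS bT; apply/asboolP; split.
  move: bS bT => /asboolP[lS _] /asboolP[lT _] c f g.
  change (a *: S (c *: f + g) + T (c *: f + g)
    = c *: (a *: S f + T f) + (a *: S g + T g)).
  by rewrite lS lT !scalerDr !scalerA [c * a]mulrC -!addrA; congr (_ + _); rewrite addrCA.
have [c c0 cS] := bounded_op_bound bS; have [d d0 dT] := bounded_op_bound bT.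
exists (normc a * c + d) => f.
change (l2norm (a *: S f + T f) <= (normc a * c + d) * l2norm f).
rewrite (le_trans (l2norm_triangle _ _))// l2normZ mulrDl lerD// -mulrA.
by rewrite ler_wpM2l// normc_ge0.
Qed.
HB.instance Definition _ := GRing.isSubmodClosed.Build K[i]
  (ell2 K X -> ell2 K X) bounded_op bounded_op_submod.
End BoundedOperators.

Record bop (K : realType) (X : choiceType) := Bop {
  bop_fun :> ell2 K X -> ell2 K X;
  _ : bop_fun \in bounded_op
}.
HB.instance Definition _ K X := [isSub for @bop_fun K X].
HB.instance Definition _ K X := [Choice of bop K X by <:].
HB.instance Definition _ K X := [SubChoice_isSubLmodule of bop K X by <:].

Section BopTheory.
Context {K : realType} {X : choiceType}.
Implicit Types (f g : ell2 K X) (S T : bop K X).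

Lemma bopP S T : (forall f, S f = T f) -> S = T.
Proof. by move=> ST; apply/val_inj/funext. Qed.

Lemma bopPl T : linear T.
Proof. by case: T => T /= /asboolP[]. Qed.

Definition opnorm T : K := sup [set l2norm (T f) | f in [set f | l2norm f <= 1]].

Lemma opnorm_le T (c : K) : 0 <= c -> (forall f, l2norm (T f) <= c * l2norm f) ->
  opnorm T <= c.
Proof.
move=> c0 cT; apply: ge_sup.
  by exists (l2norm (T 0)), 0 => //=; rewrite l2norm0 ler01.
by move=> _ [f /= f1 <-]; rewrite (le_trans (cT f))// -[leRHS]mulr1 ler_wpM2l.
Qed.

Lemma opnorm_ub T f : l2norm f <= 1 -> l2norm (T f) <= opnorm T.
Proof.
move=> f1; apply: ub_le_sup; last by exists f.
have [c c0 cT] := bounded_op_bound (valP T).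
by exists c => _ [g /= g1 <-]; rewrite (le_trans (cT g))// -[leRHS]mulr1 ler_wpM2l.
Qed.

Lemma opnorm_ge0 T : 0 <= opnorm T.
Proof. by apply: le_trans (opnorm_ub (f := 0) T _); rewrite ?l2norm_ge0 ?l2norm0 ?ler01. Qed.
End BopTheory.

HB.instance Definition _ (K : realType) (X : choiceType) (T : bop K X) :=
  GRing.isLinear.Build K[i] (ell2 K X) (ell2 K X) *:%R (bop_fun T) (bopPl T).

Section BopAlgebra.
Context {K : realType} {X : choiceType}.
Implicit Types (f g : ell2 K X) (S T : bop K X).

Lemma opnormP T f : l2norm (T f) <= opnorm T * l2norm f.
Proof.
have [->|f0] := eqVneq f 0; first by rewrite linear0 l2norm0 mulr0.
have nf0 : 0 < l2norm f by rewrite lt_neqAle l2norm_ge0 andbT eq_sym;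
  apply: contra f0 => /eqP/l2norm_eq0->.
have nV : normc ((l2norm f)^-1)%:C%C = (l2norm f)^-1.
  by rewrite normc_real ger0_norm// invr_ge0 ltW.
have := @opnorm_ub _ _ T (((l2norm f)^-1)%:C%C *: f).
rewrite linearZ/= !l2normZ nV mulVf ?gt_eqF// => /(_ (lexx _)).
by rewrite mulrC ler_pdivrMr.
Qed.

Lemma bop_one_subproof : (idfun : ell2 K X -> ell2 K X) \in bounded_op.
Proof. by apply/asboolP; split=> //; exists 1 => f; rewrite mul1r. Qed.
Definition bop_one : bop K X := Bop bop_one_subproof.

Lemma bop_mul_subproof S T : (S \o T : ell2 K X -> ell2 K X) \in bounded_op.
Proof.
apply/asboolP; split=> [c f g|]; first by rewrite /= !linearP.
exists (opnorm S * opnorm T) => f.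
by rewrite (le_trans (opnormP _ _))// -mulrA ler_wpM2l ?opnorm_ge0// opnormP.
Qed.
Definition bop_mul S T : bop K X := Bop (bop_mul_subproof S T).

Lemma bopDE S T f : (S + T) f = S f + T f. Proof. by []. Qed.
Lemma bopNE T f : (- T) f = - T f. Proof. by []. Qed.
Lemma bopZE (c : K[i]) T f : (c *: T) f = c *: T f. Proof. by []. Qed.

Lemma opnorm_eq0 T : opnorm T = 0 -> T = 0.
Proof.
move=> T0; apply: bopP => f; apply: l2norm_eq0; apply/eqP.
by rewrite eq_le l2norm_ge0 andbT (le_trans (opnormP _ _))// T0 mul0r.
Qed.

Lemma opnormD S T : opnorm (S + T) <= opnorm S + opnorm T.
Proof.
apply: opnorm_le => [|f]; first by rewrite addr_ge0 ?opnorm_ge0.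
by rewrite bopDE (le_trans (l2norm_triangle _ _))// mulrDl lerD// opnormP.
Qed.

Lemma opnormZ_le (c : K[i]) T : opnorm (c *: T) <= normc c * opnorm T.
Proof.
apply: opnorm_le => [|f]; first by rewrite mulr_ge0 ?opnorm_ge0// normc_ge0.
by rewrite bopZE l2normZ -mulrA ler_wpM2l ?normc_ge0 ?opnormP.
Qed.

Lemma opnormZ (c : K[i]) T : opnorm (c *: T) = normc c * opnorm T.
Proof.
apply/eqP; rewrite eq_le opnormZ_le/=; have [->|c0] := eqVneq c 0.
  by rewrite normc0 mul0r opnorm_ge0.
have nc0 : 0 < normc c.
  by rewrite lt_neqAle normc_ge0 andbT eq_sym; apply: contra c0 => /eqP/eq0_normc->.
rewrite -ler_pdivlMl//; apply: le_trans (_ : normc c^-1 * opnorm (c *: T) <= _).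
  by rewrite -{1}[T]scale1r -(mulVf c0) -scalerA opnormZ_le.
by rewrite normcV.
Qed.

Lemma opnormM S T : opnorm (bop_mul S T) <= opnorm S * opnorm T.
Proof.
apply: opnorm_le => [|f]; first by rewrite mulr_ge0 ?opnorm_ge0.
by rewrite (le_trans (opnormP S (T f)))// -mulrA ler_wpM2l ?opnorm_ge0// opnormP.
Qed.

Lemma adjoint_bound T g :
  nnsummable (fun x => normc (inner g (T (delta x))) ^+ 2) /\
  nnsum (fun x => normc (inner g (T (delta x))) ^+ 2) <= (opnorm T * l2norm g) ^+ 2.
Proof.
apply: nnsum_seq_bound => [x|r ur]; first exact: sqr_ge0.
set A := \sum_(x <- r) _.
have A0 : 0 <= A by rewrite sumr_ge0// => x _; exact: sqr_ge0.
pose h x := inner g (T (delta x)).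
pose w := \sum_(x <- r) h x *: (delta x : ell2 K X).
have wE x : x \in r -> w x = h x.
  move=> xr; rewrite -inner_delta /w linear_sumlz/= (bigD1_seq x)//=.
  rewrite linearZl_LR/= inner_delta deltaE eqxx mulr1 big1 ?addr0// => y yx.
  by rewrite linearZl_LR/= inner_delta deltaE eq_sym (negPf yx) mulr0.
have Aw : inner w w = A%:C%C.
  rewrite {2}/w linear_sumr/= rmorph_sum/=; apply: eq_big_seq => x xr.
  by rewrite linearZr_LR/= inner_delta wE// mulrC mulc_conj.
have AT : inner (T w) g = A%:C%C.
  rewrite /w linear_sum linear_sumlz/= rmorph_sum/=; apply: eq_big_seq => x xr.
  by rewrite linearZ linearZl_LR/= (innerC _ g) mulc_conj.
have nw : l2norm w ^+ 2 = A by apply: (@complexI K); rewrite -inner_norm.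
have := cauchy_schwarz (T w) g; rewrite AT normc_real ger0_norm// -{1}nw => H.
have {H} H : l2norm w ^+ 2 <= l2norm w * (opnorm T * l2norm g).
  rewrite (le_trans H)// mulrA [_ * opnorm T]mulrC ler_wpM2r ?l2norm_ge0//.
  exact: opnormP.
rewrite -nw; have [w0|w0] := eqVneq (l2norm w) 0; first by rewrite w0 expr0n/= sqr_ge0.
rewrite ler_pXn2r ?nnegrE ?l2norm_ge0 ?mulr_ge0 ?opnorm_ge0 ?l2norm_ge0//.
by move: H; rewrite expr2 ler_pM2l// lt_neqAle eq_sym w0 l2norm_ge0.
Qed.

Lemma adjoint_fun_subproof T g : (fun x => inner g (T (delta x))) \in ell2_pred.
Proof. by apply/asboolP; have [] := adjoint_bound T g. Qed.
Definition adjoint_fun T g : ell2 K X := Ell2 (adjoint_fun_subproof T g).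

Lemma adjoint_subproof T : adjoint_fun T \in bounded_op.
Proof.
apply/asboolP; split=> [c f g|].
  by apply: ell2P => x; rewrite ell2DE ell2ZE/= linearPl.
exists (opnorm T) => g; have [_ H] := adjoint_bound T g.
rewrite -(@ler_pXn2r _ 2)// ?nnegrE ?mulr_ge0 ?l2norm_ge0 ?opnorm_ge0//.
rewrite [X in X ^+ 2 <= _]/l2norm sqr_sqrtr//; apply: nnsum_ge0 => x; exact: sqr_ge0.
Qed.
(* Coordinate x of T^* g is <T^* g, delta x> = <g, T (delta x)>. *)
Definition adjoint T : bop K X := Bop (adjoint_subproof T).

Lemma opnorm_adjoint T : opnorm (adjoint T) <= opnorm T.
Proof.
apply: opnorm_le => [|g]; first exact: opnorm_ge0.
have [_ H] := adjoint_bound T g.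
rewrite -(@ler_pXn2r _ 2)// ?nnegrE ?mulr_ge0 ?l2norm_ge0 ?opnorm_ge0//.
rewrite [X in X ^+ 2 <= _]/l2norm sqr_sqrtr//; apply: nnsum_ge0 => x; exact: sqr_ge0.
Qed.

Lemma normc_small (z : K[i]) (M : K) : 0 <= M ->
  (forall e, 0 < e -> normc z <= M * e) -> z = 0.
Proof.
move=> M0 H; apply/eq0_normc/eqP; rewrite eq_le normc_ge0 andbT leNgt; apply/negP => z0.
have M1 : 0 < M + 1 by rewrite ltr_wpDl.
have e0 : 0 < normc z / (M + 1) by rewrite divr_gt0.
have := H _ e0; rewrite leNgt => /negP; apply.
by rewrite mulrCA gtr_pMr// ltr_pdivrMr// mul1r ltrDl.
Qed.

Lemma adjointP T f g : inner (T f) g = inner f (adjoint T g).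
Proof.
apply/eqP; rewrite -subr_eq0; apply/eqP.
apply: (@normc_small _ (2 * (opnorm T * l2norm g))) => [|e e0].
  by rewrite !mulr_ge0 ?opnorm_ge0 ?l2norm_ge0.
have [r ur fr] := restrict_approx f e0.
have E : inner (T (l2restrict f r)) g = inner (l2restrict f r) (adjoint T g).
  rewrite /l2restrict linear_sum !linear_sumlz/=; apply: eq_bigr => x _.
  rewrite linearZ !linearZl_LR/= (innerC (delta x)) inner_delta/=.
  by rewrite (innerC g) conjCK.
have -> : inner (T f) g - inner f (adjoint T g) =
    inner (T (f - l2restrict f r)) g - inner (f - l2restrict f r) (adjoint T g).
  by rewrite linearB !linearBl/= E opprB addrA subrK.
set d := f - l2restrict f r.
rewrite (le_trans (le_normcD _ _))// normcN.
have h1 : normc (inner (T d) g) <= opnorm T * l2norm g * e.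
  rewrite (le_trans (cauchy_schwarz _ _))// [leRHS]mulrAC ler_wpM2r ?l2norm_ge0//.
  by rewrite (le_trans (opnormP _ _))// ler_wpM2l ?opnorm_ge0// ltW.
have h2 : normc (inner d (adjoint T g)) <= opnorm T * l2norm g * e.
  rewrite (le_trans (cauchy_schwarz _ _))// [leRHS]mulrC.
  apply: ler_pM; rewrite ?l2norm_ge0//; first exact: ltW.
  rewrite (le_trans (opnormP (adjoint T) g))//.
  by rewrite ler_wpM2r ?l2norm_ge0// opnorm_adjoint.
by rewrite mulr_natl mulr2n mulrDl lerD.
Qed.

Lemma inner_inj f g : (forall h, inner h f = inner h g) -> f = g.
Proof.
by move=> H; apply: ell2P => x; rewrite -!inner_delta innerC H -innerC.
Qed.

Lemma adjoint_unique S T : (forall f g, inner (T f) g = inner f (S g)) -> S = adjoint T.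
Proof. by move=> H; apply: bopP => g; apply: inner_inj => h; rewrite -H adjointP. Qed.

Lemma adjointK T : adjoint (adjoint T) = T.
Proof.
apply/esym/adjoint_unique => f g.
by rewrite innerC -adjointP -innerC.
Qed.

Lemma opnorm_cstar T : opnorm (bop_mul (adjoint T) T) = opnorm T ^+ 2.
Proof.
apply/eqP; rewrite eq_le; apply/andP; split.
  by rewrite (le_trans (opnormM _ _))// expr2 ler_wpM2r ?opnorm_ge0// opnorm_adjoint.
set c := opnorm (bop_mul _ _).
have c0 : 0 <= c by exact: opnorm_ge0.
rewrite -(sqr_sqrtr c0) ler_pXn2r ?nnegrE ?opnorm_ge0 ?sqrtr_ge0//.
apply: opnorm_le => [|f]; first exact: sqrtr_ge0.
rewrite -(@ler_pXn2r _ 2)// ?nnegrE ?mulr_ge0 ?l2norm_ge0 ?sqrtr_ge0//.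
rewrite exprMn (sqr_sqrtr c0).
have -> : l2norm (T f) ^+ 2 = normc (inner f (bop_mul (adjoint T) T f)).
  by rewrite -[bop_mul _ _ f]/(adjoint T (T f)) -adjointP inner_norm normc_real ger0_norm// sqr_ge0.
rewrite (le_trans (cauchy_schwarz _ _))// expr2 mulrCA ler_wpM2l ?l2norm_ge0//.
exact: opnormP.
Qed.

End BopAlgebra.

Section BopComplete.
Context {K : realType} {X : choiceType}.

Lemma real_cauchy (s : nat -> K) :
  (forall e : K, 0 < e -> exists N, forall m n, (N <= m)%N -> (N <= n)%N -> `|s m - s n| < e) ->
  exists l : K, s n @[n --> \oo] --> l.
Proof.
move=> H; have : cvg (s n @[n --> \oo]); last by move/cvg_ex.
apply: R_complete; apply: cauchy_exP => e e0; have [N HN] := H e e0.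
by exists (s N); exists N => // n /= Nn; exact: HN.
Qed.

Lemma bop_complete (u : nat -> bop K X) :
  (forall e : K, 0 < e -> exists N, forall m n, (N <= m)%N -> (N <= n)%N ->
     opnorm (u m - u n) < e) ->
  exists l, opnorm (u n - l) @[n --> \oo] --> (0 : K).
Proof.
move=> H.
have Hc (f : ell2 K X) x (e : K) : 0 < e -> exists N, forall m n, (N <= m)%N -> (N <= n)%N ->
    normc (u m f x - u n f x) < e.
  move=> e0; have e1 : 0 < e / (l2norm f + 1) by rewrite divr_gt0// ltr_wpDl ?l2norm_ge0.
  have [N HN] := H _ e1; exists N => m n Nm Nn.
  have -> : u m f x - u n f x = (u m - u n) f x by [].
  rewrite (le_lt_trans (l2norm_coord _ _))// (le_lt_trans (opnormP _ _))//.
  have h := HN m n Nm Nn; have f0 := l2norm_ge0 f.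
  rewrite (@le_lt_trans _ _ (e / (l2norm f + 1) * l2norm f))//.
    by rewrite ler_wpM2r// ltW.
  by rewrite mulrAC ltr_pdivrMr ?ltr_wpDl// ltr_pM2l// ltrDl.
have Rle (z : K[i]) : `|complex.Re z| <= normc z.
  by case: z => a b /=; rewrite -sqrtr_sqr ler_wsqrtr// lerDl sqr_ge0.
have Ile (z : K[i]) : `|complex.Im z| <= normc z.
  by case: z => a b /=; rewrite -sqrtr_sqr ler_wsqrtr// lerDr sqr_ge0.
have Lex (f : ell2 K X) x : exists z : K[i],
    (complex.Re (u n f x) @[n --> \oo] --> complex.Re z) /\
    (complex.Im (u n f x) @[n --> \oo] --> complex.Im z).
  have [|a ha] := @real_cauchy (fun n => complex.Re (u n f x)).
    move=> e e0; have [N HN] := Hc f x e e0; exists N => m n Nm Nn.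
    by rewrite (le_lt_trans _ (HN m n Nm Nn))// (le_trans _ (Rle _))//; case: (u m f x) (u n f x) => ? ? [].
  have [|b hb] := @real_cauchy (fun n => complex.Im (u n f x)).
    move=> e e0; have [N HN] := Hc f x e e0; exists N => m n Nm Nn.
    by rewrite (le_lt_trans _ (HN m n Nm Nn))// (le_trans _ (Ile _))//; case: (u m f x) (u n f x) => ? ? [].
  by exists (Complex a b).
pose L f x := projT1 (cid (Lex f x)).
have LR f x : complex.Re (u n f x) @[n --> \oo] --> complex.Re (L f x).
  by rewrite /L; case: cid => z /= [].
have LI f x : complex.Im (u n f x) @[n --> \oo] --> complex.Im (L f x).
  by rewrite /L; case: cid => z /= [].
have key (e : K) : 0 < e -> exists N, forall n, (N <= n)%N -> forall f,
    nnsummable (fun x => normc (u n f x - L f x) ^+ 2) /\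
    nnsum (fun x => normc (u n f x - L f x) ^+ 2) <= (e * l2norm f) ^+ 2.
  move=> e0; have [N HN] := H e e0; exists N => n Nn f.
  apply: nnsum_seq_bound => [x|r ur]; first exact: sqr_ge0.
  have Cx : (\sum_(x <- r) normc (u n f x - u m f x) ^+ 2) @[m --> \oo] -->
      \sum_(x <- r) normc (u n f x - L f x) ^+ 2.
    have E (z w : K[i]) : normc (z - w) ^+ 2 =
       (complex.Re z - complex.Re w) * (complex.Re z - complex.Re w) +
       (complex.Im z - complex.Im w) * (complex.Im z - complex.Im w).
      by rewrite sqr_normcE; case: z w => a b [c d] /=; rewrite !expr2.
    elim: (r) => [|x t IH].
      rewrite big_nil; under eq_fun do rewrite big_nil; exact: cvg_cst.
    rewrite big_cons; under eq_fun do rewrite big_cons.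
    apply: cvgD IH; rewrite E; under eq_fun do rewrite E.
    by apply: cvgD; apply: cvgM; apply: cvgB; [exact: cvg_cst|exact: LR|exact: cvg_cst|exact: LR
      |exact: cvg_cst|exact: LI|exact: cvg_cst|exact: LI].
  rewrite -(cvg_lim _ Cx)//; apply: limr_le; first by apply/cvg_ex; eexists; exact: Cx.
  exists N => // m /= Nm.
  have -> : \sum_(x <- r) normc (u n f x - u m f x) ^+ 2 = \sum_(x <- r) normc ((u n - u m) f x) ^+ 2.
    by [].
  have p0 x : 0 <= normc ((u n - u m) f x) ^+ 2 by exact: sqr_ge0.
  rewrite (le_trans (nnsum_seq_le p0 (ell2_sum _) ur))//.
  have -> : nnsum (fun x => normc ((u n - u m) f x) ^+ 2) = l2norm ((u n - u m) f) ^+ 2.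
    by rewrite /l2norm sqr_sqrtr//; exact: nnsum_ge0.
  have hle : l2norm ((u n - u m) f) <= e * l2norm f.
    by rewrite (le_trans (opnormP _ _))// ler_wpM2r ?l2norm_ge0// ltW// HN.
  by rewrite ler_pXn2r// nnegrE ?l2norm_ge0// (le_trans _ hle)// l2norm_ge0.
have [N1 HN1] := key 1 ltr01.
have Lp f : L f \in ell2_pred.
  have d : (fun x => u N1 f x - L f x) \in ell2_pred.
    by apply/asboolP; have [] := HN1 N1 (leqnn _) f.
  have -> : L f = (u N1 f : X -> K[i]) - (fun x => u N1 f x - L f x).
    by apply/funext => x; rewrite /GRing.add/= /GRing.opp/=; rewrite subKr.
  by rewrite rpredB//; exact: valP.
pose L2 f : ell2 K X := Ell2 (Lp f).
have Ll : linear L2.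
  move=> [a b] f g; apply: ell2P => x; rewrite ell2DE ell2ZE /=.
  have E n : u n (Complex a b *: f + g) x = Complex a b * u n f x + u n g x by rewrite linearP.
  apply/eqP; rewrite eq_complex; apply/andP; split; apply/eqP.
  - apply: (cvg_unique _ (LR _ x)) => //.
    have -> : complex.Re (Complex a b * L f x + L g x) =
       a * complex.Re (L f x) - b * complex.Im (L f x) + complex.Re (L g x).
      by case: (L f x) (L g x) => ? ? [].
    have -> : (fun n => complex.Re (u n (Complex a b *: f + g) x)) = (fun n =>
       a * complex.Re (u n f x) - b * complex.Im (u n f x) + complex.Re (u n g x)).
      by apply/funext => n; rewrite E; case: (u n f x) (u n g x) => ? ? [].
    by apply: cvgD (LR g x); apply: cvgB; apply: cvgM; (exact: cvg_cst || exact: LR || exact: LI).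
  - apply: (cvg_unique _ (LI _ x)) => //.
    have -> : complex.Im (Complex a b * L f x + L g x) =
       a * complex.Im (L f x) + b * complex.Re (L f x) + complex.Im (L g x).
      by case: (L f x) (L g x) => ? ? [].
    have -> : (fun n => complex.Im (u n (Complex a b *: f + g) x)) = (fun n =>
       a * complex.Im (u n f x) + b * complex.Re (u n f x) + complex.Im (u n g x)).
      by apply/funext => n; rewrite E; case: (u n f x) (u n g x) => ? ? [].
    by apply: cvgD (LI g x); apply: cvgD; apply: cvgM; (exact: cvg_cst || exact: LR || exact: LI).
have Ld (e : K) : 0 < e -> exists N, forall n, (N <= n)%N -> forall f,
    l2norm (u n f - L2 f) <= e * l2norm f.
  move=> e0; have [N HN] := key e e0; exists N => n Nn f.
  rewrite -(@ler_pXn2r _ 2)// ?nnegrE ?mulr_ge0 ?l2norm_ge0 ?(ltW e0)//.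
  rewrite [X in X ^+ 2 <= _]/l2norm sqr_sqrtr; first by have [_] := HN n Nn f.
  by apply: nnsum_ge0 => x; exact: sqr_ge0.
have Lb : L2 \in bounded_op.
  apply/asboolP; split=> //.
  have [N HN] := Ld 1 ltr01; exists (opnorm (u N) + 1) => f.
  have -> : L2 f = u N f - (u N f - L2 f) by rewrite subKr.
  apply: le_trans (l2norm_triangle _ _) _; rewrite l2normN mulrDl.
  by apply: lerD; [exact: opnormP|exact: HN].
exists (Bop Lb); apply/cvgrPdist_le => e e0.
have [N HN] := Ld e e0; exists N => // n /= Nn.
rewrite sub0r normrN ger0_norm ?opnorm_ge0//.
by apply: opnorm_le => [|f]; [exact: ltW|exact: HN].
Qed.

End BopComplete.

Section BopCStar.
Context {K : realType} {X : pointedType}.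
Implicit Types S T : bop K X.

Lemma bop_mulA : associative (@bop_mul K X).
Proof. by move=> S T U; apply: bopP. Qed.
Lemma bop_mul1 : left_id bop_one (@bop_mul K X).
Proof. by move=> T; apply: bopP. Qed.
Lemma bop_mulr1 : right_id bop_one (@bop_mul K X).
Proof. by move=> T; apply: bopP. Qed.
Lemma bop_mulDl : left_distributive (@bop_mul K X) +%R.
Proof. by move=> S T U; apply: bopP. Qed.
Lemma bop_mulDr : right_distributive (@bop_mul K X) +%R.
Proof. by move=> S T U; apply: bopP => f; exact: (linearD S). Qed.
Lemma bop_one_neq0 : bop_one != 0 :> bop K X.
Proof.
apply/eqP => /(congr1 (fun T => T (delta point) point)) /eqP.
by rewrite deltaE eqxx oner_eq0.
Qed.

HB.instance Definition _ := GRing.Zmodule_isNzRing.Build (bop K X)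
  bop_mulA bop_mul1 bop_mulr1 bop_mulDl bop_mulDr bop_one_neq0.

Lemma bop_scaleAl (c : K[i]) S T : c *: (S * T) = c *: S * T.
Proof. by apply: bopP. Qed.
HB.instance Definition _ := GRing.Lmodule_isLalgebra.Build K[i] (bop K X) bop_scaleAl.

Lemma bop_scaleAr (c : K[i]) S T : c *: (S * T) = S * (c *: T).
Proof. by apply: bopP => f; rewrite bopZE /= linearZ. Qed.
HB.instance Definition _ := GRing.Lalgebra_isAlgebra.Build K[i] (bop K X) bop_scaleAr.

Lemma adjointD : {morph @adjoint K X : S T / S + T}.
Proof.
move=> S T; apply/esym/adjoint_unique => f g.
by rewrite !bopDE linearDl linearDr /= !adjointP.
Qed.

Lemma adjointZ (c : K[i]) T : adjoint (c *: T) = c^* *: adjoint T.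
Proof.
apply/esym/adjoint_unique => f g.
by rewrite !bopZE linearZl_LR linearZr_LR /= conjCK adjointP.
Qed.

Lemma adjointM S T : adjoint (S * T) = adjoint T * adjoint S.
Proof.
apply/esym/adjoint_unique => f g.
change (inner (S (T f)) g = inner f (adjoint T (adjoint S g))).
by rewrite -(adjointP T) -(adjointP S).
Qed.

HB.instance Definition _ := isCStarAlgebra.Build K (bop K X)
  (@opnorm_eq0 K X) (@opnormD K X) (@opnormZ K X) (@opnormM K X) (@bop_complete K X)
  (@adjointK K X) adjointD adjointZ adjointM (@opnorm_cstar K X).

End BopCStar.

Section BasisOperators.
Context {K : realType} {X : choiceType}.
Variables (phi : X -> X) (phi_inj : injective phi).

Lemma pullback_bound (f : ell2 K X) :
  nnsummable (fun x => normc (f (phi x)) ^+ 2) /\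
  nnsum (fun x => normc (f (phi x)) ^+ 2) <= l2norm f ^+ 2.
Proof.
have p0 x : 0 <= normc (f x) ^+ 2 by exact: sqr_ge0.
apply: nnsum_seq_bound => [x|r ur]; first exact: sqr_ge0.
rewrite /l2norm sqr_sqrtr ?nnsum_ge0// -(big_map phi xpredT (fun x => normc (f x) ^+ 2)).
by rewrite nnsum_seq_le ?map_inj_uniq//; exact: ell2_sum.
Qed.

Lemma pullback_fun_subproof (f : ell2 K X) : (fun x => f (phi x)) \in ell2_pred.
Proof. by apply/asboolP; have [] := pullback_bound f. Qed.

Lemma pullback_subproof : (fun f => Ell2 (pullback_fun_subproof f)) \in @bounded_op K X.
Proof.
apply/asboolP; split=> [c f g|]; first exact: ell2P.
exists 1 => f; rewrite mul1r -(@ler_pXn2r _ 2)// ?nnegrE ?l2norm_ge0//.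
rewrite [X in X ^+ 2 <= _]/l2norm sqr_sqrtr; first by have [_] := pullback_bound f.
by apply: nnsum_ge0 => x; exact: sqr_ge0.
Qed.

(* The isometry sending the basis vector at x to the one at phi x; its adjoint
   is f |-> f \o phi. *)
Definition basis_op : bop K X := adjoint (Bop pullback_subproof).

Lemma basis_opE x : basis_op (delta x) = delta (phi x).
Proof.
apply: inner_inj => f; rewrite -adjointP !inner_delta//.
Qed.

End BasisOperators.

Section Fock.
Context (K : realType) {R : idomainType} (M : lmodType R).

Definition nonzero : Type := {r : R | r != 0}.
HB.instance Definition _ := Choice.on nonzero.
Definition nonzero1 : nonzero := exist _ 1 (oner_neq0 R).
Definition nonzero_mul (r s : nonzero) : nonzero :=
  exist _ (val r * val s) (mulf_neq0 (valP r) (valP s)).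

(* l^2(M) (x) l^2(R^x) is identified with l^2(M x R^x), the vector
   v_n (x) u_s being delta (n, s). *)
Definition fock_basis : Type := (M * nonzero)%type.
HB.instance Definition _ := Choice.on fock_basis.
HB.instance Definition _ := isPointed.Build fock_basis (0, nonzero1).

Definition fock_U_index (m : M) (x : fock_basis) : fock_basis :=
  (val x.2 *: m + x.1, x.2).
Definition fock_S_index (r : nonzero) (x : fock_basis) : fock_basis :=
  (x.1, nonzero_mul r x.2).

Lemma fock_U_inj m : injective (fock_U_index m).
Proof. by move=> [n s] [n' s'] [+ ss']; rewrite /= ss' => /addrI ->. Qed.

Lemma fock_S_inj r : injective (fock_S_index r).
Proof.
move=> [n s] [n' s'] [-> /(mulfI (valP r)) ss'].
by congr pair; apply: val_inj.
Qed.

Definition fock_U m : bop K fock_basis := basis_op (@fock_U_inj m).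
Definition fock_S r : bop K fock_basis := basis_op (@fock_S_inj r).

Lemma fock_UE m n s : fock_U m (delta (n, s)) = delta (val s *: m + n, s).
Proof. exact: basis_opE. Qed.

Lemma fock_SE r n s : fock_S r (delta (n, s)) = delta (n, nonzero_mul r s).
Proof. exact: basis_opE. Qed.

Definition fock_algebra : set (bop K fock_basis) :=
  closed_algebra (range fock_U `|` range fock_S).

Definition torsion_free : Prop :=
  forall (r : R) (m : M), r *: m = 0 -> r = 0 \/ m = 0.

End Fock.

Arguments fock_algebra K {R} M.

(* Main.v *)
From HB Require Import structures.
Require Import Defs.
From mathcomp Require Import all_boot all_order all_algebra.
From mathcomp Require Import complex fraction sesquilinear generic_quotient.
From mathcomp Require Import all_classical all_reals ereal topology normedtype sequences.
From mathcomp Require Import ring lra.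

Import Defs.

Set Implicit Arguments.
Unset Strict Implicit.
Unset Printing Implicit Defensive.
Import Order.TTheory GRing.Theory Num.Theory.
Import numFieldNormedType.Exports ComplexField.Normc.

Local Open Scope classical_set_scope.
Local Open Scope ring_scope.

Local Notation "t %:K" := (real_complex _ t) (at level 1, format "t %:K").

(* Write A for the algebra of M over R and E for that of N over Q(R), where N is
   the localization of M. Translating the basis of l^2(M x R^x) by the inverses
   of the denominators b gives copies of it inside l^2(N x Q(R)^x) that exhaust
   the latter, and every a in A has a unique lift iota(a) which acts as a on each
   copy; iota is completely isometric. In E all generators are unitary, so E is a
   C*-algebra, and it is generated by iota(A) since U^(m/b) = S_b U^m S_b^*.

   Let j be a unital completely isometric homomorphism of A onto a generating
   subalgebra of a C*-algebra D. By Paulsen's argument j(a) |-> iota(a) induces a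
   positive functional on the accretive part of the D-valued matrices indexed by
   the vectors of l^2(N x Q(R)^x); the M. Riesz extension theorem extends it to
   all matrices, which is Arveson's extension of the map to a unital completely
   positive map phi on D. As phi sends the contractions j(U^m), j(S_r) to
   unitaries, they lie in its multiplicative domain, and phi is a
   *-homomorphism. Its range is all of E, because every T in the span of the
   generators of E satisfies T S_b = iota(a) for some b and a, so that T lifts to
   j(a) j(S_b)^*, whose norm is at most that of T. *)

(** The scaling of both coordinates of a basis vector (n, s) by a constant commutes with (n, s) ->
    (s m + n, s) and with (n, s) -> (n, r s); this is why one operator a can act alike on all the
    copies. The copies are directed by divisibility, so finitely many basis vectors lie in a single
    copy and matrix norms can be compared there up to an arbitrarily small error. The extension phi
    takes values in all bounded operators, where Arveson's theorem holds, and the range has to be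
    identified separately. Indexing matrices by all vectors lets one real functional carry the whole
    map: its value at d (x) h (x) k^* is the real part of the inner product of phi(d) h with k. Each
    phi(d) is the compression of left multiplication by d on a semi-inner product space, and null
    vectors take the place of a quotient. Positivity is handled through commuting square roots in
    place of spectral theory. Surjectivity onto E does not go through closedness of the range:
    norm-controlled lifts of a dense set are summed in a convergent series. *)

Section AbelianNormalization.

(** The algebras are noncommutative: identities are first expanded by distributivity, and [abel]
    then compares the integer coefficients of the resulting monomials, taken as atoms of an additive
    group. *)
Inductive abexpr := AbAtom of nat | Ab0 | AbAdd of abexpr & abexpr | AbOpp of abexpr.

Fixpoint abeval (V : zmodType) (env : seq V) e : V :=
  match e with
  | AbAtom n => env`_n
  | Ab0 => 0
  | AbAdd e1 e2 => abeval env e1 + abeval env e2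
  | AbOpp e1 => - abeval env e1
  end.

Fixpoint abcoef e (i : nat) : int :=
  match e with
  | AbAtom n => (n == i)%:Z
  | Ab0 => 0
  | AbAdd e1 e2 => abcoef e1 i + abcoef e2 i
  | AbOpp e1 => - abcoef e1 i
  end.

Lemma abevalE (V : zmodType) (env : seq V) e :
  abeval env e = \sum_(i < size env) env`_i *~ abcoef e i.
Proof.
elim: e => [n||e1 IH1 e2 IH2|e1 IH1] /=; rewrite ?IH1 ?IH2.
- have [ns|ns] := ltnP n (size env).
    rewrite (bigD1 (Ordinal ns))//= eqxx mulr1z big1 ?addr0// => i ni.
    by have /negPf -> : n != i by apply: contra ni => /eqP ni; apply/eqP/val_inj.
  rewrite nth_default// big1// => i _.
  by have /negPf -> : n != i; [rewrite gtn_eqF// (leq_trans _ ns)|].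
- by rewrite big1// => i _; rewrite mulr0z.
- by rewrite -big_split/=; apply: eq_bigr => i _; rewrite mulrzDr.
- by rewrite -sumrN; apply: eq_bigr => i _; rewrite mulrNz.
Qed.

Lemma abeval_eq (V : zmodType) (env : seq V) n e1 e2 : size env = n ->
  all (fun i => abcoef e1 i == abcoef e2 i) (iota 0 n) ->
  abeval env e1 = abeval env e2.
Proof.
move=> <- /allP H; rewrite !abevalE; apply: eq_bigr => i _.
by rewrite (eqP (H i _))// mem_iota leq0n add0n ltn_ord.
Qed.

End AbelianNormalization.

(* Equality of atoms, up to the algebraic structures through which the operations
   are inferred. *)
Ltac ab_same x y :=
  first
  [ constr_eq x y
  | lazymatch constr:((x, y)) with
    | ((?a + ?b)%R, (?c + ?d)%R) => ab_same a c; ab_same b d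
    | ((?a * ?b)%R, (?c * ?d)%R) => ab_same a c; ab_same b d
    | ((?a *: ?b)%R, (?c *: ?d)%R) => ab_same a c; ab_same b d
    | ((- ?a)%R, (- ?b)%R) => ab_same a b
    | (0%R, 0%R) => idtac
    | (1%R, 1%R) => idtac
    | (?f ?a, ?g ?b) => ab_same f g; first [ ab_same a b | unify a b ]
    end ].
Ltac ab_index x l :=
  lazymatch l with
  | ?y :: ?l' => match constr:(Set) with
      | _ => let _ := match goal with _ => ab_same x y end in constr:(0%N)
      | _ => let n := ab_index x l' in constr:(n.+1) end
  end.
Ltac ab_atoms e l :=
  lazymatch e with
  | 0%R => l
  | (?a + ?b)%R => let l1 := ab_atoms a l in ab_atoms b l1
  | (- ?a)%R => ab_atoms a l
  | _ => match constr:(Set) with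
     | _ => let _ := ab_index e l in l
     | _ => constr:(e :: l) end
  end.
Ltac ab_reify e l :=
  lazymatch e with
  | 0%R => constr:(Ab0)
  | (?a + ?b)%R => let a' := ab_reify a l in let b' := ab_reify b l in constr:(AbAdd a' b')
  | (- ?a)%R => let a' := ab_reify a l in constr:(AbOpp a')
  | _ => let n := ab_index e l in constr:(AbAtom n)
  end.
Ltac ab_size l :=
  lazymatch l with _ :: ?l' => let n := ab_size l' in constr:(n.+1) | _ => constr:(0%N) end.
Ltac abel :=
  lazymatch goal with
  | |- @eq ?T ?x ?y =>
    let l := ab_atoms x (@nil T) in let l := ab_atoms y l in
    let x' := ab_reify x l in let y' := ab_reify y l in
    let n := ab_size l in
    let H := fresh in
    pose proof (H := @abeval_eq _ l n x' y' (erefl n) (erefl true));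
    cbv beta iota delta [abeval nth] in H; exact H
  end.

(** * Positive elements of a C*-algebra *)

Lemma conjcK (K : realType) (t : K) : (t%:K)^* = t%:K.
Proof. by apply: CrealP; rewrite complex_real. Qed.

Lemma conjci (K : realType) : ('i : K[i])^* = - 'i.
Proof. exact: conjCi. Qed.

Lemma mulci (K : realType) : 'i * 'i = -1 :> K[i].
Proof. by rewrite -expr2 sqrCi. Qed.

Section CStarBasics.
Context {K : realType} {B : cstarType K}.
Implicit Types a b c h r s x y : B.

Lemma cnorm0 : cnorm (0 : B) = 0.
Proof. by rewrite -(scale0r (0 : B)) cnormZ normc0 mul0r. Qed.

Lemma cnormN a : cnorm (- a) = cnorm a.
Proof. by rewrite -scaleN1r cnormZ normcN normc1 mul1r. Qed.

Lemma cnorm_ge0 a : 0 <= cnorm a.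
Proof.
have := cnormD a (- a); rewrite subrr cnorm0 cnormN -mulr2n -mulr_natl.
by rewrite pmulr_rge0.
Qed.

Lemma cnormB a b : cnorm (a - b) = cnorm (b - a).
Proof. by rewrite -cnormN opprB. Qed.

Lemma cnorm_le_add a b : cnorm a <= cnorm b + cnorm (a - b).
Proof. by rewrite -{1}(subrK b a) addrC; exact: cnormD. Qed.

Lemma cnorm_trans a b c : cnorm (a - c) <= cnorm (a - b) + cnorm (b - c).
Proof. by rewrite -(subrKA b); exact: cnormD. Qed.

Lemma cnorm_sum (I : Type) (r : seq I) (P : pred I) (F : I -> B) :
  cnorm (\sum_(i <- r | P i) F i) <= \sum_(i <- r | P i) cnorm (F i).
Proof.
elim/big_ind2: _ => [|x s y t xs yt|//]; first by rewrite cnorm0.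
by rewrite (le_trans (cnormD _ _))// lerD.
Qed.

Lemma cnormZr (t : K) a : 0 <= t -> cnorm (t%:K *: a) = t * cnorm a.
Proof. by move=> t0; rewrite cnormZ normc_real ger0_norm. Qed.

Lemma half_double a : (2^-1)%:K *: a + (2^-1)%:K *: a = a.
Proof.
rewrite -scalerDl -rmorphD (_ : 2^-1 + 2^-1 = 1) ?rmorph1 ?scale1r//.
by field.
Qed.

Lemma adjB a b : adj (a - b) = adj a - adj b.
Proof. by rewrite adjD -(scaleN1r b) adjZ rmorphN1 scaleN1r. Qed.

Lemma adj0 : adj (0 : B) = 0.
Proof. by rewrite -(subrr (0 : B)) adjB !subrr. Qed.

Lemma adj1 : adj (1 : B) = 1.
Proof. have e : adj (adj 1 * 1) = adj 1 * 1 :> B by rewrite adjM adjK.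
by move: e; rewrite mulr1 adjK. Qed.

Lemma adj_sum (I : Type) (r : seq I) (P : pred I) (F : I -> B) :
  adj (\sum_(i <- r | P i) F i) = \sum_(i <- r | P i) adj (F i).
Proof. exact: (big_morph _ adjD adj0). Qed.

Lemma adjZr (t : K) a : adj (t%:K *: a) = t%:K *: adj a.
Proof. by rewrite adjZ conjcK. Qed.

Lemma cnorm_adj a : cnorm (adj a) = cnorm a.
Proof.
have H b : cnorm b <= cnorm (adj b).
  have := cnormM (adj b) b; rewrite cnorm_adjM expr2.
  have [->|b0] := eqVneq (cnorm b) 0; first by rewrite cnorm_ge0.
  by rewrite ler_pM2r// lt_neqAle eq_sym b0 cnorm_ge0.
by apply/eqP; rewrite eq_le H andbT -{2}[a]adjK H.
Qed.

Lemma cnorm1 : cnorm (1 : B) = 1.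
Proof.
have := cnorm_adjM (1 : B); rewrite mulr1 adj1 => /eqP.
rewrite expr2 eq_sym -subr_eq0 -{3}[cnorm 1]mulr1 -mulrBr mulf_eq0 subr_eq0.
by case/orP => /eqP // /cnorm_eq0/eqP; rewrite oner_eq0.
Qed.

Lemma cnorm_sq h : adj h = h -> cnorm (h * h) = cnorm h ^+ 2.
Proof. by move=> hh; rewrite -{1}hh cnorm_adjM. Qed.

Lemma cnorm_le0 a : cnorm a <= 0 -> a = 0.
Proof. by move=> a0; apply: cnorm_eq0; apply/eqP; rewrite eq_le a0 cnorm_ge0. Qed.

Lemma sa_sq_eq0 h : adj h = h -> h * h = 0 -> h = 0.
Proof.
move=> hh h2; apply: cnorm_eq0; apply/eqP.
by rewrite -sqrf_eq0 -cnorm_sq// h2 cnorm0.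
Qed.

(** The hypothesis makes [w] nondecreasing; being bounded it converges, and its Cauchy estimates
    pass to [u]. The same criterion serves the square root iteration and the geometric
    approximations. *)
Lemma cnorm_limit (u : nat -> B) (w : nat -> K) (M : K) :
  (forall n, cnorm (u n.+1 - u n) <= w n.+1 - w n) -> (forall n, w n <= M) ->
  exists l, forall e, 0 < e -> exists N, forall n, (N <= n)%N -> cnorm (u n - l) < e.
Proof.
move=> uw wM.
have w_nd n m : (n <= m)%N -> w n <= w m.
  move=> /subnK <-; elim: (m - n)%N => [|k IH]; first by rewrite add0n.
  by rewrite (le_trans IH)// addSn -subr_ge0 (le_trans (cnorm_ge0 _) (uw _)).
have ub n m : (n <= m)%N -> cnorm (u m - u n) <= w m - w n.
  move=> /subnK <-; elim: (m - n)%N => [|k IH]; first by rewrite add0n !subrr cnorm0.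
  rewrite (le_trans (cnorm_trans _ (u (k + n)%N) _))//.
  have := lerD (uw (k + n)%N) IH; rewrite addSn; lra.
have wc : exists l : K, w n @[n --> \oo] --> l.
  exists (sup (range w)); apply: nondecreasing_cvgn; last by exists M => _ [n _ <-].
  by move=> n m nm; exact: w_nd.
case: wc => l wl.
have wcauchy (e : K) : 0 < e -> exists N, forall n, (N <= n)%N -> `|w n - l| < e.
  move=> e0; have /cvgrPdist_lt/(_ _ e0)[N _ HN] := wl.
  by exists N => n Nn; rewrite distrC; exact: HN.
have [|L HL] := @cnorm_complete K B u.
  move=> e e0; have [|N HN] := wcauchy (e / 2); first by rewrite divr_gt0.
  exists N => m n Nm Nn.
  have H p q : (N <= p)%N -> (N <= q)%N -> (q <= p)%N -> cnorm (u p - u q) < e.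
    move=> Np Nq qp; apply: le_lt_trans (ub _ _ qp) _.
    move: (HN _ Np) (HN _ Nq); rewrite !ltr_norml => /andP[_ h1] /andP[h2 _]; lra.
  by case/orP: (leq_total n m) => nm; [|rewrite cnormB]; exact: H.
exists L => e e0; have /cvgrPdist_lt/(_ _ e0)[N _ HN] := HL.
by exists N => n Nn; have := HN n Nn; rewrite sub0r normrN ger0_norm// cnorm_ge0.
Qed.

Lemma cnorm_lim_unique (u : nat -> B) l l' :
  (forall e, 0 < e -> exists N, forall n, (N <= n)%N -> cnorm (u n - l) < e) ->
  (forall e, 0 < e -> exists N, forall n, (N <= n)%N -> cnorm (u n - l') < e) -> l = l'.
Proof.
move=> ul ul'; apply/eqP; rewrite -subr_eq0; apply/eqP/cnorm_le0.
rewrite leNgt; apply/negP => d0.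
have e0 : 0 < cnorm (l - l') / 2 by rewrite divr_gt0.
have [N HN] := ul _ e0; have [N' HN'] := ul' _ e0.
pose n := maxn N N'.
have h1 := HN n (leq_maxl _ _); have h2 := HN' n (leq_maxr _ _).
have := cnorm_trans l (u n) l'; rewrite (cnormB l (u n)); lra.
Qed.

Lemma cnorm_small a (M : K) : 0 <= M -> (forall e, 0 < e -> cnorm a <= M * e) -> a = 0.
Proof.
move=> M0 H; apply: cnorm_le0; rewrite leNgt; apply/negP => a0.
have M1 : 0 < M + 1 by rewrite ltr_wpDl.
have e0 : 0 < cnorm a / (M + 1) by rewrite divr_gt0.
have := H _ e0; rewrite leNgt => /negP; apply.
by rewrite mulrCA gtr_pMr// ltr_pdivrMr// mul1r ltrDl.
Qed.

End CStarBasics.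

Section Psd.
Context {K : realType} {B : cstarType K}.
Implicit Types a b c h p q r s x y : B.

(* The solution s = 1 - w of s^2 = 1 - r is the limit of w := (r + w^2) / 2;
   the increments are dominated by those of the same scalar iteration at r = 1. *)
Fixpoint sqrt_iter r n : B :=
  if n is m.+1 then (2^-1)%:K *: (r + sqrt_iter r m * sqrt_iter r m) else 0.

Fixpoint sqrt_iter1 n : K :=
  if n is m.+1 then 2^-1 * (1 + sqrt_iter1 m * sqrt_iter1 m) else 0.

Lemma sqrt_iter1_bound n : 0 <= sqrt_iter1 n <= 1.
Proof.
elim: n => [|n /andP[IH0 IH1]] /=; first by rewrite lexx ler01.
by apply/andP; split; nra.
Qed.

Lemma sqrt_iter_norm r n : cnorm r <= 1 -> cnorm (sqrt_iter r n) <= sqrt_iter1 n.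
Proof.
move=> r1; elim: n => [|n IH] /=; first by rewrite cnorm0.
rewrite cnormZr ?invr_ge0// ler_pM2l ?invr_gt0//.
rewrite (le_trans (cnormD _ _))// lerD// (le_trans (cnormM _ _))//.
by apply: ler_pM => //; exact: cnorm_ge0.
Qed.

Lemma sqrt_iter_comm r c n : c * r = r * c -> c * sqrt_iter r n = sqrt_iter r n * c.
Proof.
move=> cr; elim: n => [|n IH] /=; first by rewrite mulr0 mul0r.
by rewrite -scalerAl -scalerAr mulrDl mulrDr cr mulrA IH -!mulrA IH.
Qed.

Lemma sqrt_iter_adj r n : adj r = r -> adj (sqrt_iter r n) = sqrt_iter r n.
Proof.
move=> ar; elim: n => [|n IH] /=; first by rewrite adj0.
by rewrite adjZr adjD adjM IH ar.
Qed.

(** Consecutive iterates w, w' commute, so the next increment is (w' + w)(w' - w) / 2; the scalar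
    iteration factors identically. *)
Lemma sqrt_iter_step r n : cnorm r <= 1 ->
  cnorm (sqrt_iter r n.+1 - sqrt_iter r n) <= sqrt_iter1 n.+1 - sqrt_iter1 n.
Proof.
move=> r1; elim: n => [|n IH].
  rewrite /= !subr0 mul0r addr0 cnormZr ?invr_ge0//; nra.
set w' := sqrt_iter r n.+1; set w := sqrt_iter r n.
have -> : sqrt_iter r n.+2 - sqrt_iter r n.+1 = (2^-1)%:K *: ((w' + w) * (w' - w)).
  have ww : w * w' = w' * w by apply: sqrt_iter_comm; rewrite sqrt_iter_comm.
  change ((2^-1)%:K *: (r + w' * w') - (2^-1)%:K *: (r + w * w) = (2^-1)%:K *: ((w' + w) * (w' - w))).
  rewrite -scalerBr; congr (_ *: _).
  by rewrite mulrDl !mulrBr ww subrKA opprD addrACA subrr add0r.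
rewrite cnormZr ?invr_ge0//.
have h1 := sqrt_iter_norm n.+1 r1; have h2 := sqrt_iter_norm n r1.
have -> : sqrt_iter1 n.+2 - sqrt_iter1 n.+1 =
   2^-1 * ((sqrt_iter1 n.+1 + sqrt_iter1 n) * (sqrt_iter1 n.+1 - sqrt_iter1 n)).
  set v' := sqrt_iter1 n.+1; set v := sqrt_iter1 n.
  change (2^-1 * (1 + v' * v') - 2^-1 * (1 + v * v) = 2^-1 * ((v' + v) * (v' - v))).
  by ring.
rewrite ler_pM2l ?invr_gt0// (le_trans (cnormM _ _))//.
apply: ler_pM; rewrite ?cnorm_ge0// (le_trans (cnormD _ _))// lerD//.
Qed.

(** The last two clauses replace functional calculus: |1 - s| <= 1 makes [s] positive, and [s]
    commutes with whatever commutes with [r]. *)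
Lemma sqrt1B r : adj r = r -> cnorm r <= 1 ->
  exists s, [/\ adj s = s, s * s = 1 - r, cnorm (1 - s) <= 1
    & forall c, c * r = r * c -> c * s = s * c].
Proof.
move=> ar r1.
have [l Hl] := cnorm_limit (fun n => sqrt_iter_step n r1)
  (fun n => proj2 (andP (sqrt_iter1_bound n))).
(* An identity for the limit is proved by bounding its defect linearly in the distance from [l] to
   two consecutive iterates. *)
have small : forall x (M : K), 0 <= M ->
    (forall e n, 0 < e -> e <= 1 -> cnorm (sqrt_iter r n - l) < e ->
       cnorm (sqrt_iter r n.+1 - l) < e -> cnorm x <= M * e) -> x = 0.
  move=> x M M0 H; apply: (@cnorm_small _ _ _ M M0) => e e0.
  have e1 : 0 < Num.min e 1 by rewrite lt_min e0 ltr01.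
  have [N HN] := Hl _ e1.
  apply: le_trans (H _ N e1 _ (HN N (leqnn _)) (HN N.+1 (leqnSn _))) _.
    by rewrite ge_min lexx orbT.
  by rewrite ler_wpM2l// ge_min lexx.
have wn n : cnorm (sqrt_iter r n) <= 1.
  by rewrite (le_trans (sqrt_iter_norm _ r1))//; case/andP: (sqrt_iter1_bound n).
have l1 : cnorm l <= 1.
  rewrite leNgt; apply/negP; rewrite -subr_gt0 => /Hl[N /(_ N (leqnn _))].
  have := cnorm_le_add l (sqrt_iter r N); rewrite cnormB; have := wn N; lra.
have al : adj l = l.
  apply/eqP; rewrite -subr_eq0; apply/eqP; apply: (small _ 2) => // e n _ _ h _.
  rewrite (le_trans (cnorm_trans _ (sqrt_iter r n) _))//.
  by rewrite -{1}(sqrt_iter_adj n ar) -adjB cnorm_adj cnormB mulr_natl mulr2n ltW// ltrD.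
have cl c : c * r = r * c -> c * l = l * c.
  move=> cr; apply/eqP; rewrite -subr_eq0; apply/eqP.
  apply: (small _ (2 * cnorm c)) => [|e n _ _ h _]; first by rewrite mulr_ge0 ?cnorm_ge0.
  have -> : c * l - l * c = c * (l - sqrt_iter r n) + (sqrt_iter r n - l) * c.
    by rewrite mulrBr mulrBl (sqrt_iter_comm n cr) subrKA.
  have -> : 2 * cnorm c * e = cnorm c * e + e * cnorm c by ring.
  rewrite (le_trans (cnormD _ _))// lerD// (le_trans (cnormM _ _))//.
    by rewrite cnormB ler_wpM2l ?cnorm_ge0// ltW.
  by rewrite ler_wpM2r ?cnorm_ge0// ltW.
(* Limit of the recursion 2 w' = r + w^2; the 4 counts the error terms. *)
have ll : l + l = r + l * l.
  apply/eqP; rewrite -subr_eq0; apply/eqP; apply: (small _ 4) => // e n e0 e1 h h'.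
  set w := sqrt_iter r n; set w' := sqrt_iter r n.+1.
  have E : w' + w' = r + w * w by rewrite /w' /= half_double.
  have -> : l + l - (r + l * l) = (l - w') + (l - w') + (w * (w - l) + (w - l) * l).
    have -> : r = w' + w' - w * w by rewrite E addrK.
    by rewrite mulrBr mulrBl; abel.
  rewrite (le_trans (cnormD _ _))//.
  have -> : 4 * e = (e + e) + (1 * e + e * 1) by ring.
  apply: lerD; rewrite (le_trans (cnormD _ _))//; apply: lerD.
  - by rewrite cnormB ltW.
  - by rewrite cnormB ltW.
  - by apply: le_trans (cnormM _ _) _; apply: ler_pM; [exact: cnorm_ge0..|exact: wn|exact: ltW].
  - by apply: le_trans (cnormM _ _) _; apply: ler_pM; [exact: cnorm_ge0..|exact: ltW|].
exists (1 - l); split.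
- by rewrite adjB adj1 al.
- have -> : r = l + l - l * l by rewrite ll addrK.
  by rewrite mulrBl mul1r mulrBr mulr1; abel.
- by rewrite subKr.
- by move=> c /cl cc; rewrite mulrBr mulrBl mulr1 mul1r cc.
Qed.

(** Positivity without spectra: for self-adjoint x, |t - x| <= t says that the spectrum lies in
    [0, 2t]. Closure under sums is then the triangle inequality. *)
Definition psd x : Prop := adj x = x /\ exists2 t : K, 0 <= t & cnorm (t%:K%:A - x) <= t.

Lemma real_algD (t t' : K) : (t + t')%:K%:A = t%:K%:A + t'%:K%:A :> B.
Proof. by rewrite rmorphD scalerDl. Qed.

Lemma psd0 : psd 0.
Proof. by split; rewrite ?adj0//; exists 0 => //; rewrite scale0r subrr cnorm0. Qed.

Lemma psdD x y : psd x -> psd y -> psd (x + y).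
Proof.
move=> [ax [t t0 tx]] [ay [t' t0' ty]]; split; first by rewrite adjD ax ay.
exists (t + t'); first exact: addr_ge0.
by rewrite real_algD opprD addrACA (le_trans (cnormD _ _))// lerD.
Qed.

Lemma psd_sum (I : Type) (r : seq I) (P : pred I) (F : I -> B) :
  (forall i, P i -> psd (F i)) -> psd (\sum_(i <- r | P i) F i).
Proof. by move=> H; apply: big_ind => //; [exact: psd0|exact: psdD]. Qed.

Lemma psdZ (t : K) x : 0 <= t -> psd x -> psd (t%:K *: x).
Proof.
move=> t0 [ax [s s0 sx]]; split; first by rewrite adjZr ax.
exists (t * s); first exact: mulr_ge0.
by rewrite rmorphM -scalerA -scalerBr cnormZr// ler_wpM2l.
Qed.

Lemma psd_sub_norm (t : K) x : adj x = x -> cnorm x <= t -> psd (t%:K%:A - x).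
Proof.
move=> ax xt; split; first by rewrite adjB adjZr adj1 ax.
by exists t; [exact: le_trans (cnorm_ge0 _) xt|rewrite subKr].
Qed.

Lemma psd_real (t : K) : psd t%:K%:A -> 0 <= t.
Proof.
move=> [_ [s s0]]; rewrite -scalerBl -rmorphB cnormZ normc_real cnorm1 mulr1.
by rewrite ler_norml => /andP[_]; rewrite gerBl.
Qed.

(** After rescaling, r = 1 - x / t has norm at most 1, and the root is sqrt(t) times the root of 1 -
    r. *)
Lemma sqrt_psd x : psd x ->
  exists h, [/\ psd h, h * h = x & forall c, c * x = x * c -> c * h = h * c].
Proof.
move=> [ax [t t0 tx]]; have [t00|tn0] := eqVneq t 0.
  have -> : x = 0.
    by apply: cnorm_le0; move: tx; rewrite t00 scale0r sub0r cnormN.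
  by exists 0; split; rewrite ?mulr0//; first exact: psd0.
have tp : 0 < t by rewrite lt_neqAle eq_sym tn0.
pose r := 1 - (t^-1)%:K *: x.
have rE : r = (t^-1)%:K *: (t%:K%:A - x).
  by rewrite scalerBr scalerA -rmorphM mulVf// scale1r.
have ar : adj r = r by rewrite adjB adj1 adjZr ax.
have r1 : cnorm r <= 1.
  by rewrite rE cnormZr ?invr_ge0// -(mulVf tn0) ler_wpM2l ?invr_ge0.
have [s [as_ ss s1 sc]] := sqrt1B ar r1.
exists ((Num.sqrt t)%:K *: s); split.
- split; first by rewrite adjZr as_.
  exists (Num.sqrt t); first exact: sqrtr_ge0.
  by rewrite -scalerBr cnormZr ?sqrtr_ge0// -[leRHS]mulr1 ler_wpM2l ?sqrtr_ge0.
- rewrite -scalerAl -scalerAr scalerA -rmorphM -expr2 sqr_sqrtr// ss.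
  by rewrite /r subKr scalerA -rmorphM mulfV// scale1r.
- move=> c cx; rewrite -scalerAl -scalerAr sc// /r mulrBr mulrBl mulr1 mul1r.
  by rewrite -scalerAl -scalerAr cx.
Qed.

(* h + i s has square modulus h^2 + s^2. *)
Lemma sum_sq_adj h s : adj h = h -> adj s = s -> h * s = s * h ->
  adj (h + 'i *: s) * (h + 'i *: s) = h * h + s * s.
Proof.
move=> ah as_ hs; rewrite adjD adjZ conjci ah as_ mulrDl !mulrDr.
rewrite -!scalerAr -!scalerAl scalerA mulrN mulci opprK scale1r hs scaleNr.
by abel.
Qed.

(** [h] is the real part of u = h + i s, and the C*-identity gives |u|^2 = |h^2 + s^2| = t. *)
Lemma cnorm_sum_sq h s (t : K) : 0 <= t -> adj h = h -> adj s = s -> h * s = s * h ->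
  h * h + s * s = t%:K%:A -> cnorm (h * h) <= t.
Proof.
move=> t0 ah as_ hs E; set u := h + 'i *: s.
have nu : cnorm u ^+ 2 = t.
  by rewrite -cnorm_adjM /u sum_sq_adj// E cnormZr// cnorm1 mulr1.
rewrite cnorm_sq// -nu ler_pXn2r ?nnegrE ?cnorm_ge0//.
have -> : h = (2^-1)%:K *: (u + adj u).
  rewrite /u adjD adjZ conjci ah as_ scaleNr addrACA subrr addr0.
  by rewrite scalerDr half_double.
rewrite cnormZr ?invr_ge0// (le_trans (_ : _ <= 2^-1 * (cnorm u + cnorm u)))//.
  by rewrite ler_wpM2l ?invr_ge0// (le_trans (cnormD _ _))// cnorm_adj.
by rewrite mulrDr -mulrDl (_ : 2^-1 + 2^-1 = 1) ?mul1r//; field.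
Qed.

(** For t = |h|^2 the element t - h^2 is the square of a self-adjoint element commuting with [h];
    the two squares add up to t, so [cnorm_sum_sq] bounds |t - h^2| by t. *)
Lemma psd_sq h : adj h = h -> psd (h * h).
Proof.
move=> ah; have [->|h0] := eqVneq h 0; first by rewrite mulr0; exact: psd0.
split; first by rewrite adjM ah.
pose t := cnorm h ^+ 2; have tp : 0 < t.
  by rewrite exprn_gt0// lt_neqAle cnorm_ge0 andbT eq_sym; apply: contra h0 => /eqP/cnorm_eq0->.
pose r := (t^-1)%:K *: (h * h).
have [|| s [as_ ss _ sc]] := @sqrt1B r; first by rewrite adjZr adjM ah.
  by rewrite cnormZr ?invr_ge0 ?(ltW tp)// cnorm_sq// mulVf// gt_eqF.
have hs : h * s = s * h by apply: sc; rewrite -scalerAl -scalerAr mulrA.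
have st0 := sqrtr_ge0 t.
have stt : (Num.sqrt t)%:K *: s * ((Num.sqrt t)%:K *: s) = t%:K%:A - h * h.
  rewrite -scalerAl -scalerAr scalerA -rmorphM -expr2 sqr_sqrtr ?ltW// ss scalerBr.
  by rewrite scalerA -rmorphM mulfV ?gt_eqF// scale1r.
exists t; first exact: ltW.
rewrite -stt; apply: (@cnorm_sum_sq _ h); rewrite ?(ltW tp)//.
- by rewrite adjZr as_.
- by rewrite -scalerAl -scalerAr hs.
- by rewrite stt subrK.
Qed.

(** x and t - x have commuting square roots whose squares sum to t. *)
Lemma psd_cnorm_le (t : K) x : psd x -> psd (t%:K%:A - x) -> cnorm x <= t.
Proof.
move=> px ptx; have t0 : 0 <= t by apply: psd_real; rewrite -(subrK x t%:K%:A); exact: psdD.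
have [h [[ah _] hh _]] := sqrt_psd px; have [s [[as_ _] ss sc]] := sqrt_psd ptx.
have hs : h * s = s * h.
  by apply: sc; rewrite -hh mulrBr mulrBl -scalerAl -scalerAr mulr1 mul1r mulrA.
by rewrite -hh; apply: (@cnorm_sum_sq _ s) => //; rewrite ss hh addrC subrK.
Qed.

Lemma psd_norm_mono x y : psd x -> psd (y - x) -> cnorm x <= cnorm y.
Proof.
move=> px pyx; have [ay _] : psd y by rewrite -(subrK x y); exact: psdD.
apply: psd_cnorm_le => //.
rewrite (_ : _ - x = ((cnorm y)%:K%:A - y) + (y - x)); last by abel.
by apply: psdD => //; exact: psd_sub_norm.
Qed.

Lemma psd_anti x : psd x -> psd (- x) -> x = 0.
Proof. by move=> px px'; apply: cnorm_le0; apply: psd_cnorm_le => //; rewrite scale0r sub0r. Qed.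

Lemma cartesian a : exists h s, [/\ adj h = h, adj s = s & a = h + 'i *: s].
Proof.
exists ((2^-1)%:K *: (a + adj a)), (- 'i *: ((2^-1)%:K *: (a - adj a))); split.
- by rewrite adjZr adjD adjK addrC.
- rewrite adjZ adjZr adjB adjK -(opprB a) !scalerN -scaleNr; congr (_ *: _).
  by rewrite rmorphN /= conjci opprK.
- rewrite scalerA mulrN mulci opprK scale1r -scalerDr addrACA subrr addr0.
  by rewrite scalerDr half_double.
Qed.

(* With - y^* y = h^2 and c = y h, both c^* c and c c^* are negative, whereas their
   sum is twice the sum of the squares of the real and imaginary parts of c. *)
Lemma neg_adjM_eq0 y : psd (- (adj y * y)) -> y = 0.
Proof.
move=> /sqrt_psd[h [[ah _] hh _]].
set p := adj y * y in hh *; set q := y * adj y.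
have aq : adj q = q by rewrite adjM adjK.
have ap : adj p = p by rewrite adjM adjK.
pose c := y * h.
have cc : adj c * c = - (p * p).
  have hp : h * p = p * h by rewrite -[p]opprK -hh mulrN mulNr mulrA.
  by rewrite adjM ah -mulrA (mulrA _ y) -/p mulrA hp -mulrA hh mulrN.
have cc' : c * adj c = - (q * q).
  by rewrite adjM ah -mulrA (mulrA h) hh mulNr mulrN /p /q !mulrA.
have [a [b [aa ab cE]]] := cartesian c.
have S : adj c * c + c * adj c = (a * a + b * b) + (a * a + b * b).
  rewrite cE adjD adjZ conjci aa ab !mulrDl !mulrDr.
  rewrite -!scalerAr -!scalerAl !scalerA !mulrN !mulNr mulci opprK scale1r !scaleNr.
  by abel.
have pp := psd_sq ap; have pq := psd_sq aq.
have pS : psd (- (p * p + q * q)).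
  by rewrite opprD -cc -cc' S; apply: psdD; apply: psdD; exact: psd_sq.
have E := psd_anti (psdD pp pq) pS.
have p2 : p * p = 0.
  apply: psd_anti => //; rewrite (_ : - _ = q * q)//.
  by apply/eqP; rewrite eq_sym -addr_eq0 addrC E.
have p0 := sa_sq_eq0 ap p2.
by apply: cnorm_eq0; apply/eqP; rewrite -sqrf_eq0 -cnorm_adjM -/p p0 cnorm0.
Qed.

(* h - x, where h = |x|, is twice the negative part of x = y^* y. *)
Lemma psd_adjM y : psd (adj y * y).
Proof.
set x := adj y * y; have ax : adj x = x by rewrite adjM adjK.
have [h [ph hh hc]] := sqrt_psd (psd_sq ax); have [ah _] := ph.
have [k [[ak _] kk kc]] := sqrt_psd ph.
have hx : x * h = h * x by apply: hc; rewrite mulrA.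
pose n := h - x; have an : adj n = n by rewrite adjB ah ax.
have kn : n * k = k * n.
  by apply: kc; rewrite mulrBl mulrBr hx.
have hn : n * h = h * n by rewrite mulrBl mulrBr hx.
have xn : x * n = - (h * n) by rewrite !mulrBr hx hh opprB.
have nn : n * n = h * n + h * n by rewrite {1}/n mulrBl xn opprK.
have knkn : n * (h * n) = k * n * (k * n) by rewrite -kk !mulrA kn.
(* The element - (y n)^* (y n) = - n x n = n h n is the square of the self-adjoint k n, hence
   positive, and [neg_adjM_eq0] applies. *)
have c0 : y * n = 0.
  apply: neg_adjM_eq0.
  rewrite adjM an -mulrA (mulrA _ y) -/x xn mulrN opprK knkn.
  by apply: psd_sq; rewrite adjM ak an kn.
have nx : n * (x * n) = 0 by rewrite /x -(mulrA _ y) c0 !mulr0.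
have nhn : n * (h * n) = 0 by move: nx; rewrite xn mulrN => /eqP; rewrite oppr_eq0 => /eqP.
(* Since n^2 = 2 h n, the product n^2 n^2 is a multiple of n (n h n) = 0. *)
have n2 : n * n = 0.
  apply: sa_sq_eq0; first by rewrite adjM an.
  by rewrite {2}nn mulrDr -mulrA nhn mulr0 addr0.
have n0 := sa_sq_eq0 an n2.
by have -> : x = h by apply/eqP; rewrite eq_sym -subr_eq0 -/n n0.
Qed.

Lemma psd_conj c x : psd x -> psd (adj c * x * c).
Proof.
move=> /sqrt_psd[h [[ah _] <- _]].
by rewrite (_ : _ * c = adj (h * c) * (h * c)); [exact: psd_adjM|rewrite adjM ah !mulrA].
Qed.

End Psd.

(** * The M. Riesz extension theorem *)

Section RieszExtension.
Context {K : realType} {V : lmodType K[i]}.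
Variables (C : set V) (g0 : set (V * K)).

(** Partial real functionals are encoded by their graphs: extension becomes inclusion, and Zorn's
    lemma applies to unions of chains. *)
Definition real_linear_graph (g : set (V * K)) : Prop :=
  forall c v s w t, g (v, s) -> g (w, t) -> g (c%:K *: v + w, c * s + t).

Definition positive_graph (g : set (V * K)) : Prop :=
  forall v t, g (v, t) -> C v -> 0 <= t.

(** In the order of the cone, v lies between -w and w for some w in the initial domain. The two
    bounds make the set of admissible values at v nonempty and bounded. *)
Definition dominated (v : V) : Prop := exists w t, [/\ g0 (w, t), C (w - v) & C (w + v)].

Hypotheses (C0 : C 0) (CD : forall v w, C v -> C w -> C (v + w))
  (CZ : forall (c : K) v, 0 <= c -> C v -> C (c%:K *: v)).
Hypotheses (g00 : g0 (0, 0)) (g0l : real_linear_graph g0) (g0p : positive_graph g0).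

Let good (g : set (V * K)) := [/\ g0 `<=` g, real_linear_graph g & positive_graph g].

Lemma graph_unique g v s t : good g -> g (v, s) -> g (v, t) -> s = t.
Proof.
move=> [sg lg pg] gs gt.
have H a b : g (v, a) -> g (v, b) -> a <= b.
  move=> ga gb; have := lg (-1) _ _ _ _ ga gb.
  rewrite rmorphN1 scaleN1r addNr mulN1r => /pg/(_ C0).
  by rewrite addrC subr_ge0.
by apply/eqP; rewrite eq_le !H.
Qed.

(** The new value at [y] is the supremum of the values of [g] at elements below [y]. For c y + v in
    the cone, v / (-c) lies above [y] when c < 0 and - v / c lies below [y] when c > 0. *)
Lemma extend_graph g y : good g -> dominated y ->
  exists a, good [set vt | exists v t c, g (v, t) /\ vt = (c%:K *: y + v, c * a + t)].
Proof.
move=> [sg lg pg] [w [b [gwb Cm Cp]]].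
have g00' : g (0, 0) by exact: sg.
have gZ (c : K) v t : g (v, t) -> g (c%:K *: v, c * t).
  by move=> gv; have := lg c _ _ _ _ gv g00'; rewrite !addr0.
have gB v s v' t : g (v, s) -> g (v', t) -> g (v' - v, t - s).
  move=> gs gt; have := lg (-1) _ _ _ _ gs gt.
  by rewrite rmorphN1 scaleN1r mulN1r addrC [- s + _]addrC.
pose L := [set t | exists2 v, g (v, t) & C (y - v)].
have L0 : L (- b).
  exists (- w); last by rewrite opprK addrC.
  by have := gZ (-1) _ _ (sg _ gwb); rewrite rmorphN1 scaleN1r mulN1r.
have Lub v t : g (v, t) -> C (v - y) -> ubound L t.
  move=> gv Cv s [v' gv' Cv']; rewrite -subr_ge0.
  by apply: (pg (v - v')); [exact: gB|rewrite -(subrKA y); exact: CD].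
exists (sup L); split.
- by move=> [v t] gv; exists v, t, 0; split; [exact: sg|rewrite rmorph0 scale0r mul0r !add0r].
- move=> c _ _ _ _ [v [s [d [gv [-> ->]]]]] [v' [s' [d' [gv' [-> ->]]]]].
  exists (c%:K *: v + v'), (c * s + s'), (c * d + d'); split; first exact: lg.
  rewrite rmorphD rmorphM scalerDl scalerDr scalerA; congr pair; first exact: addrACA.
  by ring.
- move=> _ _ [v [t [c [gv [-> ->]]]]] Cv.
  have [c0|c0|c0] := ltgtP c 0.
  + have nc : 0 < - c by rewrite oppr_gt0.
    have : sup L <= (- c)^-1 * t.
      apply: ge_sup; first by exists (- b).
      apply: (Lub (((- c)^-1)%:K *: v)); first exact: gZ.
      rewrite (_ : _ - y = ((- c)^-1)%:K *: (c%:K *: y + v)).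
        by apply: CZ => //; rewrite invr_ge0 ltW.
      rewrite scalerDr scalerA -rmorphM invrN mulNr mulVf ?lt_eqF// rmorphN1 scaleN1r.
      by rewrite addrC.
    by rewrite ler_pdivlMl// mulNr; lra.
  + have : - (c^-1 * t) <= sup L.
      apply: ub_le_sup; first by exists b; apply: Lub Cm; exact: sg.
      exists (- (c^-1)%:K *: v).
        by have := gZ (- c^-1) _ _ gv; rewrite rmorphN mulNr.
      rewrite scaleNr opprK (_ : _ + _ = (c^-1)%:K *: (c%:K *: y + v)).
        by apply: CZ => //; rewrite invr_ge0 ltW.
      by rewrite scalerDr scalerA -rmorphM mulVf ?gt_eqF// scale1r.
    by rewrite -mulrN ler_pdivrMl//; lra.
  + by move: Cv; rewrite c0 rmorph0 scale0r mul0r !add0r; exact: pg.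
Qed.

Theorem riesz_extension : exists f : V -> K,
  [/\ forall v t, g0 (v, t) -> f v = t,
      forall (c : K) v w, dominated v -> dominated w -> f (c%:K *: v + w) = c * f v + f w
    & forall v, dominated v -> C v -> 0 <= f v].
Proof.
(* Adjoining [g0] to each member keeps the empty chain admissible. *)
have [|A [gA maxA]] := @Zorn_bigcup _ [set h | good (h `|` g0)].
  move=> F FP Ftot.
  have [F0|/set0P[h0 Fh0]] := eqVneq F set0.
    by rewrite F0 /= bigcup_set0 set0U; split.
  have mem x : (\bigcup_(X in F) X `|` g0) x <-> exists2 h, F h & (h `|` g0) x.
    split=> [[[h Fh hx]|gx]|[h Fh [hx|gx]]].
    - by exists h => //; left.
    - by exists h0 => //; right.
    - by left; exists h.
    - by right.
  split.
  - by move=> x gx; right.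
  - move=> c v s w t /mem[h Fh hv] /mem[h' Fh' hw]; apply/mem.
    have [hh|hh] := Ftot _ _ Fh Fh'.
    + have [_ l _] := FP _ Fh'; exists h' => //; apply: l => //.
      by case: hv => [/hh ?|?]; [left|right].
    + have [_ l _] := FP _ Fh; exists h => //; apply: l => //.
      by case: hw => [/hh ?|?]; [left|right].
  - by move=> v t /mem[h Fh hv] Cv; have [_ _ p] := FP _ Fh; exact: p hv Cv.
set g := A `|` g0 in gA.
have gtot y : dominated y -> exists t, g (y, t).
  move=> dy; apply: contrapT => ny.
  have [a] := extend_graph gA dy; set g' := [set _ | _] => gg'.
  have [sg' _ _] := gg'.
  have gg : g `<=` g'.
    by move=> [v t] gv; exists v, t, 0; split => //; rewrite rmorph0 scale0r mul0r !add0r.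
  apply: (maxA g').
    split=> [x Ax|sub]; first by apply: gg; left.
     apply: ny; exists a; left; apply: sub.
    exists 0, 0, 1; split; first by have [+ _ _] := gA; exact.
    by rewrite rmorph1 scale1r mul1r !addr0.
  by rewrite /= (setUidl sg').
have [sg lg pg] := gA.
pose f v := if pselect (exists t, g (v, t)) is left H then projT1 (cid H) else 0.
have fE v t : g (v, t) -> f v = t.
  move=> gv; rewrite /f; case: pselect => [H|[]]; last by exists t.
  by case: cid => s /= gs; exact: graph_unique gA gs gv.
exists f; split.
- by move=> v t /sg/fE.
- move=> c v w /gtot[s gs] /gtot[t gt].
  by rewrite (fE _ _ gs) (fE _ _ gt); apply: fE; exact: lg.
- by move=> v /gtot[t gt] Cv; rewrite (fE _ _ gt); exact: pg gt Cv.
Qed.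

End RieszExtension.

(** * Norms of operator matrices *)

Section ColumnNorm.
Context {K : realType} {B : cstarType K}.

Definition colsq n (b : 'cV[B]_n) : B := \sum_i adj (b i 0) * b i 0.

Lemma psd_colsq n (b : 'cV[B]_n) : psd (colsq b).
Proof. by apply: psd_sum => i _; exact: psd_adjM. Qed.

Lemma colsqZ n (t : K) (b : 'cV[B]_n) :
  colsq (\col_i (t%:K *: b i 0)) = (t ^+ 2)%:K *: colsq b.
Proof.
rewrite /colsq scaler_sumr; apply: eq_bigr => i _.
by rewrite mxE adjZr -scalerAl -scalerAr scalerA -rmorphM.
Qed.

Lemma cnorm_col n (b : 'cV[B]_n) i : cnorm (b i 0) ^+ 2 <= cnorm (colsq b).
Proof.
rewrite -cnorm_adjM; apply: psd_norm_mono; first exact: psd_adjM.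
rewrite /colsq (bigD1 i)//= addrAC subrr add0r.
by apply: psd_sum => j _; exact: psd_adjM.
Qed.

Lemma mxnorm_le n (M : 'M[B]_n) (c : K) : 0 <= c ->
  (forall b, cnorm (colsq b) <= 1 -> cnorm (colsq (M *m b)) <= c ^+ 2) ->
  (mxnorm M <= c%:E)%E.
Proof.
move=> c0 H; apply: ge_ereal_sup => _ [b /= b1 <-]; rewrite lee_fin.
rewrite -(ger0_norm c0) -sqrtr_sqr ler_wsqrtr// H//.
by rewrite -(sqr_sqrtr (cnorm_ge0 (colsq b))) exprn_ile1// sqrtr_ge0.
Qed.

Lemma mxnorm_ub n (M : 'M[B]_n) (c : K) b : (mxnorm M <= c%:E)%E ->
  cnorm (colsq b) <= 1 -> cnorm (colsq (M *m b)) <= c ^+ 2.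
Proof.
move=> Mc b1; have H : (Num.sqrt (cnorm (colsq (M *m b))) <= c).
  rewrite -lee_fin (le_trans _ Mc)//; apply: ereal_sup_ubound; exists b => //=.
  by rewrite -[leRHS]sqrtr1 ler_wsqrtr.
rewrite -(sqr_sqrtr (cnorm_ge0 (colsq (M *m b)))) ler_pXn2r ?nnegrE ?sqrtr_ge0//.
by rewrite (le_trans _ H)// sqrtr_ge0.
Qed.

Lemma mxnormP n (M : 'M[B]_n) (c : K) b : (mxnorm M <= c%:E)%E ->
  cnorm (colsq (M *m b)) <= c ^+ 2 * cnorm (colsq b).
Proof.
move=> Mc; have [b0|b0] := eqVneq (cnorm (colsq b)) 0.
  have -> : b = 0.
    apply/matrixP => i j; rewrite ord1 mxE; apply: cnorm_eq0; apply/eqP.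
    by rewrite -sqrf_eq0 eq_le sqr_ge0 andbT -b0 cnorm_col.
  rewrite mulmx0 {1}/colsq big1 => [|i _]; last by rewrite mxE mulr0.
  by rewrite cnorm0; apply: mulr_ge0; [exact: sqr_ge0|exact: cnorm_ge0].
have bp : 0 < cnorm (colsq b) by rewrite lt_neqAle eq_sym b0 cnorm_ge0.
set s := cnorm _ in b0 bp *; pose t := (Num.sqrt s)^-1.
have t2 : t ^+ 2 = s^-1 by rewrite /t exprVn sqr_sqrtr// ltW.
have := @mxnorm_ub n M c (\col_i (t%:K *: b i 0)) Mc.
rewrite colsqZ cnormZr ?sqr_ge0// t2 mulVf// => /(_ (lexx _)).
have -> : M *m \col_i (t%:K *: b i 0) = \col_i (t%:K *: (M *m b) i 0).
  apply/matrixP => i j; rewrite !mxE scaler_sumr; apply: eq_bigr => k _.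
  by rewrite mxE scalerAr.
by rewrite colsqZ cnormZr ?sqr_ge0// t2 mulrC ler_pdivrMr.
Qed.

Lemma mxnorm_ge0 n (M : 'M[B]_n) : (0 <= mxnorm M)%E.
Proof.
apply: le_trans (_ : (Num.sqrt (cnorm (colsq (M *m 0))))%:E <= _)%E.
  by rewrite lee_fin sqrtr_ge0.
apply: ereal_sup_ubound; exists 0 => //=; rewrite big1 ?cnorm0 ?sqrtr0// => i _.
by rewrite mxE mulr0.
Qed.

(** The supremum is attained at the column with entry 1. Through 1 x 1 matrices, complete isometry
    gives isometry. *)
Lemma mxnorm1 (a : B) : mxnorm (a%:M : 'M_1) = (cnorm a)%:E.
Proof.
have E (x : 'cV[B]_1) : colsq (a%:M *m x) = adj (a * x 0 0) * (a * x 0 0).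
  by rewrite /colsq big_ord1 mul_scalar_mx mxE.
have le_a : (mxnorm (a%:M : 'M_1) <= (cnorm a)%:E)%E.
  apply: mxnorm_le; first exact: cnorm_ge0.
  move=> b; rewrite E cnorm_adjM /colsq big_ord1 cnorm_adjM => b1.
  rewrite ler_pXn2r ?nnegrE ?cnorm_ge0// (le_trans (cnormM _ _))//.
  rewrite -[leRHS]mulr1 ler_wpM2l ?cnorm_ge0//.
  by rewrite -(@ler_pXn2r _ 2)// ?nnegrE ?cnorm_ge0// expr1n.
apply/eqP; rewrite eq_le le_a /=.
have := mxnorm_ge0 (a%:M : 'M_1); move: le_a.
case E' : (mxnorm (a%:M : 'M_1)) => [c| |] //= _; rewrite !lee_fin => c0.
have : (mxnorm (a%:M : 'M_1) <= c%:E)%E by rewrite E'.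
move=> /(@mxnorm_ub _ _ _ (const_mx 1)); rewrite E mxE mulr1 cnorm_adjM /colsq big_ord1 mxE.
rewrite adj1 mulr1 cnorm1 => /(_ (lexx _)).
by rewrite ler_pXn2r ?nnegrE ?cnorm_ge0.
Qed.

Lemma mxnorm_le_mxnorm (C : cstarType K) n (M : 'M[B]_n) (N : 'M[C]_n) :
  (forall c : K, 0 <= c -> (mxnorm M <= c%:E)%E -> (mxnorm N <= c%:E)%E) ->
  (mxnorm N <= mxnorm M)%E.
Proof.
move=> H; have := mxnorm_ge0 M; case E : (mxnorm M) => [c| |].
- by rewrite lee_fin => c0; apply: H; rewrite // E.
- by move=> _; rewrite leey.
- by rewrite leNgt ltNy0.
Qed.

End ColumnNorm.

Section InnerProduct.
Context {K : realType} {X : choiceType}.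
Implicit Types f g h : ell2 K X.

Lemma innerZl c f g : inner (c *: f) g = c * inner f g.
Proof. exact: linearZl_LR. Qed.

Lemma innerZr c f g : inner f (c *: g) = c^* * inner f g.
Proof. exact: linearZr_LR. Qed.

Lemma innerDl f g h : inner (f + g) h = inner f h + inner g h.
Proof. exact: linearDl. Qed.

Lemma innerDr f g h : inner f (g + h) = inner f g + inner f h.
Proof. exact: linearDr. Qed.

Lemma inner_suml (I : Type) (r : seq I) (P : pred I) (F : I -> ell2 K X) g :
  inner (\sum_(i <- r | P i) F i) g = \sum_(i <- r | P i) inner (F i) g.
Proof. exact: linear_sumlz. Qed.

Lemma inner_sumr (I : Type) (r : seq I) (P : pred I) f (G : I -> ell2 K X) :
  inner f (\sum_(i <- r | P i) G i) = \sum_(i <- r | P i) inner f (G i).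
Proof. exact: linear_sumr. Qed.

End InnerProduct.

Section ColumnOperators.
Context {K : realType} {X : pointedType}.
Implicit Types f g h : ell2 K X.

Lemma rank_one_subproof h : (fun f : ell2 K X => f point *: h) \in @bounded_op K X.
Proof.
apply/asboolP; split=> [c f g|]; first by rewrite ell2DE ell2ZE scalerDl scalerA.
exists (l2norm h) => f; rewrite l2normZ mulrC ler_wpM2l ?l2norm_ge0//.
exact: l2norm_coord.
Qed.

(** A column of such operators encodes a tuple of vectors, recovered by evaluation at
    [delta point]. *)
Definition rank_one h : bop K X := Bop (rank_one_subproof h).

Lemma colsq_inner n (b : 'cV[bop K X]_n) f g :
  inner (colsq b f) g = \sum_i inner (b i 0 f) (b i 0 g).
Proof.
rewrite /colsq; have -> : (\sum_i adj (b i 0) * b i 0) f = \sum_i adjoint (b i 0) (b i 0 f).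
  by elim/big_ind2: _ => [//|T u S v <- <-|].
rewrite inner_suml; apply: eq_bigr => i _.
by rewrite innerC -adjointP -innerC.
Qed.

(** The quadratic form of [colsq b] at f is the sum of the |b_i f|^2. Conversely, Cauchy-Schwarz and
    the arithmetic-geometric inequality turn a bound on this form into a bound on the sesquilinear
    form, hence on the norm. *)
Lemma cnorm_colsqP n (b : 'cV[bop K X]_n) (c : K) :
  cnorm (colsq b) <= c ^+ 2 <->
  forall f, \sum_i l2norm (b i 0 f) ^+ 2 <= c ^+ 2 * l2norm f ^+ 2.
Proof.
have E f : inner (colsq b f) f = (\sum_i l2norm (b i 0 f) ^+ 2)%:K.
  by rewrite colsq_inner rmorph_sum; apply: eq_bigr => i _; rewrite inner_norm.
have S0 f : 0 <= \sum_i l2norm (b i 0 f) ^+ 2 by apply: sumr_ge0 => i _; exact: sqr_ge0.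
split=> [bc f|H].
  have := cauchy_schwarz (colsq b f) f; rewrite E normc_real ger0_norm// => /le_trans -> //.
  rewrite expr2 mulrA ler_wpM2r ?l2norm_ge0// (le_trans (opnormP _ _))//.
  by rewrite ler_wpM2r ?l2norm_ge0.
apply: opnorm_le => [|f]; first exact: sqr_ge0.
set T := colsq b.
have bd g : normc (inner (T f) g) <= 2^-1 * (c ^+ 2 * (l2norm f ^+ 2 + l2norm g ^+ 2)).
  rewrite /T colsq_inner.
  have : normc (\sum_i inner (b i 0 f) (b i 0 g)) <=
      \sum_i (2^-1 * (l2norm (b i 0 f) ^+ 2 + l2norm (b i 0 g) ^+ 2)).
    elim/big_ind2: _ => [|x s y t xs yt|i _]; first by rewrite normc0.
      by rewrite (le_trans (le_normcD _ _))// lerD.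
    rewrite (le_trans (cauchy_schwarz _ _))//.
    by have := sqr_ge0 (l2norm (b i 0 f) - l2norm (b i 0 g)); nra.
  move/le_trans; apply; rewrite -mulr_sumr big_split/= ler_pM2l ?invr_gt0//.
  by rewrite mulrDr lerD.
have [Tf0|Tf0] := eqVneq (l2norm (T f)) 0; first by rewrite Tf0 mulr_ge0 ?sqr_ge0 ?l2norm_ge0.
have Tfp : 0 < l2norm (T f) by rewrite lt_neqAle eq_sym Tf0 l2norm_ge0.
have fp : 0 < l2norm f.
  rewrite lt_neqAle l2norm_ge0 andbT eq_sym; apply: contra Tf0 => /eqP/l2norm_eq0 ->.
  by rewrite linear0 l2norm0.
(* With this t the test vector t T f has the norm of f, which balances the two terms of [bd]. *)
pose t := l2norm f / l2norm (T f).
have t0 : 0 <= t by rewrite divr_ge0 ?l2norm_ge0.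
have := bd (t%:K *: T f).
rewrite innerZr conjcK inner_norm -rmorphM l2normZ !normc_real (ger0_norm t0) ger0_norm; last first.
  by rewrite mulr_ge0// sqr_ge0.
have -> : t * l2norm (T f) ^+ 2 = l2norm (T f) * l2norm f by rewrite /t; field.
have -> : t * l2norm (T f) = l2norm f by rewrite /t; field.
have -> : 2^-1 * (c ^+ 2 * (l2norm f ^+ 2 + l2norm f ^+ 2)) = c ^+ 2 * l2norm f * l2norm f by field.
by rewrite ler_pM2r.
Qed.

Lemma mulmx_bopE n (M : 'M[bop K X]_n) (b : 'cV[bop K X]_n) i f :
  (M *m b) i 0 f = \sum_j M i j (b j 0 f).
Proof. by rewrite mxE; elim/big_ind2: _ => [//|T u S v <- <-|]. Qed.

(** Over B(H) the matrix norm is the operator norm on the n-fold direct sum: [rank_one] columns test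
    the matrix on tuples of vectors, and a column applied to each f is again a tuple. *)
Lemma mxnorm_bopP n (M : 'M[bop K X]_n) (c : K) : 0 <= c ->
  (mxnorm M <= c%:E)%E <->
  forall h : 'I_n -> ell2 K X,
    \sum_i l2norm (\sum_j M i j (h j)) ^+ 2 <= c ^+ 2 * \sum_j l2norm (h j) ^+ 2.
Proof.
move=> c0; split=> [Mc h|H].
  pose s := \sum_j l2norm (h j) ^+ 2; rewrite -/s.
  have s0 : 0 <= s by apply: sumr_ge0 => i _; exact: sqr_ge0.
  pose b : 'cV[bop K X]_n := \col_j rank_one (h j).
  have bE j f : b j 0 f = f point *: h j by rewrite mxE.
  have bs : cnorm (colsq b) <= Num.sqrt s ^+ 2.
    apply/cnorm_colsqP => f; rewrite sqr_sqrtr// mulr_suml; apply: ler_sum => j _.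
    rewrite bE l2normZ exprMn [leLHS]mulrC; apply: ler_wpM2l; first exact: sqr_ge0.
    by rewrite ler_pXn2r ?nnegrE ?l2norm_ge0 ?normc_ge0// l2norm_coord.
  have : cnorm (colsq (M *m b)) <= (c * Num.sqrt s) ^+ 2.
    rewrite exprMn (le_trans (mxnormP _ Mc))// ler_wpM2l ?sqr_ge0//.
  move=> /cnorm_colsqP/(_ (delta point)); rewrite l2norm_delta expr1n mulr1 exprMn sqr_sqrtr//.
  congr (_ <= _); apply: eq_bigr => i _; rewrite mulmx_bopE; congr (l2norm _ ^+ 2).
  by apply: eq_bigr => j _; rewrite bE deltaE eqxx scale1r.
apply: mxnorm_le => // b b1; apply/cnorm_colsqP => f.
have -> : \sum_i l2norm ((M *m b) i 0 f) ^+ 2 = \sum_i l2norm (\sum_j M i j (b j 0 f)) ^+ 2.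
  by apply: eq_bigr => i _; rewrite mulmx_bopE.
apply: le_trans (H _) _; rewrite ler_wpM2l ?sqr_ge0//.
by have := (cnorm_colsqP b 1).1; rewrite expr1n => /(_ b1 f); rewrite mul1r.
Qed.

End ColumnOperators.

(** * Extension of completely isometric maps *)

Section BoundedForms.
Context {K : realType} {X : choiceType}.
Implicit Types f g h k : ell2 K X.

Lemma l2normB_sq (t : K) f g :
  l2norm (f - t%:K *: g) ^+ 2 =
  l2norm f ^+ 2 - 2 * t * complex.Re (inner g f) + t ^+ 2 * l2norm g ^+ 2.
Proof.
apply: (@complexI K); rewrite -inner_norm -scaleNr -rmorphN.
rewrite innerDl !innerDr !innerZl !innerZr conjcK !inner_norm (innerC f g).
case: (inner g f) => a b; apply/eqP; rewrite eq_complex /=.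
by apply/andP; split; apply/eqP; ring.
Qed.

(** Riesz representation: coordinate x of T f must be b f (delta x). Testing [b f] on a finite sum w
    of these coordinates gives |w|^2 <= c |f| |w|, so they are square summable; finite restrictions
    of g then identify the form. *)
Lemma bounded_form (b : ell2 K X -> ell2 K X -> K[i]) (c : K) : 0 <= c ->
  (forall a f g h, b (a *: f + g) h = a * b f h + b g h) ->
  (forall a f g h, b f (a *: g + h) = a^* * b f g + b f h) ->
  (forall f g, normc (b f g) <= c * l2norm f * l2norm g) ->
  exists2 T : bop K X, opnorm T <= c & forall f g, inner (T f) g = b f g.
Proof.
move=> c0 bl br bb.
have b0r f : b f 0 = 0.
  apply: eq0_normc; apply/eqP; rewrite eq_le normc_ge0 andbT.
  by rewrite (le_trans (bb _ _))// l2norm0 mulr0.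
have bsum f (r : seq X) (a : X -> K[i]) :
    b f (\sum_(x <- r) a x *: delta x) = \sum_(x <- r) (a x)^* * b f (delta x).
  elim: r => [|x r IH]; first by rewrite !big_nil b0r.
  by rewrite !big_cons br IH.
have bd f : nnsummable (fun x => normc (b f (delta x)) ^+ 2) /\
    nnsum (fun x => normc (b f (delta x)) ^+ 2) <= (c * l2norm f) ^+ 2.
  apply: nnsum_seq_bound => [x|r ur]; first exact: sqr_ge0.
  set A := \sum_(x <- r) _; pose w := \sum_(x <- r) b f (delta x) *: (delta x : ell2 K X).
  have A0 : 0 <= A by rewrite sumr_ge0// => x _; exact: sqr_ge0.
  have wE x : x \in r -> w x = b f (delta x).
    move=> xr; rewrite -inner_delta /w inner_suml (bigD1_seq x)//=.
    rewrite innerZl inner_delta deltaE eqxx mulr1 big1 ?addr0// => y yx.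
    by rewrite innerZl inner_delta deltaE eq_sym (negPf yx) mulr0.
  have Aw : l2norm w ^+ 2 = A.
    apply: (@complexI K); rewrite -inner_norm {2}/w inner_sumr rmorph_sum/=.
    by apply: eq_big_seq => x xr; rewrite innerZr inner_delta wE// mulrC mulc_conj.
  have := bb f w; rewrite bsum (_ : \sum_(x <- r) _ = A%:K); last first.
    by rewrite rmorph_sum; apply: eq_bigr => x _; rewrite mulrC mulc_conj.
  rewrite normc_real ger0_norm// -Aw => H.
  have [w0|w0] := eqVneq (l2norm w) 0; first by rewrite w0 expr0n/= sqr_ge0.
  have wp : 0 < l2norm w by rewrite lt_neqAle eq_sym w0 l2norm_ge0.
  rewrite ler_pXn2r ?nnegrE ?mulr_ge0 ?l2norm_ge0//.
  by move: H; rewrite expr2 ler_pM2r.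
have Tp f : (fun x => b f (delta x)) \in ell2_pred by apply/asboolP; have [] := bd f.
pose T f : ell2 K X := Ell2 (Tp f).
have Tb f : l2norm (T f) <= c * l2norm f.
  have [_ H] := bd f.
  rewrite -(@ler_pXn2r _ 2)// ?nnegrE ?mulr_ge0 ?l2norm_ge0//.
  by rewrite [X in X ^+ 2 <= _]/l2norm sqr_sqrtr//; apply: nnsum_ge0 => x; exact: sqr_ge0.
have Tbop : T \in @bounded_op K X.
  by apply/asboolP; split; [move=> a f g; apply: ell2P => x; exact: bl|exists c].
exists (Bop Tbop); first exact: opnorm_le.
move=> f g; apply/eqP; rewrite -subr_eq0; apply/eqP.
apply: (@normc_small _ _ (2 * (c * l2norm f))) => [|e e0].
  by rewrite !mulr_ge0 ?l2norm_ge0.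
have [r ur fr] := restrict_approx g e0.
have E : inner (T f) (l2restrict g r) = b f (l2restrict g r).
  rewrite /l2restrict bsum inner_sumr; apply: eq_bigr => x _.
  by rewrite innerZr inner_delta.
have dE : b f g = b f (g - l2restrict g r) + b f (l2restrict g r).
  by have := br 1 f (g - l2restrict g r) (l2restrict g r); rewrite scale1r rmorph1 mul1r subrK.
have -> : inner (T f) g - b f g = inner (T f) (g - l2restrict g r) - b f (g - l2restrict g r).
  have gE : inner (T f) g = inner (T f) (g - l2restrict g r) + inner (T f) (l2restrict g r).
    by rewrite -innerDr subrK.
  by rewrite dE -E gE opprD addrACA subrr addr0.
set d := g - l2restrict g r in fr *.
rewrite (le_trans (le_normcD _ _))// normcN mulr_natl mulr2n mulrDl lerD//.
  rewrite (le_trans (cauchy_schwarz _ _))//.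
  by apply: ler_pM; [exact: l2norm_ge0|exact: l2norm_ge0|exact: Tb|exact: ltW].
by rewrite (le_trans (bb _ _))// ler_wpM2l ?mulr_ge0 ?l2norm_ge0// ltW.
Qed.

End BoundedForms.

(** * Complete contractions are positive on accretive matrices *)

Section AccretiveMatrices.
Context {K : realType} {D : cstarType K} {X : pointedType}.
Implicit Types (d : D) (T : bop K X) (h k : ell2 K X).
(** [S] is the graph of a unital completely contractive linear map defined on a subspace of [D]; in
    the application it consists of the pairs (j(a), iota(a)). *)
Variable S : set (D * bop K X).
Hypothesis S1 : S (1, 1).
Hypothesis Slin : forall (c : K[i]) p q, S p -> S q -> S (c *: p.1 + q.1, c *: p.2 + q.2).
Hypothesis Scc : forall n (M : 'M[D * bop K X]_n), (forall i j, S (M i j)) ->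
  (mxnorm (map_mx snd M) <= mxnorm (map_mx fst M))%E.

Lemma S0 : S (0, 0).
Proof. by have := Slin (-1) S1 S1; rewrite /= !scaleN1r !addNr. Qed.

Lemma S_add p q : S p -> S q -> S (p.1 + q.1, p.2 + q.2).
Proof. by move=> Sp Sq; have := Slin 1 Sp Sq; rewrite !scale1r. Qed.

Lemma S_scale c p : S p -> S (c *: p.1, c *: p.2).
Proof. by move=> Sp; have := Slin c Sp S0; rewrite /= !addr0. Qed.

(* |1 - t M|^2 <= 1 + t^2 C for an accretive matrix M, and the real part of the
   corresponding form is read off at first order in t. *)
Lemma accretive_positive n (m : 'I_n -> 'I_n -> D * bop K X) (h : 'I_n -> ell2 K X) :
  (forall i j, S (m i j)) ->
  (forall b : 'I_n -> D, let x := \sum_i \sum_j adj (b i) * (m i j).1 * b j in psd (x + adj x)) ->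
  0 <= complex.Re (\sum_i \sum_j inner ((m i j).2 (h j)) (h i)).
Proof.
move=> Sm acc.
(* [C] bounds the squared norm of the matrix of first components, since the entries of a column b
   with |colsq b| <= 1 have norm at most 1. *)
pose C : K := \sum_i (\sum_j cnorm (m i j).1) ^+ 2.
have C0 : 0 <= C by apply: sumr_ge0 => i _; exact: sqr_ge0.
pose s : K := \sum_i l2norm (h i) ^+ 2.
have s0 : 0 <= s by apply: sumr_ge0 => i _; exact: sqr_ge0.
set R := complex.Re _.
(* If R were negative, t = - R / (C s + 1) would contradict this bound. *)
suff H t : 0 < t -> - (2 * R) <= t * (C * s).
  rewrite leNgt; apply/negP => Rn.
  have Cs0 : 0 <= C * s by exact: mulr_ge0.
  have Cs1 : 0 < C * s + 1 by rewrite ltr_wpDl.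
  have := H (- R / (C * s + 1)); rewrite divr_gt0 ?oppr_gt0// => /(_ isT).
  by rewrite mulrAC ler_pdivlMr// ; nra.
move=> t0.
pose N : 'M[D * bop K X]_n := \matrix_(i, j)
  ((i == j)%:R - t%:K *: (m i j).1, (i == j)%:R - t%:K *: (m i j).2).
have SN i j : S (N i j).
  rewrite mxE; have Se : S ((i == j)%:R, (i == j)%:R) by case: (i == j); [exact: S1|exact: S0].
  by have := Slin (- t%:K) (Sm i j) Se; rewrite /= !scaleNr ![- _ + _]addrC.
have C1 : 0 <= 1 + t ^+ 2 * C by rewrite addr_ge0// mulr_ge0// sqr_ge0.
have : (mxnorm (map_mx fst N) <= (Num.sqrt (1 + t ^+ 2 * C))%:E)%E.
  apply: mxnorm_le; first exact: sqrtr_ge0.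
  move=> b b1; rewrite sqr_sqrtr//.
  pose y : 'cV[D]_n := \col_i \sum_j (m i j).1 * b j 0.
  have NE i : (map_mx fst N *m b) i 0 = b i 0 - t%:K *: y i 0.
    rewrite !mxE; under eq_bigr do rewrite !mxE /= mulrBl.
    rewrite sumrB; congr (_ - _).
      rewrite (bigD1 i)//= eqxx mul1r big1 ?addr0// => j ji.
      by rewrite eq_sym (negPf ji) mul0r.
    by rewrite scaler_sumr; apply: eq_bigr => j _; rewrite scalerAl.
  pose x := \sum_i \sum_j adj (b i 0) * (m i j).1 * b j 0.
  have xE : x = \sum_i adj (b i 0) * y i 0.
    by apply: eq_bigr => i _; rewrite mxE mulr_sumr; apply: eq_bigr => j _; rewrite mulrA.
  have E : colsq (map_mx fst N *m b) = (colsq b + (t ^+ 2)%:K *: colsq y) - t%:K *: (x + adj x).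
    rewrite xE adj_sum -big_split/= -colsqZ /colsq -big_split scaler_sumr -sumrB.
    apply: eq_bigr => i _; rewrite NE /=.
    have -> : (\col_i (t%:K *: y i 0)) i 0 = t%:K *: y i 0 by exact: mxE.
    rewrite adjB adjM adjK adjZr.
    rewrite mulrBl !mulrBr scalerDr -!scalerAl -!scalerAr.
    by abel.
  have yb i : cnorm (y i 0) ^+ 2 <= (\sum_j cnorm (m i j).1) ^+ 2.
    rewrite ler_pXn2r ?nnegrE ?cnorm_ge0//; last by apply: sumr_ge0 => j _; exact: cnorm_ge0.
    rewrite mxE (le_trans (cnorm_sum _ _ _))//; apply: ler_sum => j _.
    rewrite (le_trans (cnormM _ _))// -[leRHS]mulr1 ler_wpM2l ?cnorm_ge0//.
    rewrite -(@ler_pXn2r _ 2)// ?nnegrE ?cnorm_ge0// expr1n.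
    by rewrite (le_trans (cnorm_col b j)).
  apply: le_trans (_ : cnorm (colsq b + (t ^+ 2)%:K *: colsq y) <= _).
    apply: psd_norm_mono; first exact: psd_colsq.
    rewrite E subKr; apply: psdZ; first exact: ltW.
    exact: (acc (fun i => b i 0)).
  rewrite (le_trans (cnormD _ _))// lerD// cnormZr ?sqr_ge0// ler_wpM2l ?sqr_ge0//.
  rewrite (le_trans (cnorm_sum _ _ _))//; apply: ler_sum => i _.
  by rewrite cnorm_adjM.
move=> /(le_trans (Scc SN)).
have -> : map_mx snd N = \matrix_(i, j) ((i == j)%:R - t%:K *: (m i j).2).
  by apply/matrixP => i j; rewrite !mxE.
move=> /(mxnorm_bopP _ (sqrtr_ge0 _))/(_ h); rewrite sqr_sqrtr// -/s.
have -> : \sum_i l2norm (\sum_j (\matrix_(i, j) ((i == j)%:R - t%:K *: (m i j).2)) i j (h j)) ^+ 2 =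
    s - 2 * t * R + t ^+ 2 * \sum_i l2norm (\sum_j (m i j).2 (h j)) ^+ 2.
  rewrite /R /s (raddf_sum (@complex.Re K)) mulr_sumr mulr_sumr -sumrB -big_split/=.
  apply: eq_bigr => i _; rewrite -inner_suml -l2normB_sq; congr (l2norm _ ^+ 2).
  have E j : (\matrix_(i, j) ((i == j)%:R - t%:K *: (m i j).2)) i j (h j) =
      (i == j)%:R *: h j - t%:K *: (m i j).2 (h j).
    by rewrite mxE; case: (i == j); rewrite ?scale1r ?scale0r.
  under eq_bigr do rewrite E.
  rewrite sumrB -scaler_sumr (bigD1 i)//= eqxx scale1r big1 ?addr0// => j ji.
  by rewrite eq_sym (negPf ji) scale0r.
set Y := \sum_i _ => H.
have Y0 : 0 <= Y by apply: sumr_ge0 => i _; exact: sqr_ge0.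
have : t * (- (2 * R)) <= t * (t * (C * s)).
  by have := mulr_ge0 (sqr_ge0 t) Y0; move: H; rewrite expr2; nra.
by rewrite ler_pM2l.
Qed.

End AccretiveMatrices.

(** * The positive functional on D-valued matrices indexed by vectors *)

Section DilationForm.
Context {K : realType} {D : cstarType K} {X : pointedType}.
Implicit Types (c d e : D) (T : bop K X) (h k : ell2 K X).
Local Notation V := ((ell2 K X -> D) -> D).
Variable S : set (D * bop K X).
Hypothesis S1 : S (1, 1).
Hypothesis Slin : forall (c : K[i]) p q, S p -> S q -> S (c *: p.1 + q.1, c *: p.2 + q.2).
Hypothesis Scc : forall n (M : 'M[D * bop K X]_n), (forall i j, S (M i j)) ->
  (mxnorm (map_mx snd M) <= mxnorm (map_mx fst M))%E.

(* The elementary tensor d (x) h (x) k^*, seen as a function on families of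
   coefficients indexed by all vectors. *)
Definition tensor d k h : V := fun b => adj (b k) * d * b h.

Definition tensor_seq (l : seq ((D * bop K X) * (ell2 K X * ell2 K X))) : V :=
  \sum_(p <- l) tensor p.1.1 p.2.1 p.2.2.

Definition tensor_value (l : seq ((D * bop K X) * (ell2 K X * ell2 K X))) : K :=
  complex.Re (\sum_(p <- l) inner (p.1.2 p.2.2) p.2.1).

Definition tensor_graph : set (V * K) :=
  [set vt | exists2 l, (forall p, p \in l -> S p.1) & vt = (tensor_seq l, tensor_value l)].

(** Elements with skew-adjoint values lie in this cone together with their opposites, so a positive
    functional kills them. This is what later makes the form Hermitian. *)
Definition accretive : set V := [set v | forall b, psd (v b + adj (v b))].

Lemma fct_sumE (I : eqType) (r : seq I) (P : pred I) (F : I -> V) b :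
  (\sum_(i <- r | P i) F i) b = \sum_(i <- r | P i) F i b.
Proof. by elim/big_ind2: _ => [//|x s y t <- <-|]. Qed.

Lemma S_sum (I : Type) (r : seq I) (P : pred I) (F : I -> D * bop K X) :
  (forall i, P i -> S (F i)) -> S (\sum_(i <- r | P i) F i).
Proof. by move=> H; apply: big_ind => //; [exact: (S0 S1 Slin)|exact: (S_add Slin)]. Qed.

(** A finite sum of tensors involves finitely many vectors; collecting the terms with the same pair
    of vectors gives a finite matrix over [S], to which [accretive_positive] applies. Positivity
    also yields that the value does not depend on the chosen list. *)
Lemma tensor_graph_positive : positive_graph accretive tensor_graph.
Proof.
move=> _ _ [l Sl [-> ->]] acc.
pose r := undup (map (fun p => p.2.1) l ++ map (fun p => p.2.2) l).
have ur : uniq r by exact: undup_uniq.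
have rP p : p \in l -> p.2.1 \in r /\ p.2.2 \in r.
  move=> pl; rewrite !mem_undup !mem_cat; split; apply/orP; [left|right]; exact: (map_f (fun p => _)) pl.
pose n := size r; pose v (i : 'I_n) : ell2 K X := nth 0 r i.
have v_inj (i j : 'I_n) : (v i == v j) = (i == j) by rewrite /v nth_uniq.
pose m i j : D * bop K X := \sum_(p <- l | (p.2.1 == v i) && (p.2.2 == v j)) p.1.
have Sm i j : S (m i j).
  rewrite /m big_seq_cond; apply: S_sum => p /andP[pl _]; exact: Sl.
(* The regrouping is stated for any G additive in the matrix entry, as it is needed both for the
   tensors and for their values. *)
have group (Z : zmodType) (G : ell2 K X -> ell2 K X -> D * bop K X -> Z) :
    (forall k h, G k h 0 = 0) ->
    (forall k h, {morph G k h : x y / x + y}) ->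
    \sum_i \sum_j G (v i) (v j) (m i j) = \sum_(p <- l) G p.2.1 p.2.2 p.1.
  move=> G0 GD.
  under eq_bigr do under eq_bigr do rewrite /m (big_morph _ (GD _ _) (G0 _ _)) big_mkcond.
  under eq_bigr do rewrite exchange_big/=.
  rewrite exchange_big/=; apply: eq_big_seq => p /rP[p1 p2].
  have i1 : (index p.2.1 r < n)%N by rewrite index_mem.
  have i2 : (index p.2.2 r < n)%N by rewrite index_mem.
  have e1 : v (Ordinal i1) = p.2.1 by rewrite /v /= nth_index.
  have e2 : v (Ordinal i2) = p.2.2 by rewrite /v /= nth_index.
  rewrite (bigD1 (Ordinal i1))//= (bigD1 (Ordinal i2))//= e1 e2 !eqxx/=.
  rewrite big1 ?addr0 => [|j ji]; last by rewrite -e2 v_inj eq_sym (negPf ji).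
  rewrite big1 ?addr0// => i ii; rewrite big1// => j _.
  by rewrite -{1}e1 v_inj eq_sym (negPf ii).
rewrite /tensor_value -(group _ (fun k h w => inner (w.2 h) k)).
- apply: (@accretive_positive _ _ _ _ S1 Slin Scc n m v Sm) => b.
  (* Coefficients on the n listed vectors, extended by 0 to all vectors. *)
  pose b' h := if insub (index h r) is Some i then b i else 0.
  have b'E i : b' (v i) = b i by rewrite /b' /v index_uniq// valK.
  have := acc b'; rewrite /tensor_seq fct_sumE -(group _ (fun k h w => tensor w.1 k h b')).
  + by rewrite /tensor; under eq_bigr do under eq_bigr do rewrite !b'E.
  + by move=> k h; rewrite /tensor mulr0 mul0r.
  + by move=> k h [x1 x2] [y1 y2]; rewrite /tensor /= mulrDr mulrDl.
- by move=> k h; rewrite linear0l.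
- by move=> k h [x1 x2] [y1 y2]; exact: (innerDl (x2 h) (y2 h) k).
Qed.

Lemma accretive0 : accretive 0.
Proof. by move=> b; rewrite /= adj0 addr0; exact: psd0. Qed.

Lemma accretiveD v w : accretive v -> accretive w -> accretive (v + w).
Proof.
move=> av aw b; change (psd ((v b + w b) + adj (v b + w b))).
by rewrite adjD addrACA; exact: psdD.
Qed.

Lemma accretiveZ (t : K) v : 0 <= t -> accretive v -> accretive (t%:K *: v).
Proof.
move=> t0 av b; change (psd (t%:K *: v b + adj (t%:K *: v b))).
by rewrite adjZr -scalerDr; exact: psdZ.
Qed.

Lemma tensor_graph0 : tensor_graph (0, 0).
Proof. by exists [::] => //; rewrite /tensor_seq /tensor_value !big_nil. Qed.

Lemma tensor_graph1 d T k h : S (d, T) ->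
  tensor_graph (tensor d k h, complex.Re (inner (T h) k)).
Proof.
move=> ST; exists [:: ((d, T), (k, h))]; first by move=> p; rewrite inE => /eqP ->.
by rewrite /tensor_seq /tensor_value !big_seq1.
Qed.

Lemma tensor_graph_linear : real_linear_graph tensor_graph.
Proof.
move=> c v s w t [l Sl [-> ->]] [l' Sl' [-> ->]].
pose sc (p : (D * bop K X) * (ell2 K X * ell2 K X)) := ((c%:K *: p.1.1, c%:K *: p.1.2), p.2).
exists (map sc l ++ l').
  move=> p; rewrite mem_cat => /orP[/mapP[q ql ->]|]; last exact: Sl'.
  exact: (S_scale S1 Slin) (Sl _ ql).
rewrite /tensor_seq /tensor_value !big_cat !big_map/=; congr pair.
  congr (_ + _); rewrite scaler_sumr; apply: eq_bigr => p _; apply/funext => b.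
  change (c%:K *: (adj (b p.2.1) * p.1.1 * b p.2.2) = adj (b p.2.1) * (c%:K *: p.1.1) * b p.2.2).
  by rewrite -scalerAr scalerAl.
rewrite raddfD /=; congr (_ + _).
have -> : \sum_(p <- l) inner ((c%:K *: p.1.2) p.2.2) p.2.1 =
    c%:K * \sum_(p <- l) inner (p.1.2 p.2.2) p.2.1.
  by rewrite mulr_sumr; apply: eq_bigr => p _; rewrite bopZE innerZl.
by case: (\sum_(p <- l) _) => a b /=; ring.
Qed.

Lemma dilation_functional : exists f : V -> K,
  [/\ forall v t, tensor_graph (v, t) -> f v = t,
      forall (c : K) v w, dominated accretive tensor_graph v -> dominated accretive tensor_graph w ->
        f (c%:K *: v + w) = c * f v + f w
    & forall v, dominated accretive tensor_graph v -> accretive v -> 0 <= f v].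
Proof.
exact: (riesz_extension accretive0 accretiveD accretiveZ tensor_graph0 tensor_graph_linear
  tensor_graph_positive).
Qed.

End DilationForm.

(** * The dilation space and its compressions *)

Section Dilation.
Context {K : realType} {D : cstarType K} {X : pointedType}.
Implicit Types (c d e : D) (T : bop K X) (h k : ell2 K X).
Local Notation V := ((ell2 K X -> D) -> D).
Implicit Types (v w z : V).
Variable S : set (D * bop K X).
Hypothesis S1 : S (1, 1).
Hypothesis Slin : forall (c : K[i]) p q, S p -> S q -> S (c *: p.1 + q.1, c *: p.2 + q.2).

Local Notation dom := (dominated (@accretive K D X) (tensor_graph S)).
Variable f : V -> K.
Hypothesis fE : forall v t, tensor_graph S (v, t) -> f v = t.
Hypothesis flin : forall (c : K) v w, dom v -> dom w -> f (c%:K *: v + w) = c * f v + f w.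
Hypothesis fpos : forall v, dom v -> accretive v -> 0 <= f v.

(** [z] plays the role of a vector of the dilation space, with the semi-inner product of z and z'
    read off from f at z'^* z. Domination of z^* z by an element of the graph puts these products in
    the domain of [f]. *)
Definition tame z : Prop := exists w t, tensor_graph S (w, t) /\
  forall b, psd (w b - adj (z b) * z b).

Definition star_mul z' z : V := fun b => adj (z' b) * z b.

Lemma tensor_graphD v s w t : tensor_graph S (v, s) -> tensor_graph S (w, t) ->
  tensor_graph S (v + w, s + t).
Proof.
move=> gv gw; have := tensor_graph_linear S1 Slin 1 gv gw.
by rewrite rmorph1 scale1r mul1r.
Qed.

Lemma tensor_graphZ (c : K) v t : tensor_graph S (v, t) -> tensor_graph S (c%:K *: v, c * t).
Proof.
move=> gv; have := tensor_graph_linear S1 Slin c gv (tensor_graph0 S).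
by rewrite !addr0.
Qed.

(** Parallelogram law: 2 (z^* z + z'^* z') exceeds the square of z + z' by that of z - z'. *)
Lemma tameD z z' : tame z -> tame z' -> tame (z + z').
Proof.
move=> [w [t [gw Hw]]] [w' [t' [gw' Hw']]].
exists (2%:K *: (w + w')), (2 * (t + t')); split; first exact/tensor_graphZ/tensor_graphD.
move=> b; change (psd (2%:K *: (w b + w' b) - adj (z b + z' b) * (z b + z' b))).
rewrite (_ : _ - _ = 2%:K *: ((w b - adj (z b) * z b) + (w' b - adj (z' b) * z' b))
    + adj (z b - z' b) * (z b - z' b)).
  by apply: psdD; [apply: psdZ => //; exact: psdD|exact: psd_adjM].
rewrite adjD adjB !mulrDl !mulrDr !mulNr !mulrN (_ : 2 = 1 + 1)// rmorphD rmorph1.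
by rewrite !scalerDl !scale1r; abel.
Qed.

Lemma tameM d z : tame z -> tame (fun b => d * z b).
Proof.
move=> [w [t [gw Hw]]]; pose s := cnorm d ^+ 2.
exists (s%:K *: w), (s * t); split; first exact: tensor_graphZ.
move=> b; change (psd (s%:K *: w b - adj (d * z b) * (d * z b))).
rewrite (_ : _ - _ = s%:K *: (w b - adj (z b) * z b) +
   adj (z b) * (s%:K%:A - adj d * d) * z b).
  apply: psdD; first by apply: psdZ => //; exact: sqr_ge0.
  by apply/psd_conj/psd_sub_norm; rewrite ?adjM ?adjK// cnorm_adjM.
by rewrite adjM scalerBr mulrBr mulrBl -scalerAr -scalerAl mulr1 !mulrA; abel.
Qed.

Lemma tameZ (c : K[i]) z : tame z -> tame (c *: z).
Proof.
move=> tz; have -> : c *: z = fun b => c%:A * z b; last exact: tameM.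
by apply/funext => b; rewrite mulr_algl.
Qed.

Lemma tame_coef d h : tame (fun b => d * b h).
Proof.
apply: tameM; exists (tensor 1 h h), (complex.Re (inner ((1 : bop K X) h) h)); split.
  exact: tensor_graph1.
by move=> b; rewrite /tensor mulr1 subrr; exact: psd0.
Qed.

(** The squares of z - z' and z + z' are positive, which bounds the cross terms on both sides by the
    diagonal ones. *)
Lemma tame_dom z z' : tame z -> tame z' -> dom (star_mul z' z).
Proof.
move=> [w [t [gw Hw]]] [w' [t' [gw' Hw']]].
exists (w + w'), (t + t'); split; first exact: tensor_graphD.
- move=> b; rewrite /= -[(_ - _) b]/((w b + w' b) - adj (z' b) * z b).
  set x := _ - _.
  have -> : x + adj x = ((w b - adj (z b) * z b) + (w' b - adj (z' b) * z' b)) +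
     (adj (w b - adj (z b) * z b) + adj (w' b - adj (z' b) * z' b)) +
     adj (z b - z' b) * (z b - z' b) + adj (z b) * z b + adj (z' b) * z' b.
    rewrite /x !adjB adjD !adjM !adjK !mulrBl !mulrBr; abel.
  have [aw _] := Hw b; have [aw' _] := Hw' b; rewrite aw aw'.
  by do !apply: psdD => //; exact: psd_adjM.
- move=> b; rewrite /= -[(_ + _) b]/((w b + w' b) + adj (z' b) * z b).
  set x := _ + adj _ * _.
  have -> : x + adj x = ((w b - adj (z b) * z b) + (w' b - adj (z' b) * z' b)) +
     (adj (w b - adj (z b) * z b) + adj (w' b - adj (z' b) * z' b)) +
     adj (z b + z' b) * (z b + z' b) + adj (z b) * z b + adj (z' b) * z' b.
    rewrite /x !adjB !adjD !adjM !adjK !mulrDl !mulrDr; abel.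
  have [aw _] := Hw b; have [aw' _] := Hw' b; rewrite aw aw'.
  by do !apply: psdD => //; exact: psd_adjM.
Qed.

(** The complex functional with real part f is v |-> f(v) - i f(i v); it is taken here at z'^* z. *)
Definition dilation_form z z' : K[i] :=
  Complex (f (star_mul z' z)) (- f (star_mul z' ('i *: z))).

Local Notation q := dilation_form.

Lemma star_mulZr (c : K[i]) z z' : star_mul z' (c *: z) = c *: star_mul z' z.
Proof. by apply/funext => b; rewrite /star_mul -[(c *: z) b]/(c *: z b) -scalerAr. Qed.

Lemma dilation_formP (c : K[i]) z w z' : tame z -> tame w -> tame z' ->
  q (c *: z + w) z' = c * q z z' + q w z'.
Proof.
move=> tz tw tz'; case: c => a b.
have E : star_mul z' (Complex a b *: z + w) =
    a%:K *: star_mul z' z + (b%:K *: star_mul z' ('i *: z) + star_mul z' w).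
  apply/funext => x; rewrite /star_mul.
  change (adj (z' x) * (Complex a b *: z x + w x) =
     a%:K *: (adj (z' x) * z x) + (b%:K *: (adj (z' x) * ('i *: z x)) + adj (z' x) * w x)).
  rewrite mulrDr -!scalerAr scalerA addrA -scalerDl; congr (_ *: _ + _).
  by apply/eqP; rewrite eq_complex /=; apply/andP; split; apply/eqP; ring.
have E' : star_mul z' ('i *: (Complex a b *: z + w)) =
    (- b)%:K *: star_mul z' z + (a%:K *: star_mul z' ('i *: z) + star_mul z' ('i *: w)).
  apply/funext => x; rewrite /star_mul.
  change (adj (z' x) * ('i *: (Complex a b *: z x + w x)) =
     (- b)%:K *: (adj (z' x) * z x) + (a%:K *: (adj (z' x) * ('i *: z x)) + adj (z' x) * ('i *: w x))).
  rewrite scalerDr mulrDr -!scalerAr !scalerA addrA -scalerDl; congr (_ *: _ + _).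
  by apply/eqP; rewrite eq_complex /=; apply/andP; split; apply/eqP; ring.
have dz := tame_dom tz tz'; have dw := tame_dom tw tz'.
have diz := tame_dom (tameZ 'i tz) tz'; have diw := tame_dom (tameZ 'i tw) tz'.
have d1 : dom (b%:K *: star_mul z' ('i *: z) + star_mul z' w).
  rewrite -star_mulZr (_ : _ + _ = star_mul z' (b%:K *: ('i *: z) + w)).
    by apply: tame_dom => //; apply: tameD => //; do 2!apply: tameZ.
  by apply/funext => x; rewrite /star_mul -[RHS]/(adj (z' x) * (_ + _)) mulrDr.
have d2 : dom (a%:K *: star_mul z' ('i *: z) + star_mul z' ('i *: w)).
  rewrite -star_mulZr (_ : _ + _ = star_mul z' (a%:K *: ('i *: z) + 'i *: w)).
    by apply: tame_dom => //; apply: tameD; do ?apply: tameZ.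
  by apply/funext => x; rewrite /star_mul -[RHS]/(adj (z' x) * (_ + _)) mulrDr.
rewrite /q E E' !flin//.
by apply/eqP; rewrite eq_complex /=; apply/andP; split; apply/eqP; ring.
Qed.

Lemma domB v w : dom v -> dom w -> dom (w - v).
Proof.
move=> [x [s [gx xm xp]]] [y [t [gy ym yp]]].
exists (x + y), (s + t); split; first exact: tensor_graphD.
  by rewrite (_ : _ - _ = (x + v) + (y - w)); [exact: accretiveD|abel].
by rewrite (_ : _ + _ = (x - v) + (y + w)); [exact: accretiveD|abel].
Qed.

(** v^* - v has zero real part, so it and its opposite are accretive. *)
Lemma f_skew v w : dom v -> dom w -> (forall b, w b = adj (v b)) -> f v = f w.
Proof.
move=> dv dw vw.
have df x y : dom x -> dom y -> (forall b, y b = adj (x b)) -> f x <= f y.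
  move=> dx dy xy; rewrite -subr_ge0.
  have -> : f y - f x = f ((-1)%:K *: x + y) by rewrite flin// mulN1r addrC.
  rewrite rmorphN1 scaleN1r addrC; apply: fpos; first exact: domB.
  move=> b; rewrite -[(y - x) b]/(y b - x b) xy adjB adjK.
  by rewrite (_ : _ + _ = 0); [exact: psd0|abel].
by apply/eqP; rewrite eq_le !df// => b; rewrite vw adjK.
Qed.

Lemma dilation_form_Re z z' : complex.Re (q z z') = f (star_mul z' z).
Proof. by []. Qed.

Lemma dilation_formC z z' : tame z -> tame z' -> q z z' = (q z' z)^*.
Proof.
move=> tz tz'; have ti := tameZ 'i tz; have ti' := tameZ 'i tz'.
rewrite /q; have -> : f (star_mul z' z) = f (star_mul z z').
  apply: f_skew; try exact: tame_dom.
  by move=> b; rewrite /star_mul adjM adjK.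
have -> : f (star_mul z' ('i *: z)) = f (star_mul ('i *: z) z').
  apply: f_skew; try exact: tame_dom.
  by move=> b; rewrite /star_mul adjM adjK.
have -> : star_mul ('i *: z) z' = (-1)%:K *: star_mul z ('i *: z') + 0.
  apply/funext => b; rewrite addr0 rmorphN1 scaleN1r.
  change (adj ('i *: z b) * z' b = - (adj (z b) * ('i *: z' b))).
  by rewrite adjZ conjci -scalerAl -scalerAr scaleNr.
have d0 : dom 0.
  exists 0, 0; split; first exact: tensor_graph0.
  + by rewrite subr0; exact: accretive0.
  + by rewrite addr0; exact: accretive0.
rewrite flin ?mulN1r//; last exact: tame_dom.
rewrite (fE (tensor_graph0 S)) addr0.
by apply/eqP; rewrite eq_complex /= !opprK !eqxx.
Qed.

Lemma dilation_form_ge0 z : tame z -> 0 <= q z z.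
Proof.
move=> tz; have := dilation_formC tz tz; case E : (q z z) => [a b] /eqP.
rewrite eq_complex /= => /andP[_ bN].
have b0 : b = 0 by apply/eqP; move: bN; rewrite -addr_eq0 -mulr2n mulrn_eq0.
rewrite b0 lecE /= eqxx/= -[a]/(complex.Re (Complex a b)) -E dilation_form_Re.
apply: fpos; first exact: tame_dom.
move=> b'; rewrite /star_mul adjM adjK; apply: psdD; exact: psd_adjM.
Qed.

Lemma dilation_form_real z : tame z -> q z z = (f (star_mul z z))%:K.
Proof.
move=> /dilation_form_ge0; rewrite lecE => /andP[/eqP im _].
by apply/eqP; rewrite eq_complex im !eqxx.
Qed.

Lemma dilation_cauchy_schwarz z z' (A B : K) : tame z -> tame z' ->
  q z z = A%:K -> q z' z' = B%:K -> normc (q z z') ^+ 2 <= A * B.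
Proof.
move=> tz tz' qA qB; set a := q z z'.
have A0 : 0 <= A by have := dilation_form_ge0 tz; rewrite qA lecR.
have B0 : 0 <= B by have := dilation_form_ge0 tz'; rewrite qB lecR.
have H (t : K) : 0 <= t ^+ 2 * normc a ^+ 2 * B - 2 * t * normc a ^+ 2 + A.
  pose l : K[i] := - (t%:K * a).
  have tl := tameZ l tz'; have tw := tameD tl tz.
  have := dilation_form_ge0 tw; rewrite dilation_formP//.
  rewrite [q z' _]dilation_formC// [q z (_ + _)]dilation_formC// !dilation_formP// qA qB.
  rewrite (dilation_formC tz' tz) -/a /l.
  suff -> : - (t%:K * a) * (- (t%:K * a) * B%:K + a)^* + (- (t%:K * a) * a^* + A%:K)^* =
     (t ^+ 2 * normc a ^+ 2 * B - 2 * t * normc a ^+ 2 + A)%:K by rewrite lecR.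
  rewrite sqr_normcE; case: (a) => x y; apply/eqP; rewrite eq_complex /=.
  by apply/andP; split; apply/eqP; ring.
have [a0|a0] := eqVneq (normc a) 0; first by rewrite a0 expr0n mulr_ge0.
have ap : 0 < normc a ^+ 2 by rewrite exprn_gt0// lt_neqAle eq_sym a0 normc_ge0.
have [B00|Bn] := eqVneq B 0.
  (* For B = 0 the inequality [H] is affine in t, and this t makes its right side equal to -1. *)
  have := H ((A + 1) / (2 * normc a ^+ 2)).
  rewrite B00 mulr0 add0r (_ : 2 * _ * _ = A + 1); first by lra.
  by field.
have Bp : 0 < B by rewrite lt_neqAle eq_sym Bn.
have := H (B^-1).
rewrite (_ : _ + A = (A * B - normc a ^+ 2) / B); last by field.
by rewrite pmulr_lge0 ?invr_gt0// subr_ge0.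
Qed.

(** Null vectors are orthogonal to all others; this stands in for the quotient Hilbert space. *)
Lemma dilation_form_null z z' : tame z -> tame z' -> q z z = 0 -> q z z' = 0.
Proof.
move=> tz tz' q0.
have := dilation_cauchy_schwarz tz tz' (A := 0) q0 (dilation_form_real tz'); rewrite mul0r => H.
apply: eq0_normc; apply/eqP; rewrite -sqrf_eq0 eq_le H sqr_ge0//.
Qed.

Definition coef d h : V := fun b => d * b h.

(** The future matrix coefficient of phi(d): left multiplication by d on the dilation space,
    compressed to the vectors 1 (x) h, as in Stinespring's construction. *)
Definition dilation_op_form d h k : K[i] := q (coef d h) (coef 1 k).

Local Notation B := dilation_op_form.

Lemma dilation_form_coef d e h k : q (coef d h) (coef e k) = B (adj e * d) h k.
Proof.
rewrite /B /q; congr (Complex (f _) (- f _)); apply/funext => b; rewrite /star_mul /coef.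
  by rewrite mul1r adjM !mulrA.
change (adj (e * b k) * ('i *: (d * b h)) = adj (1 * b k) * ('i *: (adj e * d * b h))).
by rewrite mul1r adjM -!scalerAr !mulrA.
Qed.

Lemma B_S p h k : S p -> B p.1 h k = inner (p.2 h) k.
Proof.
move=> Sp.
have e1 : f (star_mul (coef 1 k) (coef p.1 h)) = complex.Re (inner (p.2 h) k).
  rewrite -(fE (tensor_graph1 k h (d := p.1) (T := p.2) _)); last by case: (p) Sp.
  by congr f; apply/funext => b; rewrite /star_mul /coef /tensor mul1r mulrA.
have e2 : f (star_mul (coef 1 k) ('i *: coef p.1 h)) = complex.Re ('i * inner (p.2 h) k).
  have Sip : S ('i *: p.1, 'i *: p.2) by exact: (S_scale S1 Slin).
  rewrite -innerZl -bopZE -(fE (tensor_graph1 k h Sip)); congr f; apply/funext => b.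
  change (adj (1 * b k) * ('i *: (p.1 * b h)) = adj (b k) * ('i *: p.1) * b h).
  by rewrite mul1r -!scalerAr -scalerAl mulrA.
rewrite /B /q e1 e2; case: (inner _ _) => x y; apply/eqP; rewrite eq_complex /=.
by apply/andP; split; apply/eqP; ring.
Qed.

Lemma B_linear (c : K[i]) d e h k : B (c *: d + e) h k = c * B d h k + B e h k.
Proof.
rewrite /B -dilation_formP; try exact: tame_coef.
congr q; apply/funext => b.
by change ((c *: d + e) * b h = c *: (d * b h) + e * b h); rewrite mulrDl scalerAl.
Qed.

Lemma B_adj d h k : B (adj d) h k = (B d k h)^*.
Proof.
rewrite -[adj d]mulr1 -dilation_form_coef dilation_formC; try exact: tame_coef.
by rewrite /B.
Qed.

(** [d] moves to the other side as d^*, where the null vector z is met again. *)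
Lemma B_null z d k : tame z -> q z z = 0 -> q (fun b => d * z b) (coef 1 k) = 0.
Proof.
move=> tz q0; rewrite -(dilation_form_null tz (tame_coef (adj d) k) q0).
rewrite /q; congr (Complex (f _) (- f _)); apply/funext => b; rewrite /star_mul.
  by rewrite /coef mul1r adjM adjK mulrA.
change (adj (1 * b k) * ('i *: (d * z b)) = adj (adj d * b k) * ('i *: z b)).
by rewrite mul1r adjM adjK -!scalerAr mulrA.
Qed.

(** Vectors are mere labels in the tensors, so linearity in h is not built in. But (1, 1) in [S]
    fixes the form on the vectors 1 (x) h, whence 1 (x) (c h + h') - c (1 (x) h) - 1 (x) h' is null,
    and [B_null] applies. *)
Lemma B_linear_l d (c : K[i]) h h' k : B d (c *: h + h') k = c * B d h k + B d h' k.
Proof.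
pose z : V := (-1) *: coef 1 (c *: h + h') + (c *: coef 1 h + coef 1 h').
have tz : tame z.
  by apply: tameD; [apply: tameZ|apply: tameD; [apply: tameZ|]]; exact: tame_coef.
have z1 h0 : q z (coef 1 h0) = 0.
  rewrite /z !dilation_formP; try by [exact: tame_coef|apply: tameD; [apply: tameZ|]; exact: tame_coef].
  rewrite -/(B 1 (c *: h + h') h0) -/(B 1 h h0) -/(B 1 h' h0) !(@B_S (1, 1))//=.
  by rewrite innerPl mulN1r addNr.
have zz : q z z = 0.
  rewrite {1}/z !dilation_formP//; try by [exact: tame_coef|apply: tameD; [apply: tameZ|]; exact: tame_coef].
  rewrite ![q (coef _ _) z]dilation_formC; try exact: tame_coef; try exact: tz.
  by rewrite !z1 conjC0 !mulr0 !addr0.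
have := B_null d k tz zz.
have -> : (fun b => d * z b) = (-1) *: coef d (c *: h + h') + (c *: coef d h + coef d h').
  apply/funext => b; rewrite /z.
  change (d * (-1 *: (1 * b (c *: h + h')) + (c *: (1 * b h) + 1 * b h')) =
     -1 *: (d * b (c *: h + h')) + (c *: (d * b h) + d * b h')).
  by rewrite !mul1r !mulrDr -!scalerAr.
rewrite !dilation_formP; try by [exact: tame_coef|apply: tameD; [apply: tameZ|]; exact: tame_coef].
by rewrite mulN1r addrC => /eqP; rewrite subr_eq0 => /eqP.
Qed.

Lemma B_linear_r d (c : K[i]) h h' k : B d k (c *: h + h') = c^* * B d k h + B d k h'.
Proof.
rewrite -(adjK d) B_adj B_linear_l rmorphD rmorphM /=.
by rewrite -!B_adj.
Qed.

(** Positivity of t^2 - d^* d compares the square of d (x) h with t^2 times that of 1 (x) h, which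
    is |h|^2. *)
Lemma B_diag d h (t : K) : cnorm d <= t ->
  exists2 s, s <= t ^+ 2 * l2norm h ^+ 2 & q (coef d h) (coef d h) = s%:K.
Proof.
move=> dt; have tc := tame_coef d h.
exists (f (star_mul (coef d h) (coef d h))); last exact: dilation_form_real.
have g1 := tensor_graph1 h h S1.
have t0 : 0 <= t by rewrite (le_trans (cnorm_ge0 d)).
have E : t ^+ 2 * l2norm h ^+ 2 = f ((t ^+ 2)%:K *: tensor 1 h h).
  by rewrite (fE (tensor_graphZ (t ^+ 2) g1)) -[(1 : bop K X) h]/h inner_norm.
rewrite E -subr_ge0.
have Et : tensor 1 h h = star_mul (coef 1 h) (coef 1 h).
  by apply/funext => b; rewrite /tensor /star_mul /coef mulr1 mul1r.
have d1 : dom (star_mul (coef d h) (coef d h)) by apply: tame_dom.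
have d2 : dom ((t ^+ 2)%:K *: tensor 1 h h).
  by rewrite Et -star_mulZr; apply: tame_dom; do ?apply: tameZ; exact: tame_coef.
have e := flin (-1) d1 d2; rewrite rmorphN1 scaleN1r mulN1r in e.
rewrite addrC -e addrC.
apply: fpos; first exact: domB.
move=> b; set x := (_ - _) b.
suff px : psd x by have [ax _] := px; rewrite ax; exact: psdD.
change (psd ((t ^+ 2)%:K *: (adj (b h) * 1 * b h) - adj (d * b h) * (d * b h))).
rewrite (_ : _ - _ = adj (b h) * ((t ^+ 2)%:K%:A - adj d * d) * b h).
  apply/psd_conj/psd_sub_norm; rewrite ?adjM ?adjK// cnorm_adjM.
  by rewrite ler_pXn2r ?nnegrE ?cnorm_ge0.
by rewrite mulr1 adjM mulrBr mulrBl -scalerAr -scalerAl mulr1 !mulrA.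
Qed.

Lemma B_bound d h k : normc (B d h k) <= cnorm d * l2norm h * l2norm k.
Proof.
have [s s1 qs] := B_diag h (lexx (cnorm d)).
have c1 : cnorm (1 : D) <= 1 by rewrite cnorm1.
have [s' s1' qs'] := B_diag k c1.
have := dilation_cauchy_schwarz (tame_coef d h) (tame_coef 1 k) qs qs'.
rewrite -/(B d h k) => H.
rewrite -(@ler_pXn2r _ 2)// ?nnegrE ?normc_ge0 ?mulr_ge0 ?l2norm_ge0 ?cnorm_ge0//.
have s0 : 0 <= s by have := dilation_form_ge0 (tame_coef d h); rewrite qs lecR.
have s0' : 0 <= s' by have := dilation_form_ge0 (tame_coef 1 k); rewrite qs' lecR.
rewrite (le_trans H)// !exprMn; apply: ler_pM => //.
by rewrite expr1n mul1r in s1'.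
Qed.

(* c (x) h - 1 (x) W h is a null vector of the dilation form. *)
Lemma B_mul c (W : bop K X) d h k : cnorm c <= 1 ->
  (forall h k, B c h k = inner (W h) k) -> (forall h, l2norm (W h) = l2norm h) ->
  B (d * c) h k = B d (W h) k.
Proof.
move=> c1 BW isoW; have [s s1 qs] := B_diag h c1; rewrite expr1n mul1r in s1.
pose z : V := (-1) *: coef 1 (W h) + coef c h.
have tc := tame_coef c h; have tw := tame_coef 1 (W h).
have tz : tame z by apply: tameD => //; exact: tameZ.
have q1 : q (coef 1 (W h)) (coef 1 (W h)) = (l2norm h ^+ 2)%:K.
  by rewrite -/(B 1 (W h) (W h)) (@B_S (1, 1))//= inner_norm isoW.
have q2 : q (coef c h) (coef 1 (W h)) = (l2norm h ^+ 2)%:K.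
  by rewrite -/(B c h (W h)) BW inner_norm isoW.
have qzz : q z z = (s - l2norm h ^+ 2)%:K.
  rewrite {1}/z dilation_formP// ![q (coef _ _) z]dilation_formC// /z !dilation_formP//.
  rewrite (dilation_formC tw tc) q1 q2 qs !conjcK; apply/eqP; rewrite eq_complex /=.
  by apply/andP; split; apply/eqP; ring.
(* The value s - |h|^2 is nonnegative as a square and nonpositive because c is a contraction. *)
have z0 : q z z = 0.
  have := dilation_form_ge0 tz; rewrite qzz lecR subr_ge0 => s2.
  have -> : s = l2norm h ^+ 2 by apply/eqP; rewrite eq_le s1 s2.
  by rewrite subrr rmorph0.
have := B_null d k tz z0.
have -> : (fun b => d * z b) = (-1) *: coef d (W h) + coef (d * c) h.
  apply/funext => b; rewrite /z.
  change (d * (-1 *: (1 * b (W h)) + c * b h) = -1 *: (d * b (W h)) + d * c * b h).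
  by rewrite mul1r mulrDr -scalerAr mulrA.
rewrite dilation_formP; try exact: tame_coef.
by rewrite mulN1r addrC => /eqP; rewrite subr_eq0 => /eqP.
Qed.

End Dilation.

Section Extension.
Context {K : realType} {D : cstarType K} {X : pointedType}.
Variable S : set (D * bop K X).
Hypothesis S1 : S (1, 1).
Hypothesis Slin : forall (c : K[i]) p q, S p -> S q -> S (c *: p.1 + q.1, c *: p.2 + q.2).
Hypothesis Scc : forall n (M : 'M[D * bop K X]_n), (forall i j, S (M i j)) ->
  (mxnorm (map_mx snd M) <= mxnorm (map_mx fst M))%E.

(** Each phi(d) represents the bounded form [dilation_op_form f d]. The last clause is the one-sided
    multiplicative domain: a contraction with isometric image maps the compressed space into itself
    modulo null vectors. *)
Theorem positive_extension : exists phi : D -> bop K X,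
  [/\ forall (c : K[i]) d e, phi (c *: d + e) = c *: phi d + phi e,
      forall d, phi (adj d) = adjoint (phi d),
      forall d, opnorm (phi d) <= cnorm d,
      forall p, S p -> phi p.1 = p.2
    & forall c, cnorm c <= 1 -> (forall h, l2norm (phi c h) = l2norm h) ->
        forall d, phi (d * c) = phi d * phi c].
Proof.
have [f [fE flin fpos]] := dilation_functional S1 Slin Scc.
pose B := dilation_op_form f.
have phiP d : {T : bop K X | opnorm T <= cnorm d & forall h k, inner (T h) k = B d h k}.
  apply: cid2; apply: bounded_form; first exact: cnorm_ge0.
  - by move=> a h h' k; exact: (B_linear_l S1 Slin fE flin fpos).
  - by move=> a h k k'; exact: (B_linear_r S1 Slin fE flin fpos).
  - by move=> h k; exact: (B_bound S1 Slin fE flin fpos).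
pose phi d := s2val (phiP d).
have phiB d h k : B d h k = inner (phi d h) k by rewrite /phi; case: (phiP d).
have ext (T U : bop K X) : (forall h k, inner (T h) k = inner (U h) k) -> T = U.
  move=> TU; apply: bopP => h; apply: inner_inj => k.
  by rewrite innerC TU -innerC.
exists phi; split.
- move=> c d e; apply: ext => h k; rewrite -phiB /B (B_linear S1 Slin flin).
  by rewrite -/B bopDE bopZE innerPl !phiB.
- move=> d; apply: ext => h k; rewrite -phiB /B (B_adj S1 Slin fE flin fpos).
  by rewrite -/B phiB (adjointP (adjoint _)) adjointK -innerC.
- by move=> d; rewrite /phi; case: (phiP d).
- by move=> p Sp; apply: ext => h k; rewrite -phiB /B (B_S S1 Slin fE _ _ Sp).
- move=> c c1 iso d; apply: ext => h k; rewrite -phiB.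
  have BW h' k' : dilation_op_form f c h' k' = inner (phi c h') k' by exact: phiB.
  by rewrite /B (B_mul S1 Slin fE flin fpos d h k c1 BW iso) -/B phiB.
Qed.

End Extension.

(** * Localization of a torsion-free module *)

Local Notation nonzero R := (@nonzero R).
Local Notation nonzero1 R := (@nonzero1 R).

Lemma fractionE (R : idomainType) (a : {fraction R}) :
  a = tofrac \n_(repr a) / tofrac \d_(repr a).
Proof.
set y := repr a; rewrite -[LHS]reprK -/y.
rewrite /GRing.mul /= /GRing.inv /=; unlock tofrac; rewrite !piE.
congr (pi _ _); rewrite /FracField.mulf /FracField.invf !numden_Ratio ?oner_eq0 ?denom_ratioP//.
by rewrite mulr1 mul1r Ratio_numden.
Qed.

Definition ratio_denom (R : idomainType) (x : {ratio R}) : nonzero R :=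
  exist _ \d_x (denom_ratioP x).

Lemma fraction_ratio (R : idomainType) (a : {fraction R}) :
  exists p (q : nonzero R), a = tofrac p / tofrac (val q).
Proof. by exists \n_(repr a), (ratio_denom (repr a)); exact: fractionE. Qed.

Lemma val_nonzero_mul (R : idomainType) (q q' : nonzero R) :
  val (nonzero_mul q q') = val q * val q'.
Proof. by []. Qed.

Lemma tofrac_neq0 (R : idomainType) (q : nonzero R) : tofrac (val q) != 0.
Proof. by rewrite tofrac_eq0 (valP q). Qed.

Section Localization.
Variables (R : idomainType) (M : lmodType R) (M_tf : torsion_free M).
Local Open Scope quotient_scope.

Lemma torsion_free_inj (q : nonzero R) (m m' : M) : val q *: m = val q *: m' -> m = m'.
Proof.
move=> /eqP; rewrite -subr_eq0 -scalerBr => /eqP/M_tf[/eqP|/eqP].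
  by rewrite (negPf (valP q)).
by rewrite subr_eq0 => /eqP.
Qed.

Local Notation pre := (M * nonzero R)%type.

Definition loc_rel (x y : pre) : bool := val y.2 *: x.1 == val x.2 *: y.1.

Lemma loc_rel_refl : reflexive loc_rel.
Proof. by move=> x; exact: eqxx. Qed.

Lemma loc_rel_sym : symmetric loc_rel.
Proof. by move=> x y; exact: eq_sym. Qed.

(** Torsion-freeness cancels the middle denominator. *)
Lemma loc_rel_trans : transitive loc_rel.
Proof.
move=> y x z /eqP xy /eqP yz; apply/eqP/(@torsion_free_inj y.2).
rewrite scalerA [val y.2 * _]mulrC -scalerA xy scalerA mulrC -scalerA yz.
by rewrite !scalerA mulrC.
Qed.

Canonical loc_equiv := EquivRel loc_rel loc_rel_refl loc_rel_sym loc_rel_trans.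
Definition localization := {eq_quot loc_rel}.
HB.instance Definition _ : EqQuotient _ loc_rel localization := EqQuotient.on localization.
HB.instance Definition _ := Choice.on localization.

Definition loc_mk m q : localization := \pi_localization (m, q).

Lemma loc_mkP m q m' q' : loc_mk m q = loc_mk m' q' <-> val q' *: m = val q *: m'.
Proof. by split=> [/eqmodP/eqP|H]; last by apply/eqmodP/eqP. Qed.

Lemma loc_mkE n : n = loc_mk (repr n).1 (repr n).2.
Proof. by rewrite /loc_mk -surjective_pairing reprK. Qed.

Lemma repr_loc_mk m q : val q *: (repr (loc_mk m q)).1 = val (repr (loc_mk m q)).2 *: m.
Proof. exact/loc_mkP/esym/loc_mkE. Qed.

(** The operations use chosen representatives; [loc_oppE], [loc_addE] and [loc_scaleE] establish
    independence of the choice. *)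
Definition loc0 := loc_mk 0 (nonzero1 R).
Definition loc_opp (n : localization) := loc_mk (- (repr n).1) (repr n).2.
Definition loc_add (n n' : localization) := loc_mk
  (val (repr n').2 *: (repr n).1 + val (repr n).2 *: (repr n').1) (nonzero_mul (repr n).2 (repr n').2).
Definition loc_scale (a : {fraction R}) (n : localization) := loc_mk
  (\n_(repr a) *: (repr n).1)
  (nonzero_mul (ratio_denom (repr a)) (repr n).2).

Lemma loc_oppE m q : loc_opp (loc_mk m q) = loc_mk (- m) q.
Proof. by apply/loc_mkP; rewrite !scalerN repr_loc_mk. Qed.

Lemma loc_addE m q m' q' :
  loc_add (loc_mk m q) (loc_mk m' q') = loc_mk (val q' *: m + val q *: m') (nonzero_mul q q').
Proof.
apply/loc_mkP; have := repr_loc_mk m q; have := repr_loc_mk m' q'.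
move: (repr _) (repr _) => [n' p'] [n p] /= e' e.
rewrite !scalerDr !scalerA; congr (_ + _).
  rewrite (_ : _ * sval p = sval p * sval q' * sval q); last by ring.
  by rewrite -(scalerA _ (sval q)) e scalerA; congr (_ *: _); ring.
rewrite (_ : _ * sval p' = sval p' * sval q * sval q'); last by ring.
by rewrite -(scalerA _ (sval q')) e' scalerA; congr (_ *: _); ring.
Qed.

Lemma loc_scaleE p (r : nonzero R) m q :
  loc_scale (tofrac p / tofrac (val r)) (loc_mk m q) = loc_mk (p *: m) (nonzero_mul r q).
Proof.
rewrite /loc_scale; set a := _ / _.
have aE : \n_(repr a) * val r = \d_(repr a) * p.
  have d0 : tofrac \d_(repr a) != 0 by rewrite tofrac_eq0 denom_ratioP.
  apply/eqP; rewrite -tofrac_eq !rmorphM /= [X in _ == X]mulrC -eqr_div ?tofrac_neq0//.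
  by rewrite -fractionE.
apply/loc_mkP; have := repr_loc_mk m q; move: (repr (loc_mk _ _)) => [n s] /= e.
rewrite !scalerA /=; rewrite /= in aE.
rewrite (_ : _ * \n_(repr a) = \n_(repr a) * sval r * sval q); last by ring.
by rewrite aE -(scalerA _ (sval q)) e !scalerA; congr (_ *: _); ring.
Qed.

Lemma loc_addA : associative loc_add.
Proof.
move=> x y z; rewrite (loc_mkE x) (loc_mkE y) (loc_mkE z) !loc_addE; apply/loc_mkP => /=.
by rewrite !scalerDr !scalerA !addrA; congr (_ *: _ + _ *: _ + _ *: _); ring.
Qed.

Lemma loc_addC : commutative loc_add.
Proof.
move=> x y; rewrite (loc_mkE x) (loc_mkE y) !loc_addE; apply/loc_mkP => /=.
by rewrite !scalerDr !scalerA addrC; congr (_ *: _ + _ *: _); ring.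
Qed.

Lemma loc_add0 : left_id loc0 loc_add.
Proof.
move=> x; rewrite (loc_mkE x) !loc_addE; apply/loc_mkP => /=.
by rewrite scaler0 add0r scale1r mul1r.
Qed.

Lemma loc_addN : left_inverse loc0 loc_opp loc_add.
Proof.
move=> x; rewrite (loc_mkE x) loc_oppE !loc_addE; apply/loc_mkP => /=.
by rewrite scaler0 scalerN addNr scaler0.
Qed.

HB.instance Definition _ :=
  GRing.isZmodule.Build localization loc_addA loc_addC loc_add0 loc_addN.

Lemma loc_mkD m q m' q' :
  loc_mk m q + loc_mk m' q' = loc_mk (val q' *: m + val q *: m') (nonzero_mul q q').
Proof. exact: loc_addE. Qed.

Lemma loc_scaleA a b n : loc_scale a (loc_scale b n) = loc_scale (a * b) n.
Proof.
rewrite (loc_mkE n); have [p [q ->]] := fraction_ratio a; have [p' [q' ->]] := fraction_ratio b.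
have -> : tofrac p / tofrac (val q) * (tofrac p' / tofrac (val q')) =
    tofrac (p * p') / tofrac (val (nonzero_mul q q')).
  by rewrite val_nonzero_mul !rmorphM mulf_div.
rewrite !loc_scaleE; apply/loc_mkP => /=.
by rewrite !scalerA; congr (_ *: _); ring.
Qed.

Lemma loc_scale1 : left_id 1 loc_scale.
Proof.
move=> n; rewrite (loc_mkE n).
have -> : 1 = tofrac 1 / tofrac (val (nonzero1 R)) by rewrite rmorph1 divr1.
by rewrite !loc_scaleE; apply/loc_mkP => /=; rewrite scale1r mul1r.
Qed.

Lemma loc_scaleDr : right_distributive loc_scale +%R.
Proof.
move=> a m n; rewrite (loc_mkE m) (loc_mkE n); have [p [q ->]] := fraction_ratio a.
rewrite loc_mkD !loc_scaleE loc_mkD.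
by apply/loc_mkP => /=; rewrite !scalerDr !scalerA; congr (_ *: _ + _ *: _); ring.
Qed.

Lemma loc_scaleDl v : {morph loc_scale^~ v : a b / a + b}.
Proof.
move=> a b /=; rewrite (loc_mkE v).
have [p [q ->]] := fraction_ratio a; have [p' [q' ->]] := fraction_ratio b.
have -> : tofrac p / tofrac (val q) + tofrac p' / tofrac (val q') =
    tofrac (p * val q' + p' * val q) / tofrac (val (nonzero_mul q q')).
  by rewrite val_nonzero_mul rmorphD !rmorphM addf_div ?tofrac_neq0.
rewrite !loc_scaleE loc_mkD; apply/loc_mkP => /=.
by rewrite !scalerDr !scalerDl !scalerDr !scalerA; congr (_ *: _ + _ *: _); ring.
Qed.

HB.instance Definition _ := GRing.Zmodule_isLmodule.Build {fraction R} localization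
  loc_scaleA loc_scale1 loc_scaleDr loc_scaleDl.

Lemma loc_scale_tofrac r m q :
  tofrac r *: loc_mk m q = loc_mk (r *: m) (nonzero_mul (nonzero1 R) q).
Proof.
by rewrite -loc_scaleE; congr loc_scale; rewrite /= rmorph1 divr1.
Qed.

Definition loc_embed m : localization := loc_mk m (nonzero1 R).

Lemma loc_embed_linear : linear_for (@tofrac R \; *:%R) loc_embed.
Proof.
move=> r m n; rewrite /loc_embed.
have -> : (@tofrac R \; *:%R) r (loc_mk m (nonzero1 R)) = loc_mk (r *: m) (nonzero1 R).
  rewrite /= loc_scale_tofrac; apply/loc_mkP => /=.
  by rewrite mul1r.
rewrite loc_mkD; apply/loc_mkP => /=.
by rewrite !scale1r mul1r scale1r.
Qed.

HB.instance Definition _ := GRing.isLinear.Build R M localization _ loc_embed loc_embed_linear.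

Lemma loc_embed_inj : injective loc_embed.
Proof. by move=> m n /loc_mkP; rewrite /= !scale1r. Qed.

Lemma loc_embed_dense (n : localization) : exists (q : nonzero R) m,
  tofrac (val q) *: n = loc_embed m.
Proof.
have := loc_mkE n; move: (repr n) => [m q] ->; exists q, m; rewrite loc_scale_tofrac.
by apply/loc_mkP => /=; rewrite scale1r mul1r.
Qed.

End Localization.

Lemma localization_exists (R : idomainType) (M : lmodType R) : torsion_free M ->
  exists (N : lmodType {fraction R}) (i : {linear M -> N | @tofrac R \; *:%R}),
    injective i /\ forall n : N, exists (q : nonzero R) m, tofrac (val q) *: n = i m.
Proof.
move=> M_tf; exists (localization M_tf), (@loc_embed R M M_tf).
by split; [exact: loc_embed_inj|exact: loc_embed_dense].
Qed.

(** * Lifting operators along copies of a Hilbert space *)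

Section Push.
Context {K : realType} {X Y : choiceType}.
Variables (w : X -> Y) (w_inj : injective w).
Implicit Types (f : ell2 K X) (g : ell2 K Y).

Definition partial_inv y : option X :=
  if pselect (exists x, w x = y) is left H then Some (projT1 (cid H)) else None.

Lemma partial_invK : ocancel partial_inv w.
Proof. by move=> y; rewrite /partial_inv; case: pselect => //= H; case: cid. Qed.

Lemma partial_invE x : partial_inv (w x) = Some x.
Proof.
rewrite /partial_inv; case: pselect => [H|[]]; last by exists x.
by case: cid => x' /= /w_inj ->.
Qed.

Lemma push_bound f :
  nnsummable (fun y => normc (oapp f 0 (partial_inv y)) ^+ 2) /\
  nnsum (fun y => normc (oapp f 0 (partial_inv y)) ^+ 2) <= l2norm f ^+ 2.
Proof.
apply: nnsum_seq_bound => [y|r ur]; first exact: sqr_ge0.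
have -> : \sum_(y <- r) normc (oapp f 0 (partial_inv y)) ^+ 2 =
    \sum_(x <- pmap partial_inv r) normc (f x) ^+ 2.
  elim: r {ur} => [|y r IH]; first by rewrite !big_nil.
  rewrite big_cons IH [pmap _ (_ :: _)]/=; case: (partial_inv y) => [x|].
    by rewrite big_cons.
  by rewrite [oapp _ _ None]/= normc0 expr0n add0r.
have p0 x : 0 <= normc (f x) ^+ 2 by exact: sqr_ge0.
rewrite /l2norm sqr_sqrtr ?nnsum_ge0// nnsum_seq_le//; first exact: ell2_sum.
exact: pmap_uniq partial_invK _ ur.
Qed.

Lemma push_subproof f : (fun y => oapp f 0 (partial_inv y)) \in ell2_pred.
Proof. by apply/asboolP; have [] := push_bound f. Qed.
Definition push f : ell2 K Y := Ell2 (push_subproof f).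

Lemma pull_bound g :
  nnsummable (fun x => normc (g (w x)) ^+ 2) /\
  nnsum (fun x => normc (g (w x)) ^+ 2) <= l2norm g ^+ 2.
Proof.
have p0 x : 0 <= normc (g x) ^+ 2 by exact: sqr_ge0.
apply: nnsum_seq_bound => [x|r ur]; first exact: sqr_ge0.
rewrite /l2norm sqr_sqrtr ?nnsum_ge0// -(big_map w xpredT (fun x => normc (g x) ^+ 2)).
by rewrite nnsum_seq_le ?map_inj_uniq//; exact: ell2_sum.
Qed.

Lemma pull_subproof g : (fun x => g (w x)) \in ell2_pred.
Proof. by apply/asboolP; have [] := pull_bound g. Qed.
Definition pull g : ell2 K X := Ell2 (pull_subproof g).

Lemma pushE f x : push f (w x) = f x.
Proof. by rewrite /push /= partial_invE. Qed.

Lemma pushK f : pull (push f) = f.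
Proof. by apply: ell2P => x; exact: pushE. Qed.

Lemma push_linear : linear push.
Proof.
move=> c f g; apply: ell2P => y; rewrite ell2DE ell2ZE /=.
by case: (partial_inv y) => [x|] //=; rewrite mulr0 addr0.
Qed.
HB.instance Definition _ := GRing.isLinear.Build K[i] (ell2 K X) (ell2 K Y) *:%R push push_linear.

Lemma pull_linear : linear pull.
Proof. by move=> c f g; apply: ell2P. Qed.
HB.instance Definition _ := GRing.isLinear.Build K[i] (ell2 K Y) (ell2 K X) *:%R pull pull_linear.

Lemma l2norm_pull g : l2norm (pull g) <= l2norm g.
Proof.
rewrite -(@ler_pXn2r _ 2)// ?nnegrE ?l2norm_ge0//.
rewrite [X in X ^+ 2 <= _]/l2norm sqr_sqrtr; first by have [_] := pull_bound g.
by apply: nnsum_ge0 => x; exact: sqr_ge0.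
Qed.

Lemma l2norm_push f : l2norm (push f) = l2norm f.
Proof.
apply/eqP; rewrite eq_le; apply/andP; split; last first.
  by rewrite -[X in l2norm X <= _](pushK f) l2norm_pull.
rewrite -(@ler_pXn2r _ 2)// ?nnegrE ?l2norm_ge0//.
rewrite [X in X ^+ 2 <= _]/l2norm sqr_sqrtr; first by have [_] := push_bound f.
by apply: nnsum_ge0 => x; exact: sqr_ge0.
Qed.

Lemma push_delta x : push (delta x) = delta (w x).
Proof.
apply: ell2P => y; rewrite /push deltaE /=.
have [->|yx] := eqVneq y (w x); first by rewrite partial_invE /= eqxx.
have := partial_invK y; case: (partial_inv y) => [x'|] //= x'y.
by case: eqP => // x'x; move: yx; rewrite -x'y x'x eqxx.
Qed.

Lemma pull_delta x : pull (delta (w x)) = delta x.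
Proof. by rewrite -push_delta pushK. Qed.

End Push.

(** Coordinate x of U f is the inner product of f with U^* (delta x), and the coordinates of the
    latter are read off from U on the basis. *)
Lemma bop_delta_ext (K : realType) (X : choiceType) (S T : bop K X) :
  (forall x, S (delta x) = T (delta x)) -> S = T.
Proof.
move=> ST; apply: bopP => f; apply: ell2P => x.
have E (U : bop K X) : U f x = inner f (adjoint U (delta x)) by rewrite -adjointP inner_delta.
rewrite !E; congr inner; apply: ell2P => y.
rewrite -[LHS]inner_delta -[RHS]inner_delta.
by rewrite innerC -adjointP -innerC [RHS]innerC -adjointP -innerC ST.
Qed.

Lemma linear_delta_ext (K : realType) (X Y : choiceType) (S T : ell2 K X -> ell2 K Y) (c : K) :
  linear S -> linear T -> (forall f, l2norm (S f) <= c * l2norm f) ->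
  (forall f, l2norm (T f) <= c * l2norm f) ->
  (forall x, S (delta x) = T (delta x)) -> S =1 T.
Proof.
move=> lS lT bS bT ST f.
have B (U : ell2 K X -> ell2 K Y) g h : linear U -> U (g - h) = U g - U h.
  by move=> lU; have := lU (-1) h g; rewrite !scaleN1r [- h + g]addrC [RHS]addrC.
have sumE (U : ell2 K X -> ell2 K Y) (r : seq X) : linear U ->
    U (\sum_(x <- r) f x *: delta x) = \sum_(x <- r) f x *: U (delta x).
  move=> lU; elim: r => [|x r IH]; last by rewrite !big_cons lU IH.
  by rewrite !big_nil -[X in U X](subrr 0) (B _ _ _ lU) subrr.
apply/eqP; rewrite -subr_eq0; apply/eqP/l2norm_eq0/eqP.
rewrite eq_le l2norm_ge0 andbT leNgt; apply/negP; set d := l2norm _ => d0.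
have c0 : 0 <= `|c| by exact: normr_ge0.
have e0 : 0 < d / (2 * `|c| + 1) by rewrite divr_gt0// ltr_wpDl// mulr_ge0.
have [r _ fr] := restrict_approx f e0.
have E : S f - T f = S (f - l2restrict f r) - T (f - l2restrict f r).
  rewrite (B _ _ _ lS) (B _ _ _ lT) /l2restrict (sumE _ _ lS) (sumE _ _ lT).
  have -> : \sum_(x <- r) f x *: S (delta x) = \sum_(x <- r) f x *: T (delta x).
    by apply: eq_bigr => x _; rewrite ST.
  by rewrite opprB addrA subrK.
have : d <= 2 * `|c| * (d / (2 * `|c| + 1)).
  rewrite {1}/d E (le_trans (l2norm_triangle _ _))// l2normN.
  have H (U : ell2 K X -> ell2 K Y) g : l2norm (U g) <= c * l2norm g ->
      l2norm g <= d / (2 * `|c| + 1) -> l2norm (U g) <= `|c| * (d / (2 * `|c| + 1)).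
    move=> /le_trans Ug gd; apply: Ug; apply: le_trans (_ : `|c| * l2norm g <= _).
      by rewrite ler_wpM2r ?l2norm_ge0 ?ler_norm.
    by rewrite ler_wpM2l.
  by rewrite -mulrA mulr_natl mulr2n lerD// H// ltW.
rewrite leNgt => /negP; apply.
by rewrite mulrCA gtr_pMr// ltr_pdivrMr ?ltr_wpDl ?mulr_ge0// mul1r ltrDl.
Qed.

Section ApproximatingSequences.
Context {K : realType} {B : cstarType K}.

(** Nondecreasing with limit 0. Its increments 2 * 2^-n dominate 2^-n + 2^-(n+1), the distance
    between successive approximations of accuracies 2^-n and 2^-(n+1). *)
Definition geometric_bound (n : nat) : K := - (4 * 2^-1 ^+ n).

Lemma geometric_bound_le0 n : geometric_bound n <= 0.
Proof. by rewrite oppr_le0 mulr_ge0// exprn_ge0// invr_ge0. Qed.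

Lemma approx_sequence (A : set B) a :
  (forall e : K, 0 < e -> exists2 b, A b & cnorm (a - b) < e) ->
  exists u : nat -> B, [/\ forall n, A (u n),
    forall n, cnorm (u n.+1 - u n) <= geometric_bound n.+1 - geometric_bound n
    & forall e, 0 < e -> exists N, forall n, (N <= n)%N -> cnorm (u n - a) < e].
Proof.
move=> H; have g0 n : 0 < (2^-1 : K) ^+ n by rewrite exprn_gt0.
pose u n := s2val (cid2 (H _ (g0 n))).
have uA n : A (u n) by rewrite /u; case: cid2.
have ua n : cnorm (u n - a) < 2^-1 ^+ n by rewrite cnormB /u; case: cid2.
exists u; split=> // [n|e e0].
  rewrite (le_trans (cnorm_trans _ a _))// (cnormB a).
  have := ua n; have := ua n.+1; rewrite /geometric_bound exprS.
  have := g0 n; lra.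
have : (2^-1 : K) ^+ n @[n --> \oo] --> (0 : K).
  by apply: cvg_expr; rewrite ger0_norm ?invr_ge0// invf_lt1// ltr1n.
move=> /cvgrPdist_lt/(_ _ e0)[N _ HN]; exists N => n Nn.
apply: lt_trans (ua n) _; have := HN n Nn.
by rewrite sub0r normrN ger0_norm// exprn_ge0// invr_ge0.
Qed.

End ApproximatingSequences.

Lemma le_of_linear_error (K : realType) (x y M : K) :
  (forall e, 0 < e -> e <= 1 -> x <= y + M * e) -> x <= y.
Proof.
move=> H; apply/ler_addgt0Pr => e e0.
have M1 : 0 < `|M| + 1 by rewrite ltr_wpDl.
pose t := Num.min (e / (`|M| + 1)) 1.
have t0 : 0 < t by rewrite lt_min ltr01 andbT divr_gt0.
have t1 : t <= 1 by rewrite ge_min lexx orbT.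
rewrite (le_trans (H t t0 t1))// lerD2l.
apply: le_trans (_ : (`|M| + 1) * t <= _).
  by rewrite ler_wpM2r ?(ltW t0)// (le_trans (ler_norm M))// lerDl.
by rewrite mulrC -ler_pdivlMr// ge_min lexx.
Qed.

Section Lifting.
Context {K : realType} {X Y : pointedType} {I : Type}.
Variables (w : I -> X -> Y) (w_inj : forall i, injective (w i)).
(** Exhaustion and directedness in one: any finite set of basis vectors lies in a single copy. For
    the empty list it provides some copy. *)
Hypothesis w_cover : forall r : seq Y, exists i, forall y, y \in r -> exists x, w i x = y.
Implicit Types (a b : bop K X) (S T : bop K Y).

Local Notation push i := (push (w i)).
Local Notation pull i := (pull (@w_inj i)).

(* T acts as a on every copy of l^2(X) in l^2(Y). *)
Definition lifts a T : Prop := forall i f, T (push i f) = push i (a f).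

Lemma lifts_unique a S T : lifts a S -> lifts a T -> S = T.
Proof.
move=> aS aT; apply: bop_delta_ext => y; have [i /(_ y)] := w_cover [:: y].
rewrite inE eqxx => /(_ isT)[x <-].
by rewrite -(push_delta (@w_inj i)) aS aT.
Qed.

Lemma lifts1 : lifts 1 1. Proof. by []. Qed.

Lemma lifts0 : lifts 0 0.
Proof. by move=> i f; rewrite linear0. Qed.

Lemma liftsP (c : K[i]) a b S T : lifts a S -> lifts b T -> lifts (c *: a + b) (c *: S + T).
Proof. by move=> aS bT i f; rewrite !bopDE !bopZE linearP aS bT. Qed.

Lemma liftsB a b S T : lifts a S -> lifts b T -> lifts (a - b) (S - T).
Proof.
by move=> aS bT; have := liftsP (-1) bT aS; rewrite !scaleN1r ![- _ + _]addrC.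
Qed.

Lemma liftsM a b S T : lifts a S -> lifts b T -> lifts (a * b) (S * T).
Proof.
move=> aS bT i f; change (S (T (push i f)) = push i (a (b f))).
by rewrite bT aS.
Qed.

Lemma lifts_basis_op (phi : X -> X) (psi : Y -> Y) (phi_inj : injective phi)
  (psi_inj : injective psi) : (forall i x, psi (w i x) = w i (phi x)) ->
  lifts (basis_op phi_inj) (basis_op psi_inj).
Proof.
move=> wphi i; pose c := Num.max (opnorm (basis_op psi_inj : bop K Y)) (opnorm (basis_op phi_inj : bop K X)).
apply: (@linear_delta_ext _ _ _ _ _ c).
- by move=> a f g; rewrite !linearP.
- by move=> a f g; rewrite !linearP.
- move=> f; rewrite (le_trans (opnormP _ _))// l2norm_push//.
  by rewrite ler_wpM2r ?l2norm_ge0// le_max lexx.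
- move=> f; rewrite l2norm_push// (le_trans (opnormP _ _))//.
  by rewrite ler_wpM2r ?l2norm_ge0// le_max lexx orbT.
- by move=> x; rewrite push_delta// !basis_opE push_delta// wphi.
Qed.

(** Finite restrictions of the h_j are supported in one copy and are fixed by the projection onto
    it. The remainder and its projection contribute e / 2 each. *)
Lemma push_pull_approx n (h : 'I_n -> ell2 K Y) (e : K) : 0 < e ->
  exists i, forall j, l2norm (h j - push i (pull i (h j))) <= e.
Proof.
move=> e0; have e20 : 0 < e / 2 by rewrite divr_gt0.
pose r j := s2val (cid2 (restrict_approx (h j) e20)).
have hr j : l2norm (h j - l2restrict (h j) (r j)) < e / 2 by rewrite /r; case: cid2.
have [i Hi] := w_cover (flatten [seq r j | j : 'I_n]).
exists i => j; set g := l2restrict (h j) (r j).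
have Pg : push i (pull i g) = g.
  rewrite /g /l2restrict big_seq !linear_sum; apply: eq_bigr => y yr.
  rewrite !linearZ /=; have [|x <-] := Hi y.
    by apply/flattenP; exists (r j) => //; apply/mapP; exists j; rewrite ?mem_enum.
  by rewrite pull_delta// push_delta.
have -> : h j - push i (pull i (h j)) = (h j - g) - push i (pull i (h j - g)).
  by rewrite !linearB /= Pg; abel.
rewrite (le_trans (l2norm_triangle _ _))// l2normN l2norm_push//.
have h1 := hr j; have := l2norm_pull (@w_inj i) (h j - g).
rewrite -/g in h1; lra.
Qed.

(** Up to a small error the vectors h_j lie in one copy, where T acts as a and the assumed bound
    applies. *)
Lemma lifts_column_bound n (a : 'M[bop K X]_n) (T : 'M[bop K Y]_n) (c : K) :
  (forall k l, lifts (a k l) (T k l)) ->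
  (forall h, \sum_i l2norm (\sum_j a i j (h j)) ^+ 2 <= c ^+ 2 * \sum_j l2norm (h j) ^+ 2) ->
  forall h, \sum_i l2norm (\sum_j T i j (h j)) ^+ 2 <= c ^+ 2 * \sum_j l2norm (h j) ^+ 2.
Proof.
move=> aT H h; set s := c ^+ 2 * _.
have s0 : 0 <= s by rewrite mulr_ge0 ?sqr_ge0// sumr_ge0// => j _; exact: sqr_ge0.
pose C := \sum_i \sum_j opnorm (T i j).
have C0 : 0 <= C by apply: sumr_ge0 => i _; apply: sumr_ge0 => j _; exact: opnorm_ge0.
pose A := Num.sqrt s; have A0 : 0 <= A by exact: sqrtr_ge0.
(* Each of the n rows gives (|y_k| + C e)^2 <= |y_k|^2 + (2 A C + C^2) e, from |y_k| <= A and e <=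
   1. *)
apply: (@le_of_linear_error _ _ _ (n%:R * (2 * A * C + C ^+ 2))) => e e0 e1.
have [i hi] := push_pull_approx h e0.
pose g j := push i (pull i (h j)).
pose y k := \sum_j T k j (g j).
have yE k : y k = push i (\sum_j a k j (pull i (h j))).
  by rewrite linear_sum /=; apply: eq_bigr => j _; rewrite aT.
have ys : \sum_k l2norm (y k) ^+ 2 <= s.
  under eq_bigr do rewrite yE l2norm_push//.
  apply: le_trans (H _) _; rewrite ler_wpM2l ?sqr_ge0//; apply: ler_sum => j _.
  by rewrite ler_pXn2r ?nnegrE ?l2norm_ge0// l2norm_pull.
have yA k : l2norm (y k) <= A.
  rewrite -[leLHS](ger0_norm (l2norm_ge0 _)) -sqrtr_sqr ler_wsqrtr//.
  rewrite (le_trans _ ys)// (bigD1 k)//= lerDl sumr_ge0// => j _; exact: sqr_ge0.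
have dk k : l2norm (\sum_j T k j (h j)) <= l2norm (y k) + C * e.
  have -> : \sum_j T k j (h j) = y k + \sum_j T k j (h j - g j).
    by rewrite -big_split /=; apply: eq_bigr => j _; rewrite linearB /= addrC subrK.
  rewrite (le_trans (l2norm_triangle _ _))// lerD2l.
  apply: le_trans (_ : \sum_j opnorm (T k j) * e <= _).
    elim/big_ind2: _ => [|u p v q up vq|j _]; first by rewrite l2norm0.
      by rewrite (le_trans (l2norm_triangle _ _))// lerD.
    by rewrite (le_trans (opnormP _ _))// ler_wpM2l ?opnorm_ge0.
  rewrite -mulr_suml ler_wpM2r ?(ltW e0)// /C [leRHS](bigD1 k)//= lerDl.
  by apply: sumr_ge0 => l _; apply: sumr_ge0 => j _; exact: opnorm_ge0.
apply: le_trans (_ : \sum_k (l2norm (y k) ^+ 2 + (2 * A * C + C ^+ 2) * e) <= _).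
  apply: ler_sum => k _; have d := dk k; have y0 := l2norm_ge0 (y k).
  apply: le_trans (_ : (l2norm (y k) + C * e) ^+ 2 <= _).
    have Ce0 : 0 <= C * e by rewrite mulr_ge0// ltW.
    by rewrite ler_pXn2r ?nnegrE ?l2norm_ge0// addr_ge0.
  have h1 : l2norm (y k) * (C * e) <= A * (C * e).
    by rewrite ler_wpM2r ?yA// mulr_ge0// ltW.
  have h2 : C ^+ 2 * (e * e) <= C ^+ 2 * (1 * e).
    by rewrite ler_wpM2l ?sqr_ge0// ler_wpM2r ?(ltW e0).
  by rewrite sqrrD exprMn; lra.
by rewrite big_split /= sumr_const card_ord lerD// -[leLHS]mulr_natl mulrA.
Qed.

Lemma lifts_mxnorm n (a : 'M[bop K X]_n) (T : 'M[bop K Y]_n) :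
  (forall k l, lifts (a k l) (T k l)) -> mxnorm T = mxnorm a.
Proof.
move=> aT; apply/eqP; rewrite eq_le; apply/andP; split; apply: mxnorm_le_mxnorm => c c0.
  move=> /(mxnorm_bopP _ c0) H; apply/(mxnorm_bopP _ c0); exact: lifts_column_bound H.
move=> /(mxnorm_bopP _ c0) H; apply/(mxnorm_bopP _ c0) => h.
have [i _] := w_cover [::].
have := H (fun j => push i (h j)).
have -> : \sum_j l2norm (push i (h j)) ^+ 2 = \sum_j l2norm (h j) ^+ 2.
  by apply: eq_bigr => j _; rewrite l2norm_push.
congr (_ <= _); apply: eq_bigr => k _.
rewrite -(l2norm_push (@w_inj i)); congr (l2norm _ ^+ 2).
by rewrite linear_sum /=; apply: eq_bigr => j _; rewrite aT.
Qed.

Lemma lifts_norm a T : lifts a T -> cnorm T = cnorm a.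
Proof.
move=> aT; apply: EFin_inj; rewrite -!mxnorm1; apply: lifts_mxnorm => k l.
by rewrite !mxE !ord1 eqxx !mulr1n.
Qed.

(** Lifting preserves norms, so lifts of an approximating sequence converge, and their limit lifts
    [a]. *)
Lemma lifts_closed a :
  (forall e : K, 0 < e -> exists2 b, (exists T, lifts b T) & cnorm (a - b) < e) ->
  exists T, lifts a T.
Proof.
move=> /approx_sequence[u [uL ustep ua]].
pose T n := projT1 (cid (uL n)).
have uT n : lifts (u n) (T n) by rewrite /T; case: cid.
have [n||L HL] := @cnorm_limit _ _ T geometric_bound 0.
- by rewrite (lifts_norm (liftsB (uT n.+1) (uT n))).
- exact: geometric_bound_le0.
exists L => i f; apply/eqP; rewrite -subr_eq0; apply/eqP/l2norm_eq0/eqP.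
rewrite eq_le l2norm_ge0 andbT; apply: (@le_of_linear_error _ _ _ (2 * l2norm f)) => e e0 _.
have [N HN] := HL _ e0; have [N' HN'] := ua _ e0.
pose n := maxn N N'.
have -> : L (push i f) - push i (a f) = push i ((u n - a) f) - (T n - L) (push i f).
  rewrite -[(u n - a) f]/(u n f - a f) -[(T n - L) _]/(T n _ - L _) linearB /= uT.
  by abel.
rewrite (le_trans (l2norm_triangle _ _))// l2normN add0r -mulrA mulr_natl mulr2n lerD//.
  rewrite l2norm_push// (le_trans (opnormP _ _))// mulrC ler_wpM2l ?l2norm_ge0//.
  by rewrite ltW// (HN' n) ?leq_maxr.
rewrite (le_trans (opnormP _ _))// l2norm_push// mulrC ler_wpM2l ?l2norm_ge0//.
by rewrite ltW// (HN n) ?leq_maxl.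
Qed.

Definition lift_op a : bop K Y :=
  if pselect (exists T, lifts a T) is left H then projT1 (cid H) else 0.

Lemma lift_opE a T : lifts a T -> lift_op a = T.
Proof.
move=> aT; rewrite /lift_op; case: pselect => [H|[]]; last by exists T.
by case: cid => S /= aS; exact: lifts_unique aS aT.
Qed.

End Lifting.

(** * Operators on Fock space *)

Section GeneratedAlgebras.
Context {K : realType} {B : cstarType K}.
Implicit Types (G A : set B) (a b : B).

Lemma smallest_subalgebra (C : set B -> Prop) G :
  (forall A, C A -> subalgebra A) -> subalgebra (smallest C G).
Proof.
move=> CA; split.
- by move=> A [/CA[A0 _ _] _].
- by move=> c a b Ga Gb A PA; have [/CA[_ AP _] _] := PA; exact: AP (Ga _ PA) (Gb _ PA).
- by move=> a b Ga Gb A PA; have [/CA[_ _ AM] _] := PA; exact: AM (Ga _ PA) (Gb _ PA).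
Qed.

Lemma smallest_norm_closed (C : set B -> Prop) G :
  (forall A, C A -> norm_closed A) -> norm_closed (smallest C G).
Proof.
move=> CA a Ha A PA; have [/CA cA _] := PA; apply: cA => e /Ha[b Gb ab].
by exists b => //; exact: Gb _ PA.
Qed.

Lemma closed_algebra_subalgebra G : subalgebra (closed_algebra G).
Proof. by apply: smallest_subalgebra => A []. Qed.

Lemma closed_algebra_norm_closed G : norm_closed (closed_algebra G).
Proof. by apply: smallest_norm_closed => A []. Qed.

Lemma cstar_algebra_subalgebra G : subalgebra (cstar_algebra G).
Proof. by apply: smallest_subalgebra => A []. Qed.

Lemma cstar_algebra_norm_closed G : norm_closed (cstar_algebra G).
Proof. by apply: smallest_norm_closed => A []. Qed.

Lemma cstar_algebra_adj G a : cstar_algebra G a -> cstar_algebra G (adj a).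
Proof. by move=> Ga A PA; have [[_ _ +] _] := PA; apply; exact: Ga. Qed.

Definition alg_span G : set B := smallest (@subalgebra K B) G.

Lemma alg_span_subalgebra G : subalgebra (alg_span G).
Proof. exact: smallest_subalgebra. Qed.

Lemma alg_span_closed G : alg_span G `<=` closed_algebra G.
Proof.
by apply: smallest_sub; [exact: closed_algebra_subalgebra|exact: sub_gen_smallest].
Qed.

Lemma closed_algebra_dense G a : closed_algebra G a ->
  forall e : K, 0 < e -> exists2 b, alg_span G b & cnorm (a - b) < e.
Proof.
have [G0 GP GM] := alg_span_subalgebra G.
pose C : set B := [set a | forall e : K, 0 < e -> exists2 b, alg_span G b & cnorm (a - b) < e].
suff sub : closed_algebra G `<=` C by exact: sub.
apply: smallest_sub; last first.
  move=> x Gx e e0; exists x; first exact: sub_gen_smallest.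
  by rewrite subrr cnorm0.
split; last first.
  move=> x Cx e e0; have e20 : 0 < e / 2 by rewrite divr_gt0.
  have [y Cy xy] := Cx _ e20; have [z Gz yz] := Cy _ e20; exists z => //.
  rewrite (le_lt_trans (cnorm_trans _ y _))//; lra.
split.
- by move=> e e0; exists 0 => //; rewrite subrr cnorm0.
- move=> c x y Cx Cy e e0.
  have n0 : 0 < normc c + 1 by rewrite ltr_wpDl ?normc_ge0.
  have [x' Gx xx] := Cx (e / (normc c + 1) / 2) ltac:(by rewrite !divr_gt0).
  have [y' Gy yy] := Cy (e / 2) ltac:(by rewrite divr_gt0).
  exists (c *: x' + y'); first exact: GP.
  rewrite opprD addrACA -scalerBr (le_lt_trans (cnormD _ _))// cnormZ.
  have : normc c * cnorm (x - x') <= (normc c + 1) * (e / (normc c + 1) / 2).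
    by apply: ler_pM; rewrite ?normc_ge0 ?cnorm_ge0 ?lerDl// ltW.
  have -> : (normc c + 1) * (e / (normc c + 1) / 2) = e / 2 by field; rewrite gt_eqF.
  by move: yy; lra.
- move=> x y Cx Cy e e0.
  pose m := cnorm x + cnorm y + 1; have m0 : 0 < m by rewrite ltr_wpDl ?addr_ge0 ?cnorm_ge0.
  (* t <= 1 gives |x'| <= |x| + 1, so the error of the product is at most t m <= e / 2. *)
  pose t := Num.min (e / (2 * m)) 1.
  have t0 : 0 < t by rewrite lt_min ltr01 andbT !divr_gt0// mulr_gt0.
  have t1 : t <= 1 by rewrite ge_min lexx orbT.
  have te : t * m <= e / 2.
    rewrite -ler_pdivlMr// ge_min; apply/orP; left.
    by rewrite invfM mulrA.
  have [x' Gx xx] := Cx t t0; have [y' Gy yy] := Cy t t0.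
  exists (x' * y'); first exact: GM.
  have -> : x * y - x' * y' = (x - x') * y + x' * (y - y') by rewrite mulrBl mulrBr; abel.
  have nx' : cnorm x' <= cnorm x + 1.
    have := cnorm_le_add x' x; rewrite cnormB; lra.
  have h1 : cnorm ((x - x') * y) <= t * cnorm y.
    by rewrite (le_trans (cnormM _ _))// ler_wpM2r ?cnorm_ge0// ltW.
  have h2 : cnorm (x' * (y - y')) <= (cnorm x + 1) * t.
    by rewrite (le_trans (cnormM _ _))// ler_pM ?cnorm_ge0// ltW.
  rewrite (le_lt_trans (cnormD _ _))// (le_lt_trans (lerD h1 h2))//.
  rewrite (_ : _ + _ = t * m); last by rewrite /m; ring.
  by rewrite (le_lt_trans te)// ltr_pdivrMr// mulr_natr mulr2n ltrDl.
Qed.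

End GeneratedAlgebras.

Section Isometries.
Context {K : realType} {X : pointedType}.
Variables (phi : X -> X) (phi_inj : injective phi).
Local Notation T := (basis_op phi_inj : bop K X).

Lemma basis_op_isometry : adjoint T * T = 1.
Proof.
apply: bop_delta_ext => x; change (adjoint T (T (delta x)) = delta x).
rewrite basis_opE; apply: ell2P => y; rewrite -[LHS]inner_delta innerC -adjointP -innerC.
by rewrite basis_opE inner_delta !deltaE (inj_eq phi_inj).
Qed.

End Isometries.

Lemma isometry_l2norm (K : realType) (X : pointedType) (T : bop K X) f :
  adjoint T * T = 1 -> l2norm (T f) = l2norm f.
Proof.
move=> TT; apply/eqP; rewrite -(@eqrXn2 _ 2)// ?l2norm_ge0//.
rewrite -(inj_eq (@complexI K)) -!inner_norm adjointP.
by rewrite -[adjoint T (T f)]/((adjoint T * T) f) TT.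
Qed.

Lemma isometry_cnorm (K : realType) (X : pointedType) (T : bop K X) :
  adjoint T * T = 1 -> cnorm T = 1.
Proof.
move=> TT; apply/eqP; rewrite -(@eqrXn2 _ 2)// ?cnorm_ge0//.
by rewrite -cnorm_adjM [adj T * T]TT cnorm1 expr1n.
Qed.

Lemma unitary_adjoint (K : realType) (X : pointedType) (S T : bop K X) :
  adjoint S * S = 1 -> S * T = 1 -> adjoint S = T.
Proof. by move=> SS ST; rewrite -[LHS]mulr1 -ST mulrA SS mul1r. Qed.

Section FockOperators.
Context {K : realType} {R : idomainType} {M : lmodType R}.
Local Notation U := (fock_U K).
Local Notation S := (fock_S K M).
Implicit Types (m n : M) (r s : nonzero R).

Lemma nonzero_mulC r s : nonzero_mul r s = nonzero_mul s r.
Proof. by apply: val_inj => /=; rewrite mulrC. Qed.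

Lemma nonzero_mulA r s t : nonzero_mul r (nonzero_mul s t) = nonzero_mul (nonzero_mul r s) t.
Proof. by apply: val_inj => /=; rewrite mulrA. Qed.

Lemma fock_US m r : U m * S r = S r * U (val r *: m).
Proof.
apply: bop_delta_ext => -[n s].
change (U m (S r (delta (n, s))) = S r (U (val r *: m) (delta (n, s)))).
rewrite (fock_SE K r n s) (fock_UE K m n) (fock_UE K (val r *: m) n s) (fock_SE K r _ s) scalerA.
by have -> : val (nonzero_mul r s) = val s * val r by exact: mulrC.
Qed.

Lemma fock_SM r s : S r * S s = S (nonzero_mul r s).
Proof.
apply: bop_delta_ext => -[n t]; change (S r (S s (delta (n, t))) = S (nonzero_mul r s) (delta (n, t))).
by rewrite (fock_SE K s n t) (fock_SE K r n) (fock_SE K _ n t) nonzero_mulA.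
Qed.

Lemma fock_UD m n : U m * U n = U (m + n).
Proof.
apply: bop_delta_ext => -[p t]; change (U m (U n (delta (p, t))) = U (m + n) (delta (p, t))).
by rewrite (fock_UE K n p t) (fock_UE K m _ t) (fock_UE K (m + n) p t) scalerDr addrA.
Qed.

Lemma fock_U0 : U (0 : M) = 1.
Proof.
by apply: bop_delta_ext => -[p t]; rewrite (fock_UE K 0 p t) scaler0 add0r.
Qed.

Lemma fock_S1 : S (nonzero1 R) = 1.
Proof.
apply: bop_delta_ext => -[p t]; rewrite (fock_SE K _ p t).
by have -> : nonzero_mul (nonzero1 R) t = t by apply: val_inj; exact: mul1r.
Qed.

Lemma fock_U_isometry m : adjoint (U m) * U m = 1.
Proof. exact: basis_op_isometry. Qed.

Lemma fock_S_isometry r : adjoint (S r) * S r = 1.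
Proof. exact: basis_op_isometry. Qed.

Lemma fock_U_adjoint m : adjoint (U m) = U (- m).
Proof.
by apply: unitary_adjoint; [exact: fock_U_isometry|rewrite fock_UD subrr fock_U0].
Qed.

Lemma fock_algebra_U m : fock_algebra K M (U m).
Proof. by apply: sub_gen_smallest; left; exists m. Qed.

Lemma fock_algebra_S r : fock_algebra K M (S r).
Proof. by apply: sub_gen_smallest; right; exists r. Qed.

Lemma fock_algebra1 : fock_algebra K M 1.
Proof. by rewrite -fock_U0; exact: fock_algebra_U. Qed.

Definition fock_span : set (bop K (fock_basis M)) := alg_span (range (@fock_U K R M) `|` range S).

Lemma fock_span_S r : fock_span (S r).
Proof. by apply: sub_gen_smallest; right; exists r. Qed.

Lemma fock_span_U m : fock_span (U m).
Proof. by apply: sub_gen_smallest; left; exists m. Qed.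

(** An Ore condition: [S r] passes to the left of any element of the span, so denominators of
    products can be merged. *)
Lemma fock_span_commute a r : fock_span a -> exists2 a', fock_span a' & a * S r = S r * a'.
Proof.
move=> sa; have [s0 sP sM] : subalgebra fock_span by exact: alg_span_subalgebra.
move: a sa r; pose C : set (bop K (fock_basis M)) :=
  [set a | forall r, exists2 a', fock_span a' & a * S r = S r * a'].
suff sub : fock_span `<=` C by exact: sub.
apply: smallest_sub; last first.
  move=> _ [[m _ <-]|[s _ <-]] r.
    by exists (U (val r *: m)); [exact: fock_span_U|exact: fock_US].
  by exists (S s); [exact: fock_span_S|rewrite !fock_SM nonzero_mulC].
split.
- by move=> r; exists 0 => //; rewrite mul0r mulr0.
- move=> c a b Ca Cb r; have [a' sa' ea] := Ca r; have [b' sb' eb] := Cb r.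
  by exists (c *: a' + b'); [exact: sP|rewrite mulrDl mulrDr -scalerAl -scalerAr ea eb].
- move=> a b Ca Cb r; have [b' sb' eb] := Cb r; have [a' sa' ea] := Ca r.
  by exists (a' * b'); [exact: sM|rewrite -mulrA eb mulrA ea mulrA].
Qed.

End FockOperators.

(** * The Fock algebras of a module and of its localization *)

Section FractionField.
Context {K : realType} {R : idomainType} {F : fieldType} {M : lmodType R} {N : lmodType F}.
Variables (t : {rmorphism R -> F}) (i : M -> N).
Hypothesis t_inj : injective t.
Hypothesis t_frac : forall x : F, exists p (q : nonzero R), x = t p / t (val q).
Hypothesis i_lin : forall r m n, i (r *: m + n) = t r *: i m + i n.
Hypothesis i_inj : injective i.
Hypothesis i_frac : forall n : N, exists (q : nonzero R) m, t (val q) *: n = i m.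
Local Notation X := (fock_basis M).
Local Notation Y := (fock_basis N).
Local Notation A := (fock_algebra K M).
Local Notation E := (fock_algebra K N).
Local Notation UM := (@fock_U K R M).
Local Notation SM := (@fock_S K R M).
Local Notation UN := (@fock_U K F N).
Local Notation SN := (@fock_S K F N).

Lemma t_neq0 (r : nonzero R) : t (val r) != 0.
Proof. by rewrite -(rmorph0 t) (inj_eq t_inj) (valP r). Qed.

Definition frac_nz (r : nonzero R) : nonzero F := exist _ (t (val r)) (t_neq0 r).

Lemma inv_nz_subproof (q : nonzero F) : (val q)^-1 != 0.
Proof. by rewrite invr_eq0 (valP q). Qed.

Definition inv_nz (q : nonzero F) : nonzero F := exist _ (val q)^-1 (inv_nz_subproof q).

Lemma mul_inv_nz q : nonzero_mul (inv_nz q) q = nonzero1 F.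
Proof. by apply: val_inj; exact: (mulVf (valP q)). Qed.

Lemma num_neq0 (q : nonzero F) p (r : nonzero R) : val q = t p / t (val r) -> p != 0.
Proof.
by have q0 : val q != 0 := valP q; move=> qE; apply: contraNneq q0 => p0; rewrite qE p0 rmorph0 mul0r.
Qed.

Lemma i0 : i 0 = 0.
Proof. by have := i_lin (-1) 0 0; rewrite !scaler0 addr0 rmorphN1 scaleN1r addNr. Qed.

Lemma iZ r m : i (r *: m) = t r *: i m.
Proof. by have := i_lin r m 0; rewrite !addr0 i0 addr0. Qed.

Lemma iD m n : i (m + n) = i m + i n.
Proof. by have := i_lin 1 m n; rewrite rmorph1 !scale1r. Qed.

(* The copy of the Fock space of M indexed by b is its translate by b^-1. *)
Definition fock_embed (b : nonzero R) (x : X) : Y :=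
  ((val (frac_nz b))^-1 *: i x.1, nonzero_mul (inv_nz (frac_nz b)) (frac_nz x.2)).

Lemma fock_embed_inj b : injective (fock_embed b).
Proof.
have b0 : (val (frac_nz b))^-1 != 0 by rewrite invr_eq0 (valP (frac_nz b)).
move=> [m r] [m' r'] [/(scalerI b0)/i_inj -> /(mulfI b0)/t_inj rr].
by congr pair; apply: val_inj.
Qed.

(** The copy indexed by b lies in the one indexed by b b', so any two copies lie in a third. *)
Lemma fock_embed_scale b b' m r :
  fock_embed b (m, r) = fock_embed (nonzero_mul b b') (val b' *: m, nonzero_mul b' r).
Proof.
have b0 := t_neq0 b; have b0' := t_neq0 b'.
congr pair.
  change ((t (val b))^-1 *: i m = (t (val b * val b'))^-1 *: i (val b' *: m)).
  by rewrite iZ scalerA rmorphM invfM -mulrA mulVf// mulr1.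
apply: val_inj.
change ((t (val b))^-1 * t (val r) = (t (val b * val b'))^-1 * t (val b' * val r)).
by rewrite !rmorphM invfM mulrA -(mulrA _ (t (val b'))^-1) mulVf// mulr1.
Qed.

Lemma fock_embed_cover (s : seq Y) : exists b, forall y, y \in s -> exists x, fock_embed b x = y.
Proof.
elim: s => [|y s [b Hb]]; first by exists (nonzero1 R).
have [b' [[m r] yE]] : exists b' x, fock_embed b' x = y.
  case: y => n q; have [q1 [m nE]] := i_frac n; have [p [q2 qE]] := t_frac (val q).
  have p0 := num_neq0 qE.
  have q10 := t_neq0 q1; have q20 := t_neq0 q2.
  (* Common denominator q1 q2 for n = i(m) / q1 and q = p / q2. *)
  exists (nonzero_mul q1 q2), (val q2 *: m, nonzero_mul q1 (exist _ p p0)); congr pair.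
    change ((t (val q1 * val q2))^-1 *: i (val q2 *: m) = n).
    by rewrite iZ -nE !scalerA !rmorphM invfM -mulrA mulKf// mulVf// scale1r.
  apply: val_inj; change ((t (val q1 * val q2))^-1 * t (val q1 * p) = val q).
  by rewrite qE !rmorphM invfM [X in X * _]mulrC -mulrA mulKf// mulrC.
exists (nonzero_mul b b') => z; rewrite inE => /orP[/eqP ->|/Hb[[m' r'] <-]].
  by exists (val b *: m, nonzero_mul b r); rewrite nonzero_mulC -fock_embed_scale.
by exists (val b' *: m', nonzero_mul b' r'); rewrite -fock_embed_scale.
Qed.

Local Notation lifts := (lifts fock_embed).
Local Notation iota := (@lift_op K X Y (nonzero R) fock_embed).

Lemma lifts_U m : lifts (UM m) (UN (i m)).
Proof.
apply: lifts_basis_op => b [n r]; first exact: fock_embed_inj.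
congr pair.
change ((t (val b))^-1 * t (val r) *: i m + (t (val b))^-1 *: i n =
   (t (val b))^-1 *: i (val r *: m + n)).
by rewrite iD iZ scalerDr scalerA.
Qed.

Lemma lifts_S r : lifts (SM r) (SN (frac_nz r)).
Proof.
apply: lifts_basis_op => b [n s]; first exact: fock_embed_inj.
congr pair; apply: val_inj.
change (t (val r) * ((t (val b))^-1 * t (val s)) = (t (val b))^-1 * t (val r * val s)).
by rewrite mulrCA rmorphM.
Qed.

Lemma fock_algebra_lifts a : A a -> exists T, lifts a T.
Proof.
move: a; suff sub : A `<=` [set a | exists T, lifts a T] by exact: sub.
apply: smallest_sub; last first.
  by move=> _ [[m _ <-]|[r _ <-]]; eexists; [exact: lifts_U|exact: lifts_S].
split; first split.
- by exists 0; exact: lifts0.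
- by move=> c a b [S aS] [T bT]; exists (c *: S + T); exact: liftsP.
- by move=> a b [S aS] [T bT]; exists (S * T); exact: liftsM.
- by move=> a; exact: (lifts_closed fock_embed_inj fock_embed_cover).
Qed.

Lemma iotaE a T : lifts a T -> iota a = T.
Proof. exact: (lift_opE fock_embed_inj fock_embed_cover). Qed.

Lemma iotaP a : A a -> lifts a (iota a).
Proof. by move=> /fock_algebra_lifts[T aT]; rewrite (iotaE aT). Qed.

Lemma iota_U m : iota (UM m) = UN (i m). Proof. exact/iotaE/lifts_U. Qed.
Lemma iota_S r : iota (SM r) = SN (frac_nz r). Proof. exact/iotaE/lifts_S. Qed.
Lemma iota1 : iota 1 = 1. Proof. exact/iotaE/lifts1. Qed.

Lemma iota_lin (c : K[i]) a b : A a -> A b -> iota (c *: a + b) = c *: iota a + iota b.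
Proof. by move=> Aa Ab; apply/iotaE/liftsP; exact: iotaP. Qed.

Lemma iotaM a b : A a -> A b -> iota (a * b) = iota a * iota b.
Proof. by move=> Aa Ab; apply/iotaE/liftsM; exact: iotaP. Qed.

Lemma iota_norm a : A a -> cnorm (iota a) = cnorm a.
Proof. by move=> Aa; exact: (lifts_norm fock_embed_inj fock_embed_cover (iotaP Aa)). Qed.

Lemma iota_mxnorm n (a : 'M[bop K X]_n) : (forall k l, A (a k l)) ->
  mxnorm (map_mx iota a) = mxnorm a.
Proof.
move=> Aa; apply: (lifts_mxnorm fock_embed_inj fock_embed_cover) => k l.
by rewrite mxE; exact: iotaP.
Qed.

Lemma iota_unital_ci_hom : unital_ci_hom A iota.
Proof.
split; [exact: iota1|exact: iota_lin|exact: iotaM|].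
by move=> n a Aa; exact: iota_mxnorm.
Qed.

Let A_sub : subalgebra A := closed_algebra_subalgebra _.
Let A_closed : norm_closed A := @closed_algebra_norm_closed _ _ _.
Let E_sub : subalgebra E := closed_algebra_subalgebra _.
Let E_closed : norm_closed E := @closed_algebra_norm_closed _ _ _.

Lemma fock_US_frac q n m : t (val q) *: n = i m ->
  UN n * SN (frac_nz q) = SN (frac_nz q) * UN (i m).
Proof. by move=> <-; exact: (fock_US n (frac_nz q)). Qed.

Lemma SN_inv q : SN q * SN (inv_nz q) = 1.
Proof. by rewrite fock_SM nonzero_mulC mul_inv_nz fock_S1. Qed.

Lemma SN_adjoint q : adjoint (SN q) = SN (inv_nz q).
Proof. by apply: unitary_adjoint; [exact: fock_S_isometry|exact: SN_inv]. Qed.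

Lemma field_fock_adj T : E T -> E (adj T).
Proof.
have [E0 EP EM] := E_sub.
suff sub : E `<=` [set T | E T /\ E (adj T)] by move=> /sub[].
apply: smallest_sub; last first.
  move=> _ [[n _ <-]|[q _ <-]]; split.
  - exact: fock_algebra_U.
  - by rewrite [adj _]fock_U_adjoint; exact: fock_algebra_U.
  - exact: fock_algebra_S.
  - by rewrite [adj _]SN_adjoint; exact: fock_algebra_S.
split; first split.
- by split=> //; rewrite adj0.
- move=> c a b [Ea Ea'] [Eb Eb']; split; first exact: EP.
  by rewrite adjD adjZ; exact: EP.
- move=> a b [Ea Ea'] [Eb Eb']; split; first exact: EM.
  by rewrite adjM; exact: EM.
- move=> a Ha; split; apply: E_closed => e /Ha[b [Eb Eb'] ab].
    by exists b.
  by exists (adj b); rewrite // -adjB cnorm_adj.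
Qed.

(** Induction on the generators of [A], used for iota with target [E] and for j with the
    multiplicative domain. Membership in [A] is carried along because f is a homomorphism only
    there; its isometry handles limits. *)
Lemma sub_preimage (B : cstarType K) (f : bop K X -> B) (P : set B) :
  (forall (c : K[i]) a b, A a -> A b -> f (c *: a + b) = c *: f a + f b) ->
  (forall a b, A a -> A b -> f (a * b) = f a * f b) ->
  (forall a, A a -> cnorm (f a) = cnorm a) ->
  subalgebra P -> norm_closed P ->
  (forall m, P (f (UM m))) -> (forall r, P (f (SM r))) -> forall a, A a -> P (f a).
Proof.
move=> fl fm fn [P0 PP PM] Pc PU PS.
have [A0 AP AM] := A_sub.
have f0 : f 0 = 0.
  have := fl (-1) 0 0 A0 A0; rewrite scaler0 addr0 scaleN1r addNr; exact.
have fB a b : A a -> A b -> f (a - b) = f a - f b.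
  by move=> Aa Ab; have := fl (-1) b a Ab Aa; rewrite !scaleN1r [- b + a]addrC => ->; rewrite addrC.
have AB a b : A a -> A b -> A (a - b).
  by move=> Aa Ab; have := AP (-1) b a Ab Aa; rewrite scaleN1r addrC.
suff sub : A `<=` [set a | A a /\ P (f a)] by move=> a /sub[].
apply: smallest_sub; last first.
  move=> _ [[m _ <-]|[r _ <-]]; split => //; first exact: fock_algebra_U.
  exact: fock_algebra_S.
split; first split.
- by rewrite /= f0.
- move=> c a b [Aa Pa] [Ab Pb]; split; first exact: AP.
  by rewrite fl//; exact: PP.
- move=> a b [Aa Pa] [Ab Pb]; split; first exact: AM.
  by rewrite fm//; exact: PM.
- move=> a Ha; have Aa : A a by apply: A_closed => e /Ha[b [Ab _] ab]; exists b.
  split=> //; apply: Pc => e /Ha[b [Ab Pb] ab]; exists (f b) => //.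
  by rewrite -fB// fn//; exact: AB.
Qed.

Lemma iota_range_sub a : A a -> E (iota a).
Proof.
apply: (@sub_preimage _ iota) => //.
- exact: iota_lin.
- exact: iotaM.
- exact: iota_norm.
- by move=> m; rewrite iota_U; exact: fock_algebra_U.
- by move=> r; rewrite iota_S; exact: fock_algebra_S.
Qed.

Lemma nz_frac (q : nonzero F) : exists p r : nonzero R,
  nonzero_mul q (frac_nz r) = frac_nz p.
Proof.
have [p [r qE]] := t_frac (val q).
have p0 := num_neq0 qE.
exists (exist _ p p0), r; apply: val_inj; change (val q * t (val r) = t p).
by rewrite qE divfK// t_neq0.
Qed.

Lemma iota_generates : cstar_algebra (iota @` A) = E.
Proof.
have [C0 CP CM] := cstar_algebra_subalgebra (iota @` A).
have Cg a : A a -> cstar_algebra (iota @` A) (iota a).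
  by move=> Aa; apply: sub_gen_smallest; exists a.
apply/seteqP; split.
  apply: smallest_sub; last by move=> _ [a Aa <-]; exact: iota_range_sub.
  split; [exact: E_sub|exact: E_closed|exact: field_fock_adj].
apply: smallest_sub.
  by split; [exact: cstar_algebra_subalgebra|exact: cstar_algebra_norm_closed].
have CS r : cstar_algebra (iota @` A) (SN (frac_nz r)).
  by rewrite -iota_S; apply: Cg; exact: fock_algebra_S.
have CSi r : cstar_algebra (iota @` A) (SN (inv_nz (frac_nz r))).
  by rewrite -SN_adjoint; apply: cstar_algebra_adj; exact: CS.
move=> _ [[n _ <-]|[q _ <-]].
  have [q [m qn]] := i_frac n.
  have -> : UN n = SN (frac_nz q) * UN (i m) * SN (inv_nz (frac_nz q)).
    by rewrite -(fock_US_frac qn) -mulrA SN_inv mulr1.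
  by apply: (CM) => //; apply: (CM) => //; rewrite -iota_U; apply: Cg; exact: fock_algebra_U.
have [p [r qr]] := nz_frac q.
have -> : SN q = SN (frac_nz p) * SN (inv_nz (frac_nz r)).
  by rewrite -qr -fock_SM -mulrA SN_inv mulr1.
exact: CM.
Qed.

Local Notation A0 := (@fock_span K R M).
Local Notation E0 := (@fock_span K F N).

Lemma fock_span_sub a : A0 a -> A a. Proof. exact: alg_span_closed. Qed.

(* Every element of the algebra generated by the U^n and S_q is moved into the
   image of iota by some S_b on the right, b being a common denominator. *)
Lemma common_denominator T : E0 T -> exists b a, A0 a /\ T * SN (frac_nz b) = iota a.
Proof.
have [s0 sP sM] : subalgebra A0 by exact: alg_span_subalgebra.
have iS b a : A0 a -> iota a * SN (frac_nz b) = iota (a * SM b).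
  by move=> sa; exact: esym (iotaE (liftsM (iotaP (fock_span_sub sa)) (lifts_S b))).
have sS b a : A0 a -> A0 (a * SM b) by move=> sa; exact: sM _ _ sa (fock_span_S b).
have frac_M b b' : frac_nz (nonzero_mul b b') = nonzero_mul (frac_nz b) (frac_nz b').
  by apply: val_inj; exact: rmorphM.
pose P : set (bop K Y) := [set T | exists b a, A0 a /\ T * SN (frac_nz b) = iota a].
suff sub : E0 `<=` P by exact: sub.
apply: smallest_sub; last first.
  move=> _ [[n _ <-]|[q _ <-]].
    have [q [m qn]] := i_frac n; exists q, (SM q * UM m); split.
      by apply: sM; [exact: fock_span_S|exact: fock_span_U].
    rewrite (fock_US_frac qn); exact: esym (iotaE (liftsM (lifts_S q) (lifts_U m))).
  have [p [r qr]] := nz_frac q; exists r, (SM p); split; first exact: fock_span_S.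
  by rewrite (iota_S p) fock_SM qr.
split.
- exists (nonzero1 R), 0; split=> //; rewrite mul0r; apply/esym/iotaE; exact: lifts0.
- move=> c T1 T2 [b1 [a1 [sa1 e1]]] [b2 [a2 [sa2 e2]]].
  exists (nonzero_mul b1 b2), (c *: (a1 * SM b2) + a2 * SM b1); split.
    by apply: sP; exact: sS.
  rewrite (iota_lin c (fock_span_sub (sS b2 _ sa1)) (fock_span_sub (sS b1 _ sa2))).
  rewrite -(iS b2 _ sa1) -(iS b1 _ sa2) -e1 -e2 mulrDl -scalerAl -!mulrA !fock_SM -!frac_M.
  by rewrite (nonzero_mulC b2 b1).
(* T1 T2 S_b2 S_b1 = T1 iota(a2) S_b1 = T1 S_b1 iota(a2') = iota(a1) iota(a2'). *)
- move=> T1 T2 [b1 [a1 [sa1 e1]]] [b2 [a2 [sa2 e2]]].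
  have [a2' sa2' e2'] := fock_span_commute b1 sa2.
  exists (nonzero_mul b2 b1), (a1 * a2'); split; first exact: sM.
  have e : iota (SM b1 * a2') = SN (frac_nz b1) * iota a2'.
    exact: (iotaE (liftsM (lifts_S b1) (iotaP (fock_span_sub sa2')))).
  rewrite frac_M -fock_SM mulrA -(mulrA T1) e2 -mulrA (iS _ _ sa2) e2' e mulrA e1.
  exact: esym (iotaM (fock_span_sub sa1) (fock_span_sub sa2')).
Qed.

(** * The universal property of the envelope *)

Section UniversalProperty.
Variables (D : cstarType K) (j : bop K X -> D).
Hypothesis j_hom : unital_ci_hom A j.
Hypothesis j_gen : cstar_algebra (j @` A) = setT.

Lemma j_norm a : A a -> cnorm (j a) = cnorm a.
Proof.
move=> Aa; have [_ _ _ jci] := j_hom; apply: EFin_inj; rewrite -!mxnorm1.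
have [A0' _ _] := A_sub.
rewrite -(jci _ (a%:M)); last by move=> k l; rewrite mxE !ord1 eqxx mulr1n.
by congr mxnorm; apply/matrixP => k l; rewrite !mxE !ord1 eqxx !mulr1n.
Qed.

Let S : set (D * bop K Y) := [set p | exists2 a, A a & p = (j a, iota a)].

Lemma envelope_map : exists phi : D -> bop K Y,
  [/\ forall (c : K[i]) d e, phi (c *: d + e) = c *: phi d + phi e,
      {morph phi : d e / d * e}, {morph phi : d / adj d},
      forall d, opnorm (phi d) <= cnorm d & forall a, A a -> phi (j a) = iota a].
Proof.
have [j1 jl jm jci] := j_hom; have [A00 AP AM] := A_sub.
have S1 : S (1, 1) by exists 1; [exact: fock_algebra1|rewrite j1 iota1].
have Slin (c : K[i]) p q : S p -> S q -> S (c *: p.1 + q.1, c *: p.2 + q.2).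
  move=> [a Aa ->] [b Ab ->] /=; exists (c *: a + b); first exact: AP.
  by rewrite jl// iota_lin.
have Scc n (m : 'M[D * bop K Y]_n) : (forall k l, S (m k l)) ->
    (mxnorm (map_mx snd m) <= mxnorm (map_mx fst m))%E.
  move=> Sm; have ex k l : {a | A a & m k l = (j a, iota a)} := cid2 (Sm k l).
  pose a : 'M[bop K X]_n := \matrix_(k, l) s2val (ex k l).
  have Aa k l : A (a k l) by rewrite mxE; case: (ex k l).
  have ma k l : m k l = (j (a k l), iota (a k l)) by rewrite mxE; case: (ex k l).
  have e2 : map_mx snd m = map_mx iota a.
    by apply/matrixP => k l; rewrite [LHS]mxE ma [RHS]mxE.
  have e1 : map_mx fst m = map_mx j a.
    by apply/matrixP => k l; rewrite [LHS]mxE ma [RHS]mxE.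
  by rewrite e1 e2 (iota_mxnorm Aa) (jci _ _ Aa).
have [phi [phil phia phin phiS phiM]] := positive_extension S1 Slin Scc.
have phij a : A a -> phi (j a) = iota a.
  by move=> Aa; apply: (phiS (j a, iota a)); exists a.
have phi0 : phi 0 = 0.
  by have := phil (-1) 0 0; rewrite scaler0 addr0 scaleN1r addNr.
have phiB d e : phi (d - e) = phi d - phi e.
  by have := phil (-1) e d; rewrite !scaleN1r [- e + d]addrC => ->; rewrite addrC.
(* Requiring the condition of both c and c^* makes this set self-adjoint, hence a closed
   *-subalgebra that fills [D] once it contains j(A). *)
pose mult : set D := [set c | (forall d, phi (d * c) = phi d * phi c) /\
  (forall d, phi (d * adj c) = phi d * phi (adj c))].
have mult_sub : subalgebra mult.
  split.
  - by split=> d; rewrite ?adj0 phi0 !mulr0 phi0.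
  - move=> c a b [a1 a2] [b1 b2]; split=> d.
      by rewrite mulrDr -scalerAr !phil a1 b1 mulrDr -scalerAr.
    by rewrite adjD adjZ mulrDr -scalerAr !phil a2 b2 mulrDr -scalerAr.
  - move=> a b [a1 a2] [b1 b2]; split=> d.
      by rewrite mulrA b1 a1 -mulrA -b1.
    by rewrite adjM mulrA a2 b2 -mulrA -a2.
have mult_closed : norm_closed mult.
  have H (c : D) : (forall e : K, 0 < e -> exists2 b, (forall d, phi (d * b) = phi d * phi b) &
      cnorm (c - b) < e) -> forall d, phi (d * c) = phi d * phi c.
    move=> Hc d; apply/eqP; rewrite -subr_eq0; apply/eqP.
    apply: (@cnorm_small _ _ _ (2 * cnorm d)); first by rewrite mulr_ge0 ?cnorm_ge0.
    move=> e /Hc[b bM cb].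
    have -> : phi (d * c) - phi d * phi c = phi (d * (c - b)) - phi d * phi (c - b).
      by rewrite mulrBr !phiB bM mulrBr; abel.
    rewrite (le_trans (cnormD _ _))// cnormN -mulrA mulr_natl mulr2n lerD//.
      rewrite (le_trans (phin _))// (le_trans (cnormM _ _))//.
      by rewrite ler_wpM2l ?cnorm_ge0// ltW.
    rewrite (le_trans (cnormM _ _))// ler_pM ?cnorm_ge0//; first exact: phin.
    by rewrite (le_trans (phin _))// ltW.
  move=> c Hc; split; apply: H => e /Hc[b [b1 b2] cb]; first by exists b.
  by exists (adj b); rewrite // -adjB cnorm_adj.
(* Isometry of V gives the condition for j(a), isometry of V^* the one for its adjoint; this is
   where unitarity is used. *)
have mult_unitary a (V : bop K Y) : A a -> cnorm a <= 1 -> iota a = V ->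
    adjoint V * V = 1 -> V * adjoint V = 1 -> mult (j a).
  move=> Aa a1 aV VV VV'; split; apply: phiM.
  - by rewrite j_norm.
  - by move=> h; rewrite phij// aV isometry_l2norm.
  - by rewrite cnorm_adj j_norm.
  - by move=> h; rewrite phia phij// aV isometry_l2norm// adjointK.
have multT : mult = setT.
  apply/seteqP; split=> // d _; have : setT d by [].
  rewrite -j_gen; move: d; apply: smallest_sub.
    by split=> // a [a1 a2]; split=> d; rewrite ?adjK.
  move=> _ [a Aa <-]; move: a Aa; apply: (@sub_preimage _ j) => //.
  - exact: j_norm.
  - move=> m; apply: (mult_unitary _ (UN (i m))); rewrite ?iota_U//.
    + exact: fock_algebra_U.
    + by rewrite (isometry_cnorm (fock_U_isometry m)).
    + exact: fock_U_isometry.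
    + by rewrite fock_U_adjoint fock_UD subrr fock_U0.
  - move=> r; apply: (mult_unitary _ (SN (frac_nz r))); rewrite ?iota_S//.
    + exact: fock_algebra_S.
    + by rewrite (isometry_cnorm (fock_S_isometry r)).
    + exact: fock_S_isometry.
    + by rewrite SN_adjoint SN_inv.
exists phi; split=> // d e.
by have : mult e by [rewrite multT]; case.
Qed.

Lemma envelope_range (phi : D -> bop K Y) :
  (forall (c : K[i]) d e, phi (c *: d + e) = c *: phi d + phi e) ->
  {morph phi : d e / d * e} -> {morph phi : d / adj d} ->
  (forall d, opnorm (phi d) <= cnorm d) -> (forall a, A a -> phi (j a) = iota a) ->
  range phi = E.
Proof.
move=> phil phim phia phin phij.
have phi0 : phi 0 = 0.
  by have := phil (-1) 0 0; rewrite scaler0 addr0 scaleN1r addNr.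
have phiB d e : phi (d - e) = phi d - phi e.
  by have := phil (-1) e d; rewrite !scaleN1r [- e + d]addrC => ->; rewrite addrC.
have phiD d e : phi (d + e) = phi d + phi e by have := phil 1 d e; rewrite !scale1r.
have [E00 EP EM] := E_sub.
apply/seteqP; split=> [_ [d _ <-]|T ET].
  suff sub : setT `<=` [set d | E (phi d)] by exact: sub.
  rewrite -j_gen; apply: smallest_sub; last first.
    by move=> _ [a Aa <-]; rewrite /= phij//; exact: iota_range_sub.
  split; first split.
  - by rewrite /= phi0.
  - by move=> c a b Ea Eb; rewrite /= phil; exact: EP.
  - by move=> a b Ea Eb; rewrite /= phim; exact: EM.
  - move=> a Ha; apply: E_closed => e /Ha[b Eb ab]; exists (phi b) => //.
    by rewrite -phiB (le_lt_trans (phin _)).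
  - by move=> a Ea; rewrite /= phia; exact: field_fock_adj.
(* With a from the common denominator, |j(a)| = |a| = |iota(a)| = |V S_b| <= |V|. *)
have lift V : E0 V -> {d | phi d = V & cnorm d <= cnorm V}.
  move=> EV; apply: cid2; have [b [a [sa Ta]]] := common_denominator EV.
  have Aa := fock_span_sub sa; have AS := fock_algebra_S (K := K) (M := M) b.
  exists (j a * adj (j (SM b))).
    rewrite phim phia !phij// -Ta (iota_S b) -mulrA [adj _]SN_adjoint SN_inv.
    exact: mulr1.
  rewrite (le_trans (cnormM _ _))// cnorm_adj !j_norm// (isometry_cnorm (fock_S_isometry b)) mulr1.
  rewrite -(iota_norm Aa) -Ta (le_trans (cnormM _ _))//.
  by rewrite (isometry_cnorm (fock_S_isometry _)) mulr1.
have [u [uE ustep uT]] := approx_sequence (closed_algebra_dense ET).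
have [s0 sP sM] : subalgebra E0 by exact: alg_span_subalgebra.
have uB n : E0 (u n.+1 - u n).
  by have := sP (-1) _ _ (uE n) (uE n.+1); rewrite scaleN1r addrC.
(* Lifting the increments of [u] one at a time keeps their norm bounds, so the partial sums converge
   in [D] while phi(v n) = u n. *)
pose v n := \sum_(k < n) s2val (lift _ (uB k)) + s2val (lift _ (uE 0%N)).
have vu n : phi (v n) = u n.
  elim: n => [|n IH]; first by rewrite /v big_ord0 add0r; case: (lift _ (uE 0%N)).
  have -> : v n.+1 = s2val (lift _ (uB n)) + v n.
    by rewrite /v big_ord_recr /= addrA [in RHS](addrC (s2val _)).
  by rewrite phiD IH; case: (lift _ (uB n)) => d /= -> _; rewrite subrK.
have [n||l Hl] := @cnorm_limit _ _ v geometric_bound 0.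
- have -> : v n.+1 - v n = s2val (lift _ (uB n)) by rewrite /v big_ord_recr /=; abel.
  by case: (lift _ (uB n)) => d /= _ /le_trans; apply.
- exact: geometric_bound_le0.
exists l => //; apply: (cnorm_lim_unique (u := u)) => // e /Hl[n Hn]; exists n => k nk.
by rewrite -vu -phiB (le_lt_trans (phin _))// Hn.
Qed.

End UniversalProperty.

Theorem fock_envelope : is_cstar_envelope A E.
Proof.
exists iota; split; [exact: iota_unital_ci_hom|exact: iota_generates|].
move=> D j j_hom j_gen.
have [phi [phil phim phia phin phij]] := envelope_map j_hom j_gen.
have phi1 : phi 1 = 1.
  by have [j1 _ _ _] := j_hom; rewrite -[in LHS]j1 phij ?iota1//; exact: fock_algebra1.
pose phiL := GRing.isLinear.Build K[i] D (bop K Y) *:%R phi phil.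
pose phiM := GRing.isMonoidMorphism.Build D (bop K Y) phi (conj phi1 phim).
pose pi : {lrmorphism D -> bop K Y} := HB.pack phi phiL phiM.
exists pi; split; [exact: phia| |exact: phij].
exact: (envelope_range j_hom j_gen).
Qed.

End FractionField.

Theorem theorem1 (K : realType) (R : idomainType) (M : lmodType R)
    (M_torsion_free : torsion_free M) :
  exists (N : lmodType {fraction R}) (i : {linear M -> N | @tofrac R \; *:%R}),
    injective i /\ is_cstar_envelope (fock_algebra K M) (fock_algebra K N).
Proof.
have [N [i [i_inj i_dense]]] := localization_exists M_torsion_free.
exists N, i; split=> //.
apply: (@fock_envelope K R {fraction R} M N (@tofrac R) i) => //.
- by move=> p q /eqP; rewrite tofrac_eq => /eqP.
- exact: fraction_ratio.
- by move=> r m n; rewrite linearP.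
Qed.
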